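(* Let $N\ge1$, $p,q>0$, let $K$ be a kernel satisfying the standing assumptions in the context with exponent $\beta$, and let $u_0\in L^1_{\rm loc}(\mathbb R^N)$, $u_0\ge0$. Assume $$0<\beta<1\qquad\text{and}\qquad 2<p+q\le 2+\frac{2(1-\beta)}{N+\beta}.$$ Then the problem $$\begin{cases}\displaystyle u_t-\operatorname{div}\Big(\frac{\nabla u}{\sqrt{1+|\nabla u|^2}}\Big)\ge(K\ast u^p)u^q & \text{in }\mathbb R^N\times(0,\infty),\\ u(x,0)=u_0(x)\ge0&\text{in }\mathbb R^N\end{cases}$$ does not have nonnegative nontrivial (weak) solutions.
   Context: Kernel: $K\in C(\mathbb R^N\setminus\{0\})$, $K>0$, $\liminf_{x\to0}K(x)>0$, and there exist $\rho>0$, $c>0$ such that $K(x)\ge c|x|^{-\beta}$ for all $|x|>\rho$. Convolution is in space only: $(K\ast u^p)(x,t)=\int_{\mathbb R^N}K(x-y)u^p(y,t)\,dy$. $\nabla$ and $\operatorname{div}$ are with respect to $x$. Nonnegative weak solutions: with $\mathcal A(\nabla u)=\nabla u/\sqrt{1+|\nabla u|^2}$ (an operator of order $m=2$), these are nonnegative functions $u\in W^{1,2}_{\rm loc}(\mathbb R^N\times(0,\infty))$ such that (i) $\mathcal A(\nabla u)\in[L^{2}_{\rm loc}(\mathbb R^N\times(0,\infty))]^N$; (ii) $(K\ast u^p)u^q\in L^1_{\rm loc}(\mathbb R^N\times(0,\infty))$; and for any nonnegative test function $\varphi\in C^1_c(\mathbb R^N\times\mathbb R)$, $$\int_0^\infty\!\int_{\mathbb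 R^N}(K\ast u^p)u^q\varphi\,dx\,dt\le\int_0^\infty\!\int_{\mathbb R^N}u_t\,\varphi\,dx\,dt+\int_0^\infty\!\int_{\mathbb R^N}\mathcal A(\nabla u)\cdot\nabla\varphi\,dx\,dt,$$ or equivalently $$\int_0^\infty\!\int_{\mathbb R^N}(K\ast u^p)u^q\varphi\,dx\,dt\le-\int_{\mathbb R^N}u_0(x)\varphi(x,0)\,dx-\int_0^\infty\!\int_{\mathbb R^N}u\,\varphi_t\,dx\,dt+\int_0^\infty\!\int_{\mathbb R^N}\mathcal A(\nabla u)\cdot\nabla\varphi\,dx\,dt.$$ *)

(* Defs.v *)
From HB Require Import structures.
From mathcomp Require Import all_boot all_order all_algebra.
From mathcomp Require Import all_classical all_reals all_analysis.

Set Implicit Arguments.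
Unset Strict Implicit.
Unset Printing Implicit Defensive.

Import Order.TTheory GRing.Theory Num.Theory.
Import numFieldNormedType.Exports.

Local Open Scope classical_set_scope.
Local Open Scope ring_scope.

(* The Borel sigma-algebra of R^n, generated by the coordinates, as the
   library does for [n.-tuple T]. *)
Definition rV_display : measure_display -> measure_display.
Proof. exact. Qed.

Section rV_measurable.
Context {R : realType} {n : nat}.

Let coors : 'I_n -> 'rV[R]_n -> R := fun i x => x 0 i.

Let rV_set0 : g_sigma_preimage coors set0.
Proof. exact: sigma_algebra0. Qed.

Let rV_setC A : g_sigma_preimage coors A -> g_sigma_preimage coors (~` A).
Proof. exact: sigma_algebraC. Qed.

Let rV_bigcup (F : (set 'rV[R]_n)^nat) :
  (forall i, g_sigma_preimage coors (F i)) ->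
  g_sigma_preimage coors (\bigcup_i (F i)).
Proof. exact: sigma_algebra_bigcup. Qed.

HB.instance Definition _ :=
  @isMeasurable.Build (rV_display default_measure_display)
    'rV[R]_n (g_sigma_preimage coors) rV_set0 rV_setC rV_bigcup.

Lemma measurable_rV_coord (i : 'I_n) :
  measurable_fun [set: 'rV[R]_n] (fun x : 'rV[R]_n => x 0 i).
Proof.
move=> _ Y mY; rewrite setTI; apply: sub_sigma_algebra => /=.
rewrite -bigcup_seq/=; exists i => /=; first by rewrite mem_index_enum.
by exists Y => //; rewrite setTI.
Qed.

Lemma measurable_fun_rV d (T : measurableType d) (f : T -> 'rV[R]_n) :
  (forall i, measurable_fun [set: T] (fun t => f t 0 i)) ->
  measurable_fun [set: T] f.
Proof.
move=> mf _ A mA; rewrite setTI.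
have : g_sigma_preimage (fun i (t : T) => f t 0 i) `<=` measurable.
  apply: smallest_sub; first exact: sigma_algebra_measurable.
  rewrite -bigcup_seq; apply: bigcup_sub => i _ /= B [C mC <-].
  exact: mf.
apply.
rewrite -[X in g_sigma_preimage X]/(fun i => coors i \o f) g_sigma_preimage_comp.
by exists A => //; rewrite setTI.
Qed.

End rV_measurable.


Section rV_cons.
Context {R : realType} {n : nat}.

Definition consrV (z : measurableTypeR R * 'rV[R]_n) : 'rV[R]_n.+1 :=
  row_mx (z.1 : R)%:M z.2.

Definition unconsrV (x : 'rV[R]_n.+1) : measurableTypeR R * 'rV[R]_n :=
  (x 0 ord0, \row_i x 0 (lift ord0 i)).

Lemma consrVK : cancel consrV unconsrV.
Proof.
move=> [a v]; rewrite /unconsrV /consrV /=; congr (_, _).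
  have -> : (ord0 : 'I_n.+1) = lshift n (ord0 : 'I_1) by apply/val_inj.
  by rewrite (row_mxEl (a%:M : 'rV[R]_1)) mxE.
apply/rowP => i; rewrite mxE.
have -> : lift ord0 i = rshift 1 i by apply/val_inj.
by rewrite (row_mxEr (a%:M : 'rV[R]_1)).
Qed.

Lemma measurable_consrV : measurable_fun [set: _] consrV.
Proof.
apply: measurable_fun_rV => i.
case: (unliftP ord0 i) => [j|] ->.
  rewrite (_ : (fun z => _) = (fun x : 'rV[R]_n => x 0 j) \o snd).
    by apply: measurableT_comp; [exact: measurable_rV_coord|exact: measurable_snd].
  apply/funext => z /=.
  by rewrite -[in RHS](consrVK z) /= mxE.
rewrite (_ : (fun z => _) = fst); first exact: measurable_fst.
by apply/funext => z; rewrite -[in RHS](consrVK z).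
Qed.

Lemma unconsrVK : cancel unconsrV consrV.
Proof.
move=> x; apply/rowP => i; rewrite /consrV /unconsrV /=.
case: (unliftP ord0 i) => [j|] ->.
  have -> : lift ord0 j = rshift 1 j by apply/val_inj.
  rewrite (row_mxEr ((x 0 ord0)%:M : 'rV[R]_1)) mxE; congr (x _ _).
  exact/val_inj.
have -> : (ord0 : 'I_n.+1) = lshift n (ord0 : 'I_1) by apply/val_inj.
by rewrite (row_mxEl ((x 0 (lshift n (ord0 : 'I_1)))%:M : 'rV[R]_1)) mxE.
Qed.

Lemma measurable_unconsrV : measurable_fun [set: _] unconsrV.
Proof.
apply/measurable_fun_pairP; split; first exact: measurable_rV_coord.
apply: measurable_fun_rV => i.
rewrite (_ : (fun t => _) = (fun x : 'rV[R]_n.+1 => x 0 (lift ord0 i))).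
  exact: measurable_rV_coord.
by apply/funext => x; rewrite mxE.
Qed.

Variable m : {sigma_finite_measure set 'rV[R]_n -> \bar R}.

Definition lebesgue_cons : set 'rV[R]_n.+1 -> \bar R :=
  pushforward (@lebesgue_measure R \x m)%E consrV.

Let lebesgue_cons0 : lebesgue_cons set0 = 0%E.
Proof. by rewrite /lebesgue_cons /pushforward preimage_set0 measure0. Qed.

Let lebesgue_cons_ge0 A : (0 <= lebesgue_cons A)%E.
Proof. rewrite /lebesgue_cons /pushforward; exact: measure_ge0. Qed.

Let lebesgue_cons_sigma_additive : semi_sigma_additive lebesgue_cons.
Proof.
exact: (@measure_semi_sigma_additive _ _ _
  (measure_function_pushforward__canonical__measure_function_Measure
     (@lebesgue_measure R \x m)%E measurable_consrV)).
Qed.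

HB.instance Definition _ := isMeasure.Build _ _ _ lebesgue_cons
  lebesgue_cons0 lebesgue_cons_ge0 lebesgue_cons_sigma_additive.

Let lebesgue_cons_sigma_finite : sigma_finite setT lebesgue_cons.
Proof.
have /sigma_finiteP[F [TF ndF Foo]] := sigma_finiteT (@lebesgue_measure R).
have /sigma_finiteP[G [TG ndG Goo]] := sigma_finiteT m.
exists (fun k => unconsrV @^-1` (F k `*` G k)).
  rewrite -preimage_bigcup -[LHS](preimage_setT unconsrV); congr (_ @^-1` _).
  rewrite -setXTT TF TG predeqE => -[x y]; split.
    move=> [/= [i _ Fix] [j _ Gjy]]; exists (maxn i j) => //; split.
    - by move: x Fix; exact/subsetPset/ndF/leq_maxl.
    - by move: y Gjy; exact/subsetPset/ndG/leq_maxr.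
  by move=> [k _ []/= ? ?]; split; exists k.
move=> k; have [mF Fk] := Foo k; have [mG Gk] := Goo k; split.
  by rewrite -[X in measurable X]setTI; apply: measurable_unconsrV => //;
    exact: measurableX.
rewrite /lebesgue_cons /pushforward -comp_preimage.
rewrite (_ : unconsrV \o consrV = id); last first.
  by apply/funext => z; exact: consrVK.
rewrite preimage_id product_measure1E//.
by rewrite lte_mul_pinfty// ge0_fin_numE.
Qed.

HB.instance Definition _ := Measure_isSigmaFinite.Build _ _ _ lebesgue_cons
  lebesgue_cons_sigma_finite.

End rV_cons.

(* Lebesgue measure on R^n: the n-fold product of the one on R. *)
Fixpoint lebesgue_rV (R : realType) (n : nat) :
    {sigma_finite_measure set 'rV[R]_n -> \bar R} :=
  match n with
  | 0 => [the {sigma_finite_measure set 'rV[R]_0 -> \bar R} of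
            @dirac _ 'rV[R]_0 (0 : 'rV[R]_0) R]
  | n'.+1 => [the {sigma_finite_measure set 'rV[R]_n'.+1 -> \bar R} of
                lebesgue_cons (lebesgue_rV R n')]
  end.

Lemma measurable_rV_box (R : realType) (n : nat) (A : 'I_n -> set R) :
  (forall i, measurable (A i)) ->
  measurable [set x : 'rV[R]_n | forall i, A i (x 0 i)].
Proof.
move=> mA.
rewrite (_ : [set x | _] =
    \big[setI/setT]_(i < n) [set x : 'rV[R]_n | A i (x 0 i)]).
  apply: bigsetI_measurable => i _; rewrite -[X in measurable X]setTI.
  exact: measurable_rV_coord.
rewrite -bigcap_seq; apply/seteqP; split => x /= Ax i; first by move=> _.
by apply: Ax => /=; rewrite mem_index_enum.
Qed.

Lemma lebesgue_rV_box (R : realType) (n : nat) (A : 'I_n -> set R) :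
  (forall i, measurable (A i)) ->
  lebesgue_rV R n [set x | forall i, A i (x 0 i)] =
  (\prod_(i < n) lebesgue_measure (A i))%E.
Proof.
elim: n A => [|n IHn] A mA.
  rewrite big_ord0 /= diracE mem_set //=.
  by case.
have mbox := @measurable_rV_box R n (fun i => A (lift ord0 i)) (fun i => mA _).
rewrite big_ord_recl -(IHn (fun i => A (lift ord0 i))) => [|i]; last exact: mA.
rewrite -product_measure1E//; last exact: mA.
rewrite [LHS]/= /lebesgue_cons /pushforward; congr (product_measure1 _ _ _).
have E0 (z : measurableTypeR R * 'rV[R]_n) : consrV z 0 ord0 = z.1.
  by rewrite -[in RHS](consrVK z).
have ES (z : measurableTypeR R * 'rV[R]_n) i : consrV z 0 (lift ord0 i) = z.2 0 i.
  by rewrite -[in RHS](consrVK z) /= mxE.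
apply/seteqP; split => z /=.
  move=> Az; split; first by have := Az ord0; rewrite E0.
  by move=> i; have := Az (lift ord0 i); rewrite ES.
by move=> [A0 AS] i; case: (unliftP ord0 i) => [j|] ->; rewrite ?ES ?E0.
Qed.

Section weak_solutions.
Context {R : realType} {N : nat}.

Local Notation space := ('rV[R]_N).
Local Notation spacetime := ('rV[R]_N * R)%type.

Definition lebesgue_spacetime :
    {measure set ('rV[R]_N * measurableTypeR R)%type -> \bar R} :=
  (lebesgue_rV R N \x @lebesgue_measure R)%E.

Local Notation dx := (lebesgue_rV R N).
Local Notation dxdt := lebesgue_spacetime.

(* The library's norm on ['rV[R]_N] is the sup norm. *)
Definition dotmul (x y : space) : R := \sum_(i < N) x 0 i * y 0 i.
Definition enorm (x : space) : R := Num.sqrt (dotmul x x).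

Definition positive_times : set spacetime := [set z | 0 < z.2].
Local Notation Omega := positive_times.

Definition space_L1loc (f : space -> R) :=
  forall C : set space, compact C -> dx.-integrable C (EFin \o f).

Definition L1loc (f : spacetime -> \bar R) :=
  forall C : set spacetime, compact C -> C `<=` Omega ->
    dxdt.-integrable C f.

Definition L2loc (f : spacetime -> R) :=
  measurable_fun Omega f /\ L1loc (fun z => (f z ^+ 2)%:E).

Definition supp (phi : spacetime -> R) : set spacetime :=
  closure [set z | phi z != 0].

Definition C1c (phi : spacetime -> R) :=
  [/\ forall z, differentiable phi z,
      forall v, continuous ('D_v phi)
    & compact (supp phi)].

Definition partial_t (phi : spacetime -> R) (z : spacetime) : R :=
  'D_((0 : 'rV[R]_N), (1 : R)) phi z.
Definition partial_x (i : 'I_N) (phi : spacetime -> R) (z : spacetime) : R :=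
  'D_((delta_mx 0 i : 'rV[R]_N), (0 : R)) phi z.
Definition grad_x (phi : spacetime -> R) (z : spacetime) : space :=
  \row_i partial_x i phi z.

(* [g] is the weak derivative of [u] on R^N x (0, oo), for the classical
   derivative [d]. *)
Definition weak_derivative (d : (spacetime -> R) -> (spacetime -> R))
    (u g : spacetime -> R) :=
  forall phi, C1c phi -> supp phi `<=` Omega ->
  (\int[dxdt]_(z in Omega) (u z * d phi z)%:E =
   - \int[dxdt]_(z in Omega) (g z * phi z)%:E)%E.

(* [u] is in W^{1,2}_loc(R^N x (0, oo)), with weak time derivative [ut] and
   weak spatial gradient [Du]. *)
Definition W12loc (u ut : spacetime -> R) (Du : spacetime -> space) :=
  [/\ L2loc u, L2loc ut, forall i, L2loc (fun z => Du z 0 i),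
      weak_derivative partial_t u ut
    & forall i, weak_derivative (partial_x i) u (fun z => Du z 0 i)].

Definition mean_curvature_op (xi : space) : space :=
  (Num.sqrt (1 + enorm xi ^+ 2))^-1 *: xi.
Local Notation A := mean_curvature_op.

(* The value of [K] at 0 is irrelevant. *)
Definition admissible_kernel (beta : R) (K : space -> R) :=
  [/\ forall x, x != 0 -> {for x, continuous K},
      forall x, x != 0 -> 0 < K x,
      (0 < limf_einf (EFin \o K) (0%R : space)^')%E
    & exists rho c : R, [/\ 0 < rho, 0 < c &
        forall x, rho < enorm x -> c * enorm x `^ (- beta) <= K x]].

Definition conv_pow (K : space -> R) (p : R) (u : spacetime -> R)
    (z : spacetime) : \bar R :=
  (\int[dx]_y (K (z.1 - y) * u (y, z.2) `^ p)%:E)%E.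

(* With the convention 0 * +oo = 0. *)
Definition source (K : space -> R) (p q : R) (u : spacetime -> R)
    (z : spacetime) : \bar R :=
  (conv_pow K p u z * (u z `^ q)%:E)%E.

(* An integral over R^N x (0, oo) whose positive and negative parts are both
   infinite takes the value -oo, and so does any sum in which it occurs: with
   all signs inside the integrals, the two inequalities below fail when their
   right-hand side is undefined. *)
Definition weak_ineq (K : space -> R) (p q : R) (u ut : spacetime -> R)
    (Du : spacetime -> space) (phi : spacetime -> R) :=
  (\int[dxdt]_(z in Omega) (source K p q u z * (phi z)%:E) <=
   \int[dxdt]_(z in Omega) (ut z * phi z)%:E +
   \int[dxdt]_(z in Omega) (dotmul (A (Du z)) (grad_x phi z))%:E)%E.

Definition weak_ineq_initial (K : space -> R) (p q : R) (u0 : space -> R)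
    (u : spacetime -> R) (Du : spacetime -> space) (phi : spacetime -> R) :=
  (\int[dxdt]_(z in Omega) (source K p q u z * (phi z)%:E) <=
   \int[dx]_x (- (u0 x * phi (x, 0)%R))%:E +
   \int[dxdt]_(z in Omega) (- (u z * partial_t phi z))%:E +
   \int[dxdt]_(z in Omega) (dotmul (A (Du z)) (grad_x phi z))%:E)%E.

(* The two integral formulations differ by an integration by parts in time;
   functions satisfying either of them count as solutions. *)
Definition weak_solution (K : space -> R) (p q : R) (u0 : space -> R)
    (u : spacetime -> R) :=
  {ae dxdt, forall z, Omega z -> 0 <= u z} /\
  exists (ut : spacetime -> R) (Du : spacetime -> space),
    [/\ W12loc u ut Du,
        forall i, L2loc (fun z => A (Du z) 0 i),
        L1loc (source K p q u)
      & (forall phi, C1c phi -> (forall z, 0 <= phi z) ->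
           weak_ineq K p q u ut Du phi) \/
        (forall phi, C1c phi -> (forall z, 0 <= phi z) ->
           weak_ineq_initial K p q u0 u Du phi)].

Definition nontrivial (u : spacetime -> R) :=
  ~ {ae dxdt, forall z, Omega z -> u z = 0}.

End weak_solutions.

(* Main.v *)
From HB Require Import structures.
Require Import Defs.
From mathcomp Require Import all_boot all_order all_algebra.
From mathcomp Require Import all_classical all_reals all_analysis.
From mathcomp Require Import finmap measurable_realfun ring lra.

Import Order.TTheory GRing.Theory Num.Theory.
Import numFieldNormedType.Exports.

Local Open Scope classical_set_scope.
Local Open Scope ring_scope.

(** The theorem is a Fujita-type nonexistence result, proved by the method of
rescaled test functions.

Write s = (p + q)/2, so that 1 < s < 2. For test functions supported in
t > 0 both weak formulations reduce to the same inequality, without initial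
data ([weak_ineq_initial_away]).
The mean curvature flux A(Du) is bounded by 1 and satisfies
A(Du).Du >= |A(Du)|^2; testing with g(u) phi, where
g(u) = 1 + (1 + u/kappa)^(-d), 0 < d < 1, makes the term containing g' < 0
absorb the flux term, and leaves, for |grad phi|^2 <= phi psi and
- d_t phi <= psi,
  S := int source phi <= C kappa int (1 + u/kappa)^(1+d) psi
([caccioppoli]). The function g(u) phi need not be of class C1, so u is
first mollified; since the flux is bounded, every term passes to the limit by
convergence in L1 ([key_inequality]).

Take for phi the cutoff at scale r in space and r^2 in time, so that psi is of
size r^(-2), and the height kappa = r^(-(N+beta)). If 1 + d = s k/(k+1) and
phi is, up to a ramp in time, a (k+1)-th power, then (1 + u/kappa)^(1+d) psi is at most a multiple of
r^(-2) (1 + (u/kappa)^s phi) on the support of phi. On the other side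
K >= c r^(-beta) on the balls that matter, hence
S >= c r^(-beta) int A_p(t) A_q(t) dt with A_e(t) = int u^e phi dx
([source_lower_bound]), while A_s <= lambda/2 A_p A_q + 1/(2 lambda) for every
lambda > 0 ([moment_young]). With the right lambda half of S is absorbed, and
  S <= C (r^(-beta) + r^(2(N+beta)(s-1) - 2 + beta)) <= C r^(-beta),
the last step being exactly the hypothesis on p + q ([energy_decay]). As S
increases with r it vanishes for every r, hence so does A_p A_q, and u = 0
almost everywhere. *)

Set Implicit Arguments.
Unset Strict Implicit.
Unset Printing Implicit Defensive.

(** * Approximate identities *)

(** The integral of a nonnegative function is a supremum over the simple functions
below it, so that no measurability is involved. This is how the
source term is compared. *)
Lemma ge0_le_integral_all d (T : measurableType d) (R : realType)
    (mu : {measure set T -> \bar R}) (D : set T) (f g : T -> \bar R) :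
  (forall x, D x -> (0 <= f x)%E) -> (forall x, D x -> (f x <= g x)%E) ->
  (\int[mu]_(x in D) f x <= \int[mu]_(x in D) g x)%E.
Proof.
move=> f0 fg.
have g0 x : D x -> (0 <= g x)%E by move=> Dx; exact: le_trans (f0 _ Dx) (fg _ Dx).
rewrite !ge0_integralE//.
apply: le_ereal_sup => _ [h hf <-]; exists h => //= x; apply: (le_trans (hf x)); rewrite !patchE; case: ifPn => // xD.
exact/fg/set_mem.
Qed.

Section approximate_identity.
Context d (T : measurableType d) (R : realType).
Variable mu : {sigma_finite_measure set T -> \bar R}.
Variable k : nat -> T -> T -> R.
Hypothesis k_ge0 : forall n z w, 0 <= k n z w.
Hypothesis k_bounded : forall n, exists M, forall z w, k n z w <= M.
Hypothesis measurable_k :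
  forall n, measurable_fun [set: T * T] (fun zw => k n zw.1 zw.2).
Hypothesis k_int1 : forall n z, (\int[mu]_w (k n z w)%:E = 1)%E.
Hypothesis k_int2 : forall n w, (\int[mu]_z (k n z w)%:E = 1)%E.

Local Notation L1 f := (mu.-integrable [set: T] (EFin \o f)).

(** The kernels [k n] are meant to concentrate on the diagonal as [n] grows. *)
Definition smoothing n (f : T -> R) (z : T) : R := \int[mu]_w (k n z w * f w).

Lemma measurable_k1 n z : measurable_fun [set: T] (k n z).
Proof. exact: (measurableT_comp (measurable_k n) (pair1_measurable z)). Qed.

Lemma measurable_k2 n w : measurable_fun [set: T] (fun z => k n z w).
Proof. exact: (measurableT_comp (measurable_k n) (pair2_measurable w)). Qed.

Lemma integrable_kM n z f : L1 f -> L1 (fun w => k n z w * f w).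
Proof.
move=> f1.
have -> : EFin \o (fun w => k n z w * f w) =
   ((EFin \o k n z) \* (EFin \o f))%E.
  by apply/funext => w /=; rewrite EFinM.
apply: integrableMr => //; first exact: measurable_k1.
have [M kM] := k_bounded n.
exists M; split; first exact: num_real.
move=> x Mx w _ /=; rewrite ger0_norm//; exact: le_trans (kM _ _) (ltW Mx).
Qed.

(** The total mass of k(z, w) in z is 1, which is what makes the operator a
contraction of L1 and mass preserving. *)
Lemma integral_kM_norm n f : L1 f ->
  (\int[mu]_w \int[mu]_z (`|k n z w * f w|)%:E = \int[mu]_w (`|f w|)%:E)%E.
Proof.
move=> f1; apply: eq_integral => w _.
under eq_integral do rewrite normrM (ger0_norm (k_ge0 _ _ _)) mulrC EFinM.
rewrite ge0_integralZl//; first by rewrite k_int2 mule1.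
- by apply/measurable_EFinP; exact: measurable_k2.
- by move=> z _; rewrite lee_fin.
Qed.

Lemma measurable_kM n f : L1 f ->
  measurable_fun [set: T * T] (fun zw => k n zw.1 zw.2 * f zw.2).
Proof.
move=> /measurable_int/measurable_EFinP mf.
apply: measurable_funM; first exact: measurable_k.
exact: measurableT_comp mf measurable_snd.
Qed.

Lemma integrable_kM2 n f : L1 f ->
  (mu \x mu)%E.-integrable setT (EFin \o (fun zw : T * T => k n zw.1 zw.2 * f zw.2)).
Proof.
move=> f1; apply/integrable21ltyP.
  by apply/measurable_EFinP; exact: measurable_kM.
under eq_integral do under eq_integral do rewrite /=.
rewrite integral_kM_norm//; by case/integrableP : f1.
Qed.

Lemma smoothing_fubini n f : L1 f ->
  EFin \o smoothing n f =
  fubini_F mu (EFin \o (fun zw : T * T => k n zw.1 zw.2 * f zw.2)).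
Proof.
move=> f1; apply/funext => z /=.
rewrite /smoothing /fubini_F /= /Rintegral fineK//.
exact: integrable_fin_num (integrable_kM n z f1).
Qed.

Lemma integrable_smoothing n f : L1 f -> L1 (smoothing n f).
Proof.
by move=> f1; rewrite smoothing_fubini//; exact/integrable_fubini_F/integrable_kM2.
Qed.

Lemma integral_smoothing n f : L1 f ->
  (\int[mu]_z (smoothing n f z)%:E = \int[mu]_z (f z)%:E)%E.
Proof.
move=> f1.
rewrite -[LHS]/(\int[mu]_z (EFin \o smoothing n f) z)%E smoothing_fubini//.
rewrite /fubini_F Fubini; last exact: integrable_kM2.
apply: eq_integral => w _ /=.
under eq_integral do rewrite mulrC EFinM.
rewrite integralZl//; first by rewrite k_int2 mule1.
apply/integrableP; split.
  by apply/measurable_EFinP; exact: measurable_k2.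
under eq_integral do rewrite abse_EFin ger0_norm//.
by rewrite k_int2 ltry.
Qed.

Lemma le_smoothing n f : L1 f ->
  (\int[mu]_z (`|smoothing n f z|)%:E <= \int[mu]_z (`|f z|)%:E)%E.
Proof.
move=> f1; rewrite -(integral_kM_norm n f1).
rewrite -(@sfinite_Fubini _ _ _ _ _ mu mu
  (fun zw : T * T => `|k n zw.1 zw.2 * f zw.2|%:E))//; last first.
  by apply/measurable_EFinP/measurableT_comp => //; exact: measurable_kM.
apply: ge0_le_integral => //.
- by apply/measurable_EFinP/measurableT_comp => //;
    exact/measurable_EFinP/(measurable_int mu)/integrable_smoothing.
- apply: (measurable_fun_fubini_tonelli_F
    (fun zw : T * T => `|k n zw.1 zw.2 * f zw.2|%:E)) => //.
  by apply/measurable_EFinP/measurableT_comp => //; exact: measurable_kM.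
- move=> z _.
  rewrite EFin_normr_Rintegral//; last exact: integrable_kM.
  apply: le_abse_integral => //.
  exact: measurable_int (integrable_kM n z f1).
Qed.

(** The limit is spelled out to avoid convergence in the extended reals. *)
Definition smoothing_cvg f := forall e : R, 0 < e -> \forall n \near \oo,
  (\int[mu]_z (`|smoothing n f z - f z|)%:E <= e%:E)%E.

Lemma smoothingD n f g z : L1 f -> L1 g ->
  smoothing n (fun z => f z + g z) z = smoothing n f z + smoothing n g z.
Proof.
move=> f1 g1; rewrite /smoothing -RintegralD//; try exact: integrable_kM.
by apply: eq_Rintegral => w _; rewrite mulrDr.
Qed.

Lemma smoothingZ n a f z : L1 f ->
  smoothing n (fun z => a * f z) z = a * smoothing n f z.
Proof.
move=> f1; rewrite /smoothing -RintegralZl//; last exact: integrable_kM.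
by apply: eq_Rintegral => w _; rewrite mulrCA.
Qed.

Lemma L1D f g : L1 f -> L1 g -> L1 (fun z => f z + g z).
Proof.
move=> f1 g1; rewrite (_ : _ \o _ = ((EFin \o f) \+ (EFin \o g))%E)//.
exact: integrableD.
Qed.

Lemma L1Z a f : L1 f -> L1 (fun z => a * f z).
Proof.
move=> f1; rewrite (_ : _ \o _ = (fun x => a%:E * (EFin \o f) x)%E)//.
exact: integrableZl.
Qed.

Lemma L1B f g : L1 f -> L1 g -> L1 (fun z => f z - g z).
Proof.
move=> f1 g1; rewrite (_ : (fun z => _) = (fun z => f z + (-1) * g z)).
  by apply: L1D => //; exact: L1Z.
by apply/funext => z; rewrite mulN1r.
Qed.

Lemma L1_norm_measurable f : L1 f -> measurable_fun setT (fun z => (`|f z|)%:E).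
Proof.
move=> f1; apply/measurable_EFinP/measurableT_comp => //.
exact/measurable_EFinP/(measurable_int mu f1).
Qed.

Lemma L1_triangle (f g h : T -> R) : L1 f -> L1 g -> (forall z, `|h z| <= `|f z| + `|g z|) ->
  measurable_fun setT h ->
  (\int[mu]_z (`|h z|)%:E <= \int[mu]_z (`|f z|)%:E + \int[mu]_z (`|g z|)%:E)%E.
Proof.
move=> f1 g1 hfg mh.
rewrite -ge0_integralD//; [|exact: L1_norm_measurable|exact: L1_norm_measurable].
apply: ge0_le_integral => //.
- by apply/measurable_EFinP/measurableT_comp.
- by apply: emeasurable_funD; exact: L1_norm_measurable.
- by move=> z _; rewrite -EFinD lee_fin.
Qed.

Lemma L1_measurable f : L1 f -> measurable_fun setT f.
Proof. by move=> f1; exact/measurable_EFinP/(measurable_int mu f1). Qed.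

Lemma smoothing_cvgD f g : L1 f -> L1 g -> smoothing_cvg f -> smoothing_cvg g ->
  smoothing_cvg (fun z => f z + g z).
Proof.
move=> f1 g1 cf cg e e0.
have e20 : 0 < e / 2 by rewrite divr_gt0.
near=> n.
have fn : L1 (fun z => smoothing n f z - f z) by apply: L1B => //; exact: integrable_smoothing.
have gn : L1 (fun z => smoothing n g z - g z) by apply: L1B => //; exact: integrable_smoothing.
apply: (@le_trans _ _ (\int[mu]_z (`|smoothing n f z - f z|)%:E +
   \int[mu]_z (`|smoothing n g z - g z|)%:E)%E).
  apply: L1_triangle => //.
    by move=> z; rewrite smoothingD// opprD addrACA ler_normD.
  apply: L1_measurable; apply: L1B; last exact: L1D.
  by apply: integrable_smoothing; exact: L1D.
rewrite [e]splitr EFinD; apply: leeD.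
  by near: n; exact: cf.
by near: n; exact: cg.
Unshelve. all: end_near. Qed.

Lemma smoothing_cvgZ a f : L1 f -> smoothing_cvg f ->
  smoothing_cvg (fun z => a * f z).
Proof.
move=> f1 cf e e0.
have ea0 : 0 < e / (`|a| + 1) by rewrite divr_gt0// ltr_wpDl.
near=> n.
have fn : L1 (fun z => smoothing n f z - f z) by apply: L1B => //; exact: integrable_smoothing.
rewrite (_ : (\int[mu]_z _)%E = (`|a|%:E * \int[mu]_z (`|smoothing n f z - f z|)%:E)%E).
  apply: (@le_trans _ _ (`|a|%:E * (e / (`|a| + 1))%:E)%E).
    apply: lee_pmul => //; first by apply: integral_ge0 => z _; rewrite lee_fin.
    near: n; exact: cf.
  rewrite -EFinM lee_fin mulrCA ler_piMr ?(ltW e0)//.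
  by rewrite ler_pdivrMr ?ltr_wpDl// mul1r lerDl.
rewrite -ge0_integralZl//; last exact: L1_norm_measurable.
apply: eq_integral => z _; rewrite smoothingZ// -mulrBr normrM EFinM//.
Unshelve. all: end_near. Qed.

(** The functions for which the smoothing converges form a closed set in L1,
because the smoothing operators are contractions. *)
Lemma smoothing_cvg_lim f : L1 f ->
  (forall e : R, 0 < e -> exists g, [/\ L1 g, smoothing_cvg g &
     (\int[mu]_z (`|f z - g z|)%:E <= e%:E)%E]) ->
  smoothing_cvg f.
Proof.
move=> f1 fg e e0.
have e30 : 0 < e / 3 by rewrite divr_gt0.
have [g [g1 cg fge]] := fg _ e30.
near=> n.
have fgn : L1 (fun z => f z - g z) by exact: L1B.
have gn : L1 (fun z => smoothing n g z - g z) by apply: L1B => //; exact: integrable_smoothing.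
have Tfgn : L1 (smoothing n (fun z => f z - g z)) by exact: integrable_smoothing.
have h1 : L1 (fun z => smoothing n (fun z => f z - g z) z - (f z - g z)) by exact: L1B.
have Efg z : f z = (f z - g z) + g z by rewrite subrK.
apply: (@le_trans _ _ (\int[mu]_z (`|smoothing n (fun z => f z - g z) z - (f z - g z)|)%:E
    + \int[mu]_z (`|smoothing n g z - g z|)%:E)%E).
  apply: L1_triangle => //; last first.
    by apply: L1_measurable; apply: L1B => //; exact: integrable_smoothing.
  move=> z; rewrite [in leLHS](_ : smoothing n f z =
     smoothing n (fun z => f z - g z) z + smoothing n g z).
    rewrite [in leLHS](Efg z) opprD addrACA; exact: ler_normD.
  by rewrite -smoothingD//; congr (smoothing _ _ _); apply/funext => ?; rewrite -Efg.
rewrite (_ : e%:E = ((e / 3)%:E + (e / 3)%:E + (e / 3)%:E)%E); last first.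
  by rewrite -!EFinD; congr EFin; lra.
apply: leeD; last by near: n; exact: cg.
apply: (@le_trans _ _ (\int[mu]_z (`|smoothing n (fun z => f z - g z) z|)%:E
    + \int[mu]_z (`|f z - g z|)%:E)%E).
  apply: L1_triangle => //; last exact: L1_measurable.
  by move=> z; exact: ler_normB.
apply: leeD => //; apply: le_trans fge.
exact: le_smoothing.
Unshelve. all: end_near. Qed.

Lemma L1_indic A : measurable A -> (mu A < +oo)%E -> L1 (\1_A : T -> R).
Proof.
move=> mA Aoo; apply/integrableP; split; first exact/measurable_EFinP.
under eq_integral do rewrite /= ger0_norm//.
by rewrite integral_indic// setIT.
Qed.

Lemma cvge0_le (u : (\bar R)^nat) : u @ \oo --> 0%E ->
  forall e : R, 0 < e -> \forall n \near \oo, (u n <= e%:E)%E.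
Proof.
move=> /fine_cvgP[ufin /cvgrPdist_le u0] e e0.
near=> n.
have un : u n \is a fin_num by near: n.
rewrite -(fineK un) lee_fin.
have : `|0 - fine (u n)| <= e by near: n; exact: u0.
by rewrite sub0r normrN; exact: le_trans (ler_norm _).
Unshelve. all: end_near. Qed.

Lemma dominated_cvg_L1 (f_ : nat -> T -> R) (f g : T -> R) :
  (forall n, measurable_fun setT (f_ n)) -> measurable_fun setT f ->
  {ae mu, forall z, f_ ^~ z @ \oo --> f z} -> L1 g ->
  {ae mu, forall z, forall n, `|f_ n z| <= g z} ->
  forall e : R, 0 < e -> \forall n \near \oo,
    (\int[mu]_z (`|f_ n z - f z|)%:E <= e%:E)%E.
Proof.
move=> mf_ mf cf g1 fg.
have c1 : {ae mu, forall z, setT z -> EFin \o f_ ^~ z @ \oo --> (f z)%:E}.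
  by apply: filterS cf => z h _; apply: cvg_EFin => //; exact: nearW.
have c2 : {ae mu, forall z, forall n, setT z -> (`|(f_ n z)%:E| <= (g z)%:E)%E}.
  by apply: filterS fg => z h n _; exact: h.
have [_ c _] := @dominated_convergence _ _ _ mu setT measurableT
  (fun n => EFin \o f_ n) (EFin \o f) (EFin \o g)
  (fun n => (measurable_EFinP _ _).2 (mf_ n)) ((measurable_EFinP _ _).2 mf)
  c1 g1 c2.
exact: (cvge0_le c).
Qed.

Variables (G : set (set T)) (Q : set T).
Hypothesis G_generates : @measurable _ T = <<s G >>.
Hypothesis setI_G : setI_closed G.
Hypothesis k_concentrates :
  forall A z, G A -> A z -> \forall n \near \oo, forall w, k n z w != 0 -> A w.
Hypothesis GQ : G Q.
Hypothesis Qoo : (mu Q < +oo)%E.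

Lemma G_measurable A : G A -> measurable A.
Proof. by move=> GA; rewrite G_generates; exact: sub_sigma_algebra. Qed.

(** Scheffe's argument. The smoothed indicator of A tends to 1 at every point of
A because the kernel concentrates there; nothing is known outside of A, for
instance on the boundary. But smoothing preserves the integral, so that the
L1 distance is the integral of p = |t - 1_A| - (t - 1_A), which vanishes
outside of A and is at most 2 on A: dominated convergence applies to p. *)
Lemma smoothing_cvg_indic_G A : G A -> (mu A < +oo)%E ->
  smoothing_cvg (\1_A : T -> R).
Proof.
move=> GA Aoo.
have mA := G_measurable GA.
have A1 := L1_indic mA Aoo.
pose t n z := smoothing n \1_A z.
have t1 n : L1 (t n) by exact: integrable_smoothing.
have t0 n z : 0 <= t n z.
  by apply: Rintegral_ge0 => w _; rewrite mulr_ge0.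
pose p n z := `|t n z - \1_A z| - (t n z - \1_A z).
have tA n : L1 (fun z => t n z - \1_A z) by exact: L1B.
have tA' n : L1 (fun z => `|t n z - \1_A z|).
  rewrite (_ : _ \o _ = abse \o (EFin \o (fun z => t n z - \1_A z)))//.
  exact: integrable_abse.
have p1 n : L1 (p n) by exact: L1B.
have E n : (\int[mu]_z (`|t n z - \1_A z|)%:E = \int[mu]_z (p n z)%:E)%E.
  under eq_integral => z _ do
    rewrite -[ `|_| ](subrK (t n z - \1_A z)) EFinD -/(p n z).
  rewrite (@integralD _ _ _ mu setT measurableT (EFin \o p n) (EFin \o (fun z => t n z - \1_A z)) (p1 n) (tA n)).
  rewrite (_ : (\int[mu]_z (t n z - \1_A z)%:E)%E = 0%E) ?adde0//.
  under eq_integral do rewrite EFinB.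
  rewrite integralB//; last exact: t1.
  rewrite integral_smoothing// subee//.
  exact: integrable_fin_num A1.
move=> e e0.
suff : \forall n \near \oo, (\int[mu]_z (`|p n z - 0|)%:E <= e%:E)%E.
  apply: filterS => n; rewrite E => /(le_trans _); apply.
  apply: ge0_le_integral => //.
  - by move=> z _; rewrite lee_fin /p subr_ge0 ler_norm.
  - exact: measurable_int (p1 n).
  - by under eq_fun do rewrite subr0; exact: L1_norm_measurable.
  - by move=> z _; rewrite lee_fin subr0 ler_norm.
apply: (@dominated_cvg_L1 p (cst 0) (fun z => 2 * \1_A z)) => //.
- by move=> n; exact: L1_measurable.
- apply: aeW => z.
  have [Az|nAz] := pselect (A z); apply: cvg_near_cst; near=> n.
    rewrite /p.
    suff -> : t n z = 1 by rewrite indicE mem_set//= subrr normr0 subr0.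
    rewrite /t /smoothing.
    rewrite (_ : Rintegral _ _ _ = \int[mu]_w (k n z w)).
      by rewrite /Rintegral k_int1.
    apply: eq_Rintegral => w _.
    have [->|kw] := eqVneq (k n z w) 0; first by rewrite mul0r.
    rewrite indicE mem_set ?mulr1//.
    by move: w kw; near: n; exact: k_concentrates.
  by rewrite /= /p indicE memNset//= subr0 ger0_norm ?subrr.
- exact: L1Z.
- apply: aeW => z n.
  rewrite /p ger0_norm ?subr_ge0 ?ler_norm//.
  have := t0 n z; rewrite indicE; case: (_ \in _); rewrite /= ?mulr1n ?mulr0n;
    [case: (ger0P (t n z - 1))|case: (ger0P (t n z - 0))]; lra.
Unshelve. all: end_near. Qed.

Lemma smoothing_cvg_sum I (r : seq I) (f : I -> T -> R) :
  (forall i, L1 (f i)) -> (forall i, smoothing_cvg (f i)) ->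
  L1 (fun z => \sum_(i <- r) f i z) /\
  smoothing_cvg (fun z => \sum_(i <- r) f i z).
Proof.
move=> f1 fc; elim: r => [|i r [IH1 IHc]].
  under eq_fun do rewrite big_nil; split; first exact: integrable0.
  move=> e e0; near=> n.
  rewrite integral0_eq ?lee_fin ?ltW// => z _.
  rewrite /smoothing (@eq_Rintegral _ _ _ mu _ (cst 0)); last by move=> w _; rewrite mulr0.
  by rewrite /Rintegral integral0 subr0 normr0.
under eq_fun do rewrite big_cons.
by split; [exact: L1D|exact: smoothing_cvgD].
Unshelve. all: end_near. Qed.

Lemma finite_measureIQ A : measurable A -> (mu (A `&` Q) < +oo)%E.
Proof.
move=> mA; apply: le_lt_trans Qoo; have mQ := G_measurable GQ.
apply: le_measure; [|exact: mem_set|exact: subIsetr].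
by apply/mem_set; exact: measurableI.
Qed.

Lemma L1_indicIQ A : measurable A -> L1 (\1_(A `&` Q) : T -> R).
Proof.
move=> mA; apply: L1_indic; last exact: finite_measureIQ.
by apply: measurableI => //; exact: G_measurable.
Qed.

(** From the generating pi-system G to all measurable sets by Dynkin's theorem.
Intersecting with a fixed member Q of G of finite measure keeps all
indicators integrable. *)
Lemma smoothing_cvg_indic A : measurable A ->
  smoothing_cvg (\1_(A `&` Q) : T -> R).
Proof.
move=> mA.
pose P (S : set T) := smoothing_cvg (\1_(S `&` Q) : T -> R).
apply: (@dynkin_induction _ T G P) => //.
- rewrite /P setTI; exact: smoothing_cvg_indic_G.
- move=> S GS; apply: smoothing_cvg_indic_G; first exact: setI_G.
  exact/finite_measureIQ/G_measurable.
- move=> S mS PS.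
  rewrite /P (_ : \1_(~` S `&` Q) =
     fun z => \1_(setT `&` Q) z + (-1) * \1_(S `&` Q) z :> R).
    apply: smoothing_cvgD; [exact: L1_indicIQ|by apply: L1Z; exact: L1_indicIQ| |].
      by rewrite setTI; exact: smoothing_cvg_indic_G.
    by apply: smoothing_cvgZ => //; exact: L1_indicIQ.
  apply/funext => z; rewrite !indicE !in_setI in_setT in_setC.
  by case: (z \in S); case: (z \in Q) => /=; lra.
- move=> F mF tF PF.
  have mU : measurable (\bigcup_i F i) by exact: bigcupT_measurable.
  pose g N (z : T) : R := \sum_(0 <= i < N) \1_(F i `&` Q) z.
  have gE N z : g N z = \1_(\big[setU/set0]_(i < N) F i `&` Q) z.
    rewrite /g; elim: N => [|N IH]; first by rewrite big_geq// big_ord0 set0I indicE in_set0.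
    rewrite big_nat_recr//= IH big_ord_recr/= !indicE !in_setI in_setU.
    have tF' : trivIset (fun x => predT x) F by move=> i j _ _; exact: tF.
    have := @trivIset_bigsetUI _ predT F tF' N N erefl (leqnn N).
    move=> /(congr1 (fun A : set T => z \in A)); rewrite in_setI in_set0.
    by case: (z \in \big[setU/set0]_(i < N) F i); case: (z \in F N);
      case: (z \in Q) => //=; rewrite ?addr0 ?add0r.
  have [g1 gc] : (forall N, L1 (g N)) /\ (forall N, smoothing_cvg (g N)).
    by split=> N; have [] := @smoothing_cvg_sum _ (index_iota 0 N)
      (fun i => \1_(F i `&` Q)) (fun i => L1_indicIQ (mF i)) PF.
  have fc z : g ^~ z @ \oo --> (\1_(\bigcup_i F i `&` Q) z : R).
    under eq_fun do rewrite gE.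
    have [[i _ Fi]|nF] := pselect ((\bigcup_i F i) z); apply: cvg_near_cst.
      exists i.+1 => //= n /= iN.
      rewrite !indicE !in_setI; congr ((_ && _)%:R); rewrite [RHS]mem_set; last by exists i.
      by rewrite mem_set// -bigcup_mkord; exists i.
    apply: nearW => n; rewrite !indicE !in_setI; congr ((_ && _)%:R).
    rewrite [RHS]memNset// memNset// -bigcup_mkord => -[j _ Fj].
    by apply: nF; exists j.
  apply: smoothing_cvg_lim; first exact: L1_indicIQ.
  move=> e e0.
  have : \forall N \near \oo,
      (\int[mu]_z (`|g N z - \1_(\bigcup_i F i `&` Q) z|)%:E <= e%:E)%E.
    apply: (@dominated_cvg_L1 _ _ (\1_(\bigcup_i F i `&` Q))) e0 => //.
    - by move=> n; exact: L1_measurable.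
    - exact/L1_measurable/L1_indicIQ.
    - exact: aeW.
    - exact: L1_indicIQ.
    - apply: aeW => z n; rewrite gE ger0_norm// !indicE ler_nat !in_setI.
      case: (boolP (z \in \big[setU/set0]_(i < n) F i)) => [/set_mem|]; last first.
        by rewrite andFb.
      rewrite -bigcup_mkord => -[i _ Fi].
      by rewrite (@mem_set _ (\bigcup_i F i)) //; exists i.
  case=> N _ /(_ N (leqnn N)) h; exists (g N); split => //.
  by under eq_integral do rewrite distrC.
- by rewrite -G_generates.
Qed.

Import HBSimple.

(** Simple functions are dense in L1, and [smoothing_cvg_indic] applies to them. *)
Lemma smoothing_cvgP f : L1 f -> (forall z, ~ Q z -> f z = 0) -> smoothing_cvg f.
Proof.
move=> f1 f0.
have mQ := G_measurable GQ.
have fQ : mu.-integrable Q (EFin \o f) by exact: integrableS f1.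
have [g [g1 gf /cvge0_le gc]] := approximation_sfun_integrable mQ fQ.
apply: smoothing_cvg_lim => // e e0.
have [N _ /(_ N (leqnn N)) h] := gc _ e0.
pose D y : set T := (g N @^-1` [set y]) `&` Q.
have gE z : (g N \_ Q) z = \sum_(y <- fset_set (range (g N))) y * \1_(D y) z.
  rewrite patchE; case: ifPn => zQ.
    rewrite fimfunE fsbig_finite//=; apply: eq_bigr => y _.
    by rewrite /D !indicE in_setI zQ andbT.
  by rewrite big1// => y _; rewrite /D indicE in_setI (negbTE zQ) andbF mulr0.
have mD y : measurable (g N @^-1` [set y]) by exact: measurable_funPTI.
have [h1 hc] := @smoothing_cvg_sum _ (fset_set (range (g N)))
      (fun y z => y * \1_(D y) z)
      (fun y => L1Z y (L1_indicIQ (mD y)))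
      (fun y => smoothing_cvgZ y (L1_indicIQ (mD y)) (smoothing_cvg_indic (mD y))).
exists (g N \_ Q).
have -> : g N \_ Q = (fun z => \sum_(y <- fset_set (range (g N))) y * \1_(D y) z) :> (T -> R).
  by apply/funext => z; exact: gE.
split => //.
rewrite [leLHS](_ : _ =
    \int[mu]_(z in Q) `|(EFin \o f) z - (g N z)%:E|)%E//.
rewrite [RHS]integral_mkcond; apply: eq_integral => z _.
rewrite -gE !patchE; case: ifPn => //= /negP zQ.
by rewrite f0 ?subr0 ?normr0// => /mem_set.
Qed.

End approximate_identity.

(** * Bounded functions with Lipschitz derivative *)

Section C11.
Context (R : realType) (V : normedModType R).
Implicit Types (f g : V -> R) (D E : V -> V -> R).

(** [D z] is the differential of [f] at [z], and [C] bounds f, the differential,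
its Lipschitz constant and the second-order Taylor remainder. With one
explicit constant, products and integrals with respect to a parameter stay in
the class by elementary estimates, and no differentiation under the integral
sign is needed. *)
Definition C11_with (C : R) f D :=
  [/\ 0 <= C, forall z, `|f z| <= C,
    forall z a h h', D z (a *: h + h') = a * D z h + D z h',
    forall z h, `|D z h| <= C * `|h| &
    (forall z z' h, `|D z h - D z' h| <= C * `|z - z'| * `|h|) /\
    (forall z h, `|f (z + h) - f z - D z h| <= C * `|h| ^+ 2)].

Definition C11 f D := exists C, C11_with C f D.

Lemma C11_with_le C C' f D : C <= C' -> C11_with C f D -> C11_with C' f D.
Proof.
move=> CC' [C0 fC Dl DC [DL fD]].
split => //.
- exact: le_trans CC'.
- by move=> z; exact: le_trans CC'.
- by move=> z h; apply: (le_trans (DC _ _)); rewrite ler_wpM2r.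
- split.
  + move=> z z' h; apply: (le_trans (DL _ _ _)).
    by rewrite !ler_wpM2r.
  + by move=> z h; apply: (le_trans (fD _ _)); rewrite ler_wpM2r// sqr_ge0.
Qed.

Lemma C11_with_lip C f D : C11_with C f D ->
  forall z h, `|f (z + h) - f z| <= 2 * C * `|h|.
Proof.
move=> [C0 fC Dl DC [DL fD]] z h.
have [h1|h1] := lerP `|h| 1.
  have -> : f (z + h) - f z = (f (z + h) - f z - D z h) + D z h by rewrite subrK.
  apply: (le_trans (ler_normD _ _)).
  rewrite -mulrA mulr2n mulrDl mul1r; apply: lerD => //.
  apply: (le_trans (fD _ _)); rewrite expr2.
  by rewrite ler_wpM2l// ler_piMr.
apply: (le_trans (ler_normB _ _)).
apply: (@le_trans _ _ (C + C)); first exact: lerD.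
have := ler_wpM2l C0 (ltW h1); lra.
Qed.

Lemma C11_lin0 C f D : C11_with C f D -> forall z, D z 0 = 0.
Proof.
move=> [_ _ Dl _ _] z.
have := Dl z 1 0 0; rewrite scale1r addr0 mul1r => H.
by apply: (@addrI _ (D z 0)); rewrite -H addr0.
Qed.

Lemma C11_linZ C f D : C11_with C f D -> forall z a h, D z (a *: h) = a * D z h.
Proof.
move=> H z a h; have D0 := C11_lin0 H z.
by case: H => _ _ Dl _ _; have := Dl z a h 0; rewrite !addr0 D0 addr0.
Qed.

Lemma C11_diff f D : C11 f D ->
  [/\ forall z, differentiable f z, forall z v, 'D_v f z = D z v &
      forall v, continuous ('D_v f)].
Proof.
move=> [C H].
have [C0 fC Dl DC [DL fD]] := H.
have lip_cont (g : V -> R) c : (forall x y, `|g x - g y| <= c * `|x - y|) ->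
    continuous g.
  move=> gc x; apply/cvgrPdist_le => e e0; near=> y.
  apply: (le_trans (gc _ _)).
  have c1 : 0 < `|c| + 1 by rewrite ltr_wpDl.
  apply: (@le_trans _ _ ((`|c| + 1) * `|x - y|)).
    by rewrite ler_wpM2r// ler_wpDr// ler_norm.
  rewrite mulrC -ler_pdivlMr//; near: y.
  by apply: cvgr_dist_le; [exact: cvg_id|rewrite divr_gt0].
have DB z h h' : D z (h - h') = D z h - D z h'.
  by have := Dl z (-1) h' h; rewrite scaleN1r mulN1r addrC => ->; rewrite addrC.
have key z : exists L : {linear V -> R}, [/\ L = D z :> (V -> R),
   continuous (L : V -> R) &
   f \o shift z = cst (f z) + (L : V -> R) +o_ (0 : V) id].
  pose L : {linear V -> R} :=
    HB.pack (D z) (GRing.isLinear.Build R V R *:%R (D z) (Dl z)).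
  exists L; split => //.
    apply: (lip_cont _ C) => x y; rewrite /L/= -DB; exact: DC.
  apply/eqaddoP => e e0; near=> h.
  have -> : (f \o shift z - (cst (f z) + L)) h = f (z + h) - f z - D z h.
    by rewrite -[LHS]/(f (h + z) - (f z + D z h)) opprD addrA [h + z]addrC.
  apply: (le_trans (fD _ _)).
  rewrite expr2 mulrA ler_wpM2r//=.
  have c1 : 0 < C + 1 by rewrite ltr_wpDl.
  apply: (@le_trans _ _ ((C + 1) * `|h|)); first by rewrite ler_wpM2r// lerDl.
  rewrite mulrC -ler_pdivlMr//; near: h.
  by apply: nbhs0_le; rewrite divr_gt0// ltr_wpDl.
have dE z : 'd f z = D z :> (V -> R).
  by have [L [LE Lc Ld]] := key z; rewrite -LE; exact: diff_unique.
have df z : differentiable f z.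
  apply/diff_locallyP; rewrite dE; have [L [LE Lc Ld]] := key z.
  by rewrite -LE.
have DE z v : 'D_v f z = D z v by rewrite deriveE// dE.
split => // v.
rewrite (_ : 'D_v f = fun z => D z v); last by apply/funext => z.
apply: (lip_cont _ (C * `|v|)) => x y.
by apply: (le_trans (DL _ _ _)); rewrite mulrAC.
Unshelve. all: end_near. Qed.

Lemma C11M f g D E : C11 f D -> C11 g E ->
  C11 (fun z => f z * g z) (fun z h => f z * E z h + g z * D z h).
Proof.
move=> [C1 H1] [C2 H2].
pose C := Num.max C1 C2.
have {}H1 : C11_with C f D by apply: C11_with_le H1; rewrite le_max lexx.
have {}H2 : C11_with C g E by apply: C11_with_le H2; rewrite le_max lexx orbT.
have L1 := C11_with_lip H1; have L2 := C11_with_lip H2.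
move: H1 H2; rewrite -/C => -[C0 fC Dl DC [DL fD]] [_ gC El EC [EL gE]].
have CC : 0 <= C * C by rewrite mulr_ge0.
exists (10 * (C * C)); split.
- by rewrite mulr_ge0.
- move=> z; rewrite normrM; apply: (@le_trans _ _ (C * C)); first exact: ler_pM.
  lra.
- move=> z a h h'; rewrite Dl El; ring.
- move=> z h; apply: (le_trans (ler_normD _ _)); rewrite !normrM.
  have := ler_pM (normr_ge0 _) (normr_ge0 _) (fC z) (EC z h).
  have := ler_pM (normr_ge0 _) (normr_ge0 _) (gC z) (DC z h).
  have := mulr_ge0 CC (normr_ge0 h); lra.
- split.
  + move=> z z' h.
    have -> : f z * E z h + g z * D z h - (f z' * E z' h + g z' * D z' h) =
      f z * (E z h - E z' h) + (f z - f z') * E z' h +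
      (g z * (D z h - D z' h) + (g z - g z') * D z' h) by ring.
    have F1 : `|f z - f z'| <= 2 * C * `|z - z'|.
      by have := L1 z' (z - z'); rewrite [z' + _]addrC subrK.
    have F2 : `|g z - g z'| <= 2 * C * `|z - z'|.
      by have := L2 z' (z - z'); rewrite [z' + _]addrC subrK.
    apply: (le_trans (ler_normD _ _)); apply: (le_trans (lerD (ler_normD _ _) (ler_normD _ _))).
    rewrite !normrM.
    have := ler_pM (normr_ge0 _) (normr_ge0 _) (fC z) (EL z z' h).
    have := ler_pM (normr_ge0 _) (normr_ge0 _) F1 (EC z' h).
    have := ler_pM (normr_ge0 _) (normr_ge0 _) (gC z) (DL z z' h).
    have := ler_pM (normr_ge0 _) (normr_ge0 _) F2 (DC z' h).
    have := mulr_ge0 CC (mulr_ge0 (normr_ge0 (z - z')) (normr_ge0 h)).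
    nra.
  + move=> z h.
    have -> : f (z + h) * g (z + h) - f z * g z - (f z * E z h + g z * D z h) =
      f z * (g (z + h) - g z - E z h) + g z * (f (z + h) - f z - D z h) +
      (f (z + h) - f z) * (g (z + h) - g z) by ring.
    apply: (le_trans (ler_normD _ _)).
    apply: (le_trans (lerD (ler_normD _ _) (lexx _))).
    rewrite !normrM.
    have := ler_pM (normr_ge0 _) (normr_ge0 _) (fC z) (gE z h).
    have := ler_pM (normr_ge0 _) (normr_ge0 _) (gC z) (fD z h).
    have := ler_pM (normr_ge0 _) (normr_ge0 _) (L1 z h) (L2 z h).
    have := mulr_ge0 CC (sqr_ge0 `|h|).
    rewrite !expr2; nra.
Qed.

Lemma C11_cst (c : R) : C11 (fun=> c) (fun _ _ => 0).
Proof.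
exists `|c|; split => //.
- by move=> *; rewrite mulr0 addr0.
- by move=> z h; rewrite normr0 mulr_ge0.
- split=> [z z' h|z h]; rewrite ?subrr ?subr0 ?normr0 ?mulr_ge0//.
Qed.

Lemma C11_prod I (r : seq I) (f : I -> V -> R) (D : I -> V -> V -> R) :
  (forall i, C11 (f i) (D i)) ->
  exists E, C11 (fun z => \prod_(i <- r) f i z) E.
Proof.
move=> H; elim: r => [|i r [E IH]].
  exists (fun _ _ => 0).
  rewrite (_ : (fun _ => _) = fun=> 1); first exact: C11_cst.
  by apply/funext => z; rewrite big_nil.
rewrite (_ : (fun _ => _) = fun z => f i z * \prod_(j <- r) f j z); last first.
  by apply/funext => z; rewrite big_cons.
by exists (fun z h => f i z * E z h + (\prod_(j <- r) f j z) * D i z h); exact: C11M.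
Qed.

End C11.

Lemma C11_comp_linear (R : realType) (V W : normedModType R) (f : W -> R) D
    (l : V -> W) : (forall a h h', l (a *: h + h') = a *: l h + l h') ->
  (forall h, `|l h| <= `|h|) ->
  C11 f D -> C11 (f \o l) (fun z h => D (l z) (l h)).
Proof.
move=> lL l1 [C [C0 fC Dl DC [DL fD]]].
have lD h h' : l (h + h') = l h + l h' by have := lL 1 h h'; rewrite !scale1r.
have lB h h' : l (h - h') = l h - l h'.
  by rewrite addrC -scaleN1r lL scaleN1r addrC.
exists C; split => //.
- by move=> z; exact: fC.
- by move=> z a h h'; rewrite lL Dl.
- by move=> z h; apply: (le_trans (DC _ _)); rewrite ler_wpM2l.
- split.
    move=> z z' h; apply: (le_trans (DL _ _ _)); rewrite -lB.
    by rewrite -!mulrA ler_wpM2l// ler_pM.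
  move=> z h; rewrite /= lD; apply: (le_trans (fD _ _)).
  by rewrite ler_wpM2l// !expr2 ler_pM.
Qed.

Lemma C11_reflect (R : realType) (V : normedModType R) (f : V -> R) D z :
  C11 f D -> C11 (fun w => f (z - w)) (fun w h => - D (z - w) h).
Proof.
move=> [C H]; have DN y h : D y (- h) = - D y h.
  by rewrite -scaleN1r (C11_linZ H) mulN1r.
case: H => C0 fC Dl DC [DL fD].
exists C; split => //.
- by move=> y a h h'; rewrite Dl; ring.
- by move=> y h; rewrite normrN.
- split=> [y y' h|y h].
    rewrite opprK addrC.
    apply: (le_trans (DL _ _ _)).
    by rewrite opprB [_ + (y - z)]addrC addrA subrK.
  by have := fD (z - y) (- h); rewrite DN normrN opprD addrA.
Qed.

Section bell.
Context (R : realType).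
Implicit Types r x h : R.

(** A compactly supported C1 bump, piecewise polynomial, so that both its
differential and its second-order remainder can be bounded by hand. *)
Definition bell r : R := Num.max 0 (1 - r ^+ 2) ^+ 2.
Definition bell' r : R := - 4 * r * Num.max 0 (1 - r ^+ 2).

Lemma bell_ge0 r : 0 <= bell r. Proof. exact: sqr_ge0. Qed.

Lemma bell_le1 r : bell r <= 1.
Proof.
rewrite /bell; have := sqr_ge0 r; rewrite expr2 => r0.
by case: (lerP 0 (1 - r * r)) => h; rewrite expr2; nra.
Qed.

Lemma bellN r : bell (- r) = bell r. Proof. by rewrite /bell sqrrN. Qed.

Lemma bell_eq0 r : 1 <= `|r| -> bell r = 0.
Proof.
move=> r1; rewrite /bell (max_idPl _) ?expr0n// subr_le0 -real_normK ?num_real//.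
by rewrite expr_ge1.
Qed.

(** The square of the positive part is convex with 2-Lipschitz derivative. *)
Lemma pospart_sqr_taylor (w w' : R) :
  0 <= Num.max 0 w' ^+ 2 - Num.max 0 w ^+ 2 - 2 * Num.max 0 w * (w' - w)
    <= (w' - w) ^+ 2.
Proof.
have w2 := sqr_ge0 w; have w2' := sqr_ge0 w'; have d2 := sqr_ge0 (w' - w).
rewrite !expr2 in w2 w2' d2 *.
have [h|h] := lerP 0 w; have [h'|h'] := lerP 0 w'; apply/andP; split; try lra.
  by have := mulr_ge0_le0 h (ltW h'); lra.
by have := mulr_ge0_le0 h' (ltW h); lra.
Qed.

Lemma bell'_bound r : `|bell' r| <= 4.
Proof.
rewrite /bell' !normrM normrN.
have -> : `|4 : R| = 4 by rewrite ger0_norm.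
rewrite -mulrA ler_piMr//.
have [r1|r1] := lerP 1 `|r|.
  rewrite (max_idPl _) ?normr0 ?mulr0// subr_le0 -real_normK ?num_real//.
  by rewrite expr_ge1.
apply: mulr_ile1 => //; first exact: ltW.
have r2 : r ^+ 2 <= 1 by rewrite -real_normK ?num_real// expr_le1// ltW.
have r0 := sqr_ge0 r.
rewrite (max_idPr _) ?subr_ge0// ger0_norm ?subr_ge0//; lra.
Qed.

Lemma bell'E r : bell' r = if `|r| <= 1 then - 4 * r * (1 - r ^+ 2) else 0.
Proof.
rewrite /bell'; case: ifPn => [r1|]; last rewrite -ltNge => r1.
  rewrite (max_idPr _)// subr_ge0 -real_normK ?num_real//.
  by rewrite expr_le1.
rewrite (max_idPl _) ?mulr0// subr_le0 -real_normK ?num_real//.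
by rewrite expr_ge1// ltW.
Qed.

Lemma bell'_lip r x : `|bell' r - bell' x| <= 8 * `|r - x|.
Proof.
have one (a b : R) : `|a| <= 1 -> 1 < `|b| ->
    `|- 4 * a * (1 - a ^+ 2)| <= 8 * `|a - b|.
  move=> a1 b1.
  have ab : 1 - `|a| <= `|a - b|.
    have := lerB_dist b a; rewrite distrC; lra.
  rewrite !normrM normrN (_ : `|4| = 4 :> R); last by rewrite ger0_norm.
  have -> : `|1 - a ^+ 2| = (1 - `|a|) * (1 + `|a|).
    rewrite ger0_norm; last by rewrite subr_ge0 -real_normK ?num_real// expr_le1.
    by rewrite -[a ^+ 2]real_normK ?num_real//; ring.
  have a0 := normr_ge0 a.
  have a2 : 0 <= 2 + `|a| by lra.
  have := mulr_ge0 (sqr_ge0 (1 - `|a|)) a2; rewrite expr2; lra.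
rewrite !bell'E; case: ifPn => [r1|]; last rewrite -ltNge => r1;
  (case: ifPn => [x1|]; last rewrite -ltNge => x1).
- have -> : - 4 * r * (1 - r ^+ 2) - - 4 * x * (1 - x ^+ 2) =
    (r - x) * (- 4 * (1 - (r ^+ 2 + r * x + x ^+ 2))) by ring.
  rewrite normrM mulrC ler_wpM2r//.
  move: r1 x1; rewrite !ler_norml !expr2 => /andP[? ?] /andP[? ?].
  apply/andP; split; nra.
- by rewrite subr0; exact: one.
- by rewrite sub0r normrN distrC; exact: one.
- by rewrite subrr normr0 mulr_ge0.
Qed.

(** For |h| >= 1, or away from [-1, 1], the terms are bounded one by one;
otherwise the positive part enters through [pospart_sqr_taylor]. *)
Lemma bell_taylor r h : `|bell (r + h) - bell r - bell' r * h| <= 27 * `|h| ^+ 2.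
Proof.
have [h1|h1] := lerP 1 `|h|.
  have A : `|bell (r + h) - bell r| <= 1.
    have := bell_ge0 r; have := bell_ge0 (r + h).
    have := bell_le1 r; have := bell_le1 (r + h).
    by rewrite ler_norml; lra.
  apply: (le_trans (ler_normB _ _)); rewrite normrM.
  have := ler_wpM2r (normr_ge0 h) (bell'_bound r).
  rewrite expr2; nra.
have [r2|r2] := lerP 2 `|r|.
  have rh : 1 <= `|r + h| by have := ler_normB (r + h) h; rewrite addrK; lra.
  have r1 : 1 <= `|r| by lra.
  rewrite (bell_eq0 rh) (bell_eq0 r1) /bell' (max_idPl _).
    by rewrite mulr0 mul0r !subrr normr0 mulr_ge0// sqr_ge0.
  by rewrite subr_le0 -real_normK ?num_real// expr_ge1.
have hh : `|h| ^+ 2 = h ^+ 2 by rewrite real_normK ?num_real.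
rewrite hh.
have /andP[t1 t2] := pospart_sqr_taylor (1 - r ^+ 2) (1 - (r + h) ^+ 2).
set w := Num.max 0 (1 - r ^+ 2) in t1 t2.
have w0 : 0 <= w by rewrite /w le_max lexx.
have w1 : w <= 1 by rewrite /w ge_max ler01 lerBlDr lerDl sqr_ge0.
have sq : (1 - (r + h) ^+ 2 - (1 - r ^+ 2)) ^+ 2 <= 25 * h ^+ 2.
  have -> : (1 - (r + h) ^+ 2 - (1 - r ^+ 2)) ^+ 2 = (2 * r + h) ^+ 2 * h ^+ 2 by ring.
  rewrite ler_wpM2r ?sqr_ge0// -real_normK ?num_real//.
  have -> : 25 = 5 ^+ 2 :> R by ring.
  rewrite lerXn2r ?nnegrE//.
  apply: (le_trans (ler_normD _ _)); rewrite normrM [ `|2| ]ger0_norm//; lra.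
have -> : bell (r + h) - bell r - bell' r * h =
  (Num.max 0 (1 - (r + h) ^+ 2) ^+ 2 - w ^+ 2 -
   2 * w * (1 - (r + h) ^+ 2 - (1 - r ^+ 2))) - 2 * w * h ^+ 2.
  by rewrite /bell /bell' -/w; ring.
have wh : 2 * w * h ^+ 2 <= 2 * h ^+ 2.
  by rewrite ler_wpM2r ?sqr_ge0//; lra.
have wh0 : 0 <= 2 * w * h ^+ 2 by rewrite mulr_ge0 ?sqr_ge0// mulr_ge0.
rewrite ler_norml; lra.
Qed.

Lemma C11_bell (a c : R) :
  C11 ((fun r => c * bell (a * r)) : (R : normedModType R) -> R)
      (fun r h => c * bell' (a * r) * (a * h)).
Proof.
pose C := 27 * `|c| * (1 + `|a|) ^+ 2.
have a0 := normr_ge0 a; have c0 := normr_ge0 c.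
have Ca : 8 * `|c| * `|a| <= C.
  rewrite /C expr2; nra.
have Caa : 27 * `|c| * (`|a| * `|a|) <= C.
  rewrite /C expr2; nra.
have C1 : `|c| <= C by rewrite /C expr2; nra.
have C0 : 0 <= C by exact: le_trans C1.
exists C; split => //.
- move=> z; rewrite normrM; apply: le_trans C1.
  by rewrite ler_piMr// ger0_norm ?bell_ge0// bell_le1.
- move=> z b h h' /=; rewrite -[b *: h]/(b * h); ring.
- move=> z h; rewrite normrM normrM [ `|a * h| ]normrM mulrA ler_wpM2r//.
  have := ler_wpM2l c0 (bell'_bound (a * z)); nra.
- split.
  + move=> z z' h; rewrite -mulrBl -mulrBr normrM normrM [ `|a * h| ]normrM.
    rewrite mulrA ler_wpM2r//.
    have := bell'_lip (a * z) (a * z'); rewrite -mulrBr normrM => H.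
    have := ler_wpM2r a0 (ler_wpM2l c0 H).
    have := ler_wpM2r (normr_ge0 (z - z')) Caa.
    have := mulr_ge0 c0 (mulr_ge0 (mulr_ge0 a0 a0) (normr_ge0 (z - z'))).
    nra.
  + move=> z h.
    rewrite (_ : _ - _ - _ = c * (bell (a * z + a * h) - bell (a * z) - bell' (a * z) * (a * h))).
      rewrite normrM.
      have := ler_wpM2l c0 (bell_taylor (a * z) (a * h)).
      rewrite normrM !expr2.
      have := ler_wpM2r (sqr_ge0 `|h|) Caa; rewrite expr2; nra.
    rewrite mulrDr; ring.
Qed.

Lemma continuous_bell : continuous (bell : R -> R).
Proof.
move=> x.
have [/(_ x) df _ _] := C11_diff (C11_bell 1 1).
have := differentiable_continuous df.
by under [X in {for _, continuous X}]eq_fun do rewrite !mul1r.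
Qed.

End bell.

(** * A mollifier on space-time *)

Section rV_integrals.
Context {R : realType}.
Local Notation leb := (@lebesgue_measure R).

(** Lebesgue measure on R^(n+1) is the image of the product measure. *)
Lemma ge0_integral_lebesgue_cons n (f : 'rV[R]_n.+1 -> \bar R) :
  measurable_fun setT f -> (forall x, (0 <= f x)%E) ->
  (\int[lebesgue_rV R n.+1]_x f x =
   \int[leb]_a \int[lebesgue_rV R n]_v f (consrV (a, v)))%E.
Proof.
move=> mf f0.
rewrite -[LHS]/(\int[pushforward (leb \x lebesgue_rV R n)%E (@consrV R n)]_x f x)%E.
rewrite (@ge0_integral_pushforward _ _ _ _ _ _ measurable_consrV)//=.
rewrite preimage_setT fubini_tonelli1//=.
exact: measurableT_comp mf measurable_consrV.
Qed.

Lemma consrV0 n a (v : 'rV[R]_n) : consrV (a, v) 0 ord0 = a.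
Proof. by have := consrVK (a, v) => /(congr1 fst). Qed.

Lemma consrVS n a (v : 'rV[R]_n) i : consrV (a, v) 0 (lift ord0 i) = v 0 i.
Proof. by have := consrVK (a, v) => /(congr1 (fun z : measurableTypeR R * 'rV[R]_n => z.2 0 i)); rewrite /= mxE. Qed.

Lemma measurable_rV_prod n (f : 'I_n -> R -> R) :
  (forall i, measurable_fun setT (f i)) ->
  measurable_fun setT (fun x : 'rV[R]_n => \prod_(i < n) f i (x 0 i)).
Proof.
move=> mf; apply: measurable_prod => i _.
exact: measurableT_comp (mf i) (measurable_rV_coord i).
Qed.

Lemma integral_rV_prod n (f : 'I_n -> R -> R) (c : 'I_n -> R) :
  (forall i, measurable_fun setT (f i)) -> (forall i x, 0 <= f i x) ->
  (forall i, \int[leb]_x (f i x)%:E = (c i)%:E)%E ->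
  (\int[lebesgue_rV R n]_x (\prod_(i < n) f i (x 0 i))%:E = (\prod_(i < n) c i)%:E)%E.
Proof.
elim: n f c => [|n IH] f c mf f0 fc.
  rewrite big_ord0; under eq_integral do rewrite big_ord0.
  by rewrite integral_cst//= diracE mem_set// mule1.
rewrite ge0_integral_lebesgue_cons; last 2 first.
- by apply/measurable_EFinP; exact: measurable_rV_prod.
- by move=> x; rewrite lee_fin prodr_ge0.
rewrite big_ord_recl EFinM.
transitivity (\int[leb]_a ((f ord0 a)%:E * (\prod_(i < n) c (lift ord0 i))%:E))%E.
  apply: eq_integral => a _.
  under eq_integral do rewrite big_ord_recl consrV0 EFinM.
  rewrite ge0_integralZl//=.
  - congr (_ * _)%E.
    under eq_integral do under eq_bigr do rewrite consrVS.
    by apply: (IH (fun i => f (lift ord0 i)) (fun i => c (lift ord0 i))).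
  - apply/measurable_EFinP.
    under eq_fun do under eq_bigr do rewrite consrVS.
    exact: (@measurable_rV_prod _ (fun i => f (lift ord0 i))).
  - by move=> v _; rewrite lee_fin prodr_ge0.
  - by rewrite lee_fin.
rewrite ge0_integralZr//.
- by rewrite fc.
- by apply/measurable_EFinP; exact: mf.
- by move=> x _; rewrite lee_fin.
- rewrite lee_fin prodr_ge0// => i _.
  by rewrite -lee_fin -fc; apply: integral_ge0 => x _; rewrite lee_fin.
Qed.

End rV_integrals.

Section mollifier1d.
Context {R : realType}.
Local Notation leb := (@lebesgue_measure R).

(** Translation invariance of the Lebesgue measure, by the change of variables
formula. *)
Lemma integral_bell_shift (a t : R) :
  (\int[leb]_x (bell (a * (x - t)))%:E =
   \int[leb]_x (bell (a * x))%:E)%E.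
Proof.
have dF (x : R) : is_derive x 1 (fun x : R => x - t) 1.
  by apply: is_derive_eq; rewrite subr0.
have F'E : (fun x : R => x - t)^`()%classic = cst 1.
  by apply/funext => x; rewrite derive1E derive_val.
rewrite [RHS](@increasing_ge0_integration_by_substitutionT R (fun x => x - t)
  (fun x => bell (a * x))).
- by apply: eq_integral => x _; rewrite F'E /= mulr1.
- by move=> x y xy; rewrite ltrD2r.
- by rewrite F'E => x; exact: cvg_cst.
- by rewrite F'E; exact: is_cvg_cst.
- by rewrite F'E; exact: is_cvg_cst.
- by move=> x; have [] := dF x.
- exact: cvg_addrr_Ny.
- exact: cvg_addrr.
- move=> x; apply: continuous_comp; last exact: continuous_bell.
  exact: mulrl_continuous.
- by move=> x; exact: bell_ge0.
Qed.

Lemma measurable_bell (a : R) : measurable_fun [set: R] (fun x => bell (a * x)).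
Proof.
apply: continuous_measurable_fun => x.
apply: continuous_comp; last exact: continuous_bell.
exact: mulrl_continuous.
Qed.

Definition bell_mass (n : nat) : R :=
  fine (\int[leb]_x (bell (n.+1%:R * x))%:E)%E.

Lemma bell_massE n :
  (\int[leb]_x (bell (n.+1%:R * x))%:E)%E = (bell_mass n)%:E.
Proof.
rewrite /bell_mass fineK// ge0_fin_numE; last first.
  by apply: integral_ge0 => x _; rewrite lee_fin bell_ge0.
apply: (@le_lt_trans _ _ (\int[leb]_x (\1_`[-1, 1]%classic x)%:E)%E).
  apply: ge0_le_integral => //.
  - by move=> x _; rewrite lee_fin bell_ge0.
  - by apply/measurable_EFinP; exact: measurable_bell.
  - exact/measurable_EFinP.
  - move=> x _; rewrite lee_fin indicE.
    have [xI|xI] := boolP (x \in _); first exact: bell_le1.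
    rewrite bell_eq0//= normrM ger0_norm//.
    have x1 : 1 <= `|x|.
      rewrite leNgt; apply: contra xI => /ltW; rewrite ler_norml => x1.
      by apply: mem_set; rewrite /= in_itv.
    by apply: (le_trans x1); rewrite ler_peMl// ler1n.
have Joo : (leb (`[(-1)%R, 1%R]%classic : set R) < +oo)%E.
  by rewrite lebesgue_measure_itv/= lte_fin; case: ifPn => _; rewrite ltry.
by rewrite integral_indic// setIT; exact: Joo.
Qed.

Lemma bell_mass_gt0 n : 0 < bell_mass n.
Proof.
rewrite -lte_fin -bell_massE.
pose J := `[0, (2 * n.+1%:R)^-1 : R]%classic.
have i0 : 0 < (2 * n.+1%:R)^-1 :> R by rewrite invr_gt0 mulr_gt0.
have mJ : measurable (J : set (measurableTypeR R)) by exact: measurable_itv.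
have Jm : leb J = ((2 * n.+1%:R)^-1)%:E.
  by rewrite lebesgue_measure_itv/= lte_fin i0 -EFinD subr0.
have mJ1 : measurable_fun [set: measurableTypeR R] (fun x : measurableTypeR R => (\1_J x)%:E : \bar R).
  by apply/measurable_EFinP; exact: measurable_indic.
apply: (@lt_le_trans _ _ (\int[leb]_x (2^-1%:E * (\1_J x)%:E))%E).
  rewrite ge0_integralZl//.
  rewrite (@integral_indic _ _ _ leb setT measurableT J mJ) setIT.
  rewrite [X in (_ * X)%E](_ : _ = ((2 * n.+1%:R)^-1)%:E)//.
  by rewrite -EFinM lte_fin mulr_gt0// invr_gt0.
apply: ge0_le_integral => //.
- exact: measurable_funeM.
- by apply/measurable_EFinP; exact: measurable_bell.
- move=> x _; rewrite -EFinM lee_fin indicE.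
  have [|_] := boolP (x \in J); last by rewrite mulr0 bell_ge0.
  move=> /set_mem; rewrite /J/= in_itv/= mulr1 => /andP[x0 x1].
  have y1 : n.+1%:R * x <= 2^-1.
    by move: x1; rewrite invfM ler_pdivlMr// mulrC.
  have y0 : 0 <= n.+1%:R * x by rewrite mulr_ge0.
  set y := n.+1%:R * x in y0 y1 *.
  have y2 : y * y <= 4^-1 by nra.
  rewrite /bell (max_idPr _) expr2; nra.
Qed.

Definition moll1 n x : R := (bell_mass n)^-1 * bell (n.+1%:R * x).

Lemma moll1_ge0 n x : 0 <= moll1 n x.
Proof. by rewrite mulr_ge0 ?bell_ge0// invr_ge0 ltW// bell_mass_gt0. Qed.

Lemma measurable_moll1 n : measurable_fun setT (moll1 n).
Proof. by apply: measurable_funM => //; exact: measurable_bell. Qed.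

Lemma integral_moll1 n t :
  (\int[leb]_x (moll1 n (x - t))%:E = 1)%E.
Proof.
under eq_integral do rewrite EFinM.
rewrite ge0_integralZl//.
- by rewrite integral_bell_shift bell_massE -EFinM mulVf// gt_eqF// bell_mass_gt0.
- apply/measurable_EFinP; apply: (measurableT_comp (measurable_bell _)).
  exact: measurable_funB.
- by move=> x _; rewrite lee_fin bell_ge0.
- by rewrite lee_fin invr_ge0 ltW// bell_mass_gt0.
Qed.

Lemma moll1N n x : moll1 n (- x) = moll1 n x.
Proof. by rewrite /moll1 mulrN bellN. Qed.

Lemma moll1_neq0 n x : moll1 n x != 0 -> `|x| < n.+1%:R^-1.
Proof.
move=> h; rewrite ltNge; apply: contra h => h.
rewrite /moll1 bell_eq0 ?mulr0// normrM ger0_norm//.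
by rewrite mulrC -ler_pdivrMr// mul1r.
Qed.

Lemma C11_moll1 n : exists D, C11 (moll1 n : (R : normedModType R) -> R) D.
Proof. by eexists; exact: C11_bell. Qed.

End mollifier1d.

Section mollifier.
Context {R : realType} {N : nat}.
Local Notation leb := (@lebesgue_measure R).
Local Notation Z := ('rV[R]_N * R)%type.
Local Notation mZ := ('rV[R]_N * measurableTypeR R)%type.

Lemma sigma_finite_dxdt : sigma_finite setT (@lebesgue_spacetime R N).
Proof.
have /sigma_finiteP[F [TF ndF Foo]] := sigma_finiteT (lebesgue_rV R N).
have /sigma_finiteP[G [TG ndG Goo]] := sigma_finiteT leb.
exists (fun n => F n `*` G n).
  apply/seteqP; split => // -[x t] _.
  have [i _ Fi] : (\bigcup_i F i) x by rewrite -TF.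
  have [j _ Gj] : (\bigcup_i G i) t by rewrite -TG.
  exists (maxn i j) => //; split.
    by move: Fi; exact/subsetPset/ndF/leq_maxl.
  by move: Gj; exact/subsetPset/ndG/leq_maxr.
move=> n; have [mF Fn] := Foo n; have [mG Gn] := Goo n.
split; first exact: measurableX.
rewrite [ltLHS](_ : _ = (lebesgue_rV R N (F n) * leb (G n))%E);
  last exact: product_measure1E.
by rewrite lte_mul_pinfty// ge0_fin_numE.
Qed.

Definition lebesgue_st : set mZ -> \bar R := @lebesgue_spacetime R N.
HB.instance Definition _ := Measure.on lebesgue_st.
HB.instance Definition _ := Measure_isSigmaFinite.Build _ _ _ lebesgue_st
  sigma_finite_dxdt.

(** The Lebesgue measure of space-time, bundled as a sigma-finite measure as
Tonelli's theorem requires it; it is convertible to [lebesgue_spacetime]. *)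
Definition dxdt : {sigma_finite_measure set mZ -> \bar R} :=
  [the {sigma_finite_measure set mZ -> \bar R} of lebesgue_st].

Lemma norm_coord (z : Z) i : `|z.1 0 i| <= `|z|.
Proof.
apply: (@le_trans _ _ `|z.1|); last by rewrite [leRHS]prod_normE le_max lexx.
rewrite [leRHS](_ : _ = mx_norm z.1)// mx_normrE.
exact: (le_bigmax _ (fun ij => `|z.1 ij.1 ij.2|) (0, i)).
Qed.

Lemma norm_time (z : Z) : `|z.2| <= `|z|.
Proof. by rewrite [leRHS]prod_normE le_max lexx orbT. Qed.

Lemma norm_lt (z : Z) (e : R) : 0 < e -> (forall i, `|z.1 0 i| < e) -> `|z.2| < e -> `|z| < e.
Proof.
move=> e0 z1 z2; rewrite [ltLHS]prod_normE gt_max z2 andbT.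
rewrite [ltLHS](_ : _ = mx_norm z.1)// mx_normrE.
apply: bigmax_lt => // -[i j] _ /=; rewrite ord1; exact: z1.
Qed.

Definition moll n (z : mZ) : R := (\prod_(i < N) moll1 n (z.1 0 i)) * moll1 n z.2.

Definition mkernel n (z w : mZ) : R := moll n (z - w).

Lemma moll_ge0 n z : 0 <= moll n z.
Proof. by rewrite mulr_ge0 ?moll1_ge0// prodr_ge0// => i _; exact: moll1_ge0. Qed.

Lemma mollN n z : moll n (- z) = moll n z.
Proof.
rewrite /moll /= moll1N; congr (_ * _).
by apply: eq_bigr => i _; rewrite mxE moll1N.
Qed.

Lemma moll_neq0 n z : moll n z != 0 -> `|z : Z| < n.+1%:R^-1.
Proof.
rewrite mulf_eq0 negb_or => /andP[z1 z2]; apply: norm_lt.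
- by rewrite invr_gt0.
- move=> i; apply: (@moll1_neq0 _ n).
  by move: z1 => /prodf_neq0 /(_ i isT).
- exact: moll1_neq0 z2.
Qed.

Lemma C11_spacetime_prod (f : R -> R) D : C11 (f : (R : normedModType R) -> R) D ->
  exists E, C11 (fun z : Z => (\prod_(i < N) f (z.1 0 i)) * f z.2) E.
Proof.
move=> HD.
have H1 i : C11 (fun z : Z => f (z.1 0 i)) (fun z h => D (z.1 0 i) (h.1 0 i)).
  apply: (C11_comp_linear (l := fun z : Z => z.1 0 i)) HD.
    by move=> a h h'; rewrite !mxE.
  by move=> h; exact: norm_coord.
have H2 : C11 (fun z : Z => f z.2) (fun z h => D z.2 h.2).
  by apply: (C11_comp_linear (l := fun z : Z => z.2)) HD => // h; exact: norm_time.
have [E HE] := C11_prod (index_enum 'I_N) H1.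
by eexists; exact: C11M HE H2.
Qed.

Lemma C11_moll n : exists D, C11 (moll n : Z -> R) D.
Proof. by have [D HD] := C11_moll1 (R := R) n; exact: C11_spacetime_prod HD. Qed.

Lemma measurable_moll n : measurable_fun setT (moll n).
Proof.
apply: measurable_funM; last exact: measurableT_comp (measurable_moll1 n) measurable_snd.
apply: (measurableT_comp (f := fun x : 'rV[R]_N => \prod_(i < N) moll1 n (x 0 i))); last exact: measurable_fst.
apply: (@measurable_rV_prod _ _ (fun=> moll1 n)) => i; exact: measurable_moll1.
Qed.

Lemma mkernel_ge0 n z w : 0 <= mkernel n z w. Proof. exact: moll_ge0. Qed.

Lemma mkernelC n z w : mkernel n z w = mkernel n w z.
Proof. by rewrite /mkernel -mollN opprB. Qed.

Lemma mkernel_bounded n : exists M, forall z w, mkernel n z w <= M.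
Proof.
have [D [C [_ H _ _ _]]] := C11_moll n; exists C => z w.
exact: le_trans (ler_norm _) (H _).
Qed.

Lemma measurable_mkernel n : measurable_fun [set: mZ * mZ] (fun zw => mkernel n zw.1 zw.2).
Proof.
apply: (measurableT_comp (measurable_moll n)).
apply/measurable_fun_pairP; split => /=.
  apply: measurable_fun_rV => i /=.
  under eq_fun do rewrite !mxE.
  apply: measurable_funB.
    apply: (measurableT_comp (measurable_rV_coord i)).
    exact: (measurableT_comp measurable_fst measurable_fst).
  apply: (measurableT_comp (measurable_rV_coord i)).
  exact: (measurableT_comp measurable_fst measurable_snd).
apply: (measurable_funB (f := fun zw : mZ * mZ => zw.1.2 : R) (g := fun zw : mZ * mZ => zw.2.2 : R)).
  exact: (measurableT_comp measurable_snd measurable_fst).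
exact: (measurableT_comp measurable_snd measurable_snd).
Qed.

Lemma mkernel_int2 n w : (\int[dxdt]_z (mkernel n z w)%:E = 1)%E.
Proof.
rewrite -[LHS]/(\int[lebesgue_rV R N \x leb]_z (mkernel n z w)%:E)%E.
rewrite fubini_tonelli1/=; last 2 first.
- by apply/measurable_EFinP; exact: (measurable_k2 (fun n => measurable_mkernel n)).
- by move=> z; rewrite lee_fin mkernel_ge0.
rewrite /fubini_F /=.
transitivity ((\prod_(i < N) (1 : R))%:E); last by rewrite big1_eq.
transitivity (\int[lebesgue_rV R N]_x (\prod_(i < N) moll1 n (x 0 i - w.1 0 i))%:E)%E.
  apply: eq_integral => x _.
  transitivity (\int[leb]_y
     ((\prod_(i < N) moll1 n (x 0 i - w.1 0 i))%:E * (moll1 n (y - w.2))%:E))%E.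
    apply: eq_integral => y _; rewrite -EFinM /mkernel /moll /=.
    by congr ((_ * _)%:E); apply: eq_bigr => i _; rewrite !mxE.
  rewrite ge0_integralZl//=.
  - by rewrite integral_moll1 mule1.
  - apply/measurable_EFinP; apply: (measurableT_comp (measurable_moll1 n)).
    exact: (measurable_funB (f := id)).
  - by move=> t _; rewrite lee_fin moll1_ge0.
  - by rewrite lee_fin prodr_ge0// => i _; exact: moll1_ge0.
apply: (@integral_rV_prod _ _ (fun i x => moll1 n (x - w.1 0 i)) (fun=> 1)).
- move=> i; apply: (measurableT_comp (measurable_moll1 n)).
  exact: (measurable_funB (f := id)).
- by move=> i x; exact: moll1_ge0.
- by move=> i; exact: integral_moll1.
Qed.

Lemma mkernel_int1 n z : (\int[dxdt]_w (mkernel n z w)%:E = 1)%E.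
Proof. by under eq_integral do rewrite mkernelC; exact: mkernel_int2. Qed.

(** An open set is the union of the boxes with rational centre and radius 1/n that
it contains; this ties the topology of space-time to its product
sigma-algebra. *)
Lemma measurable_open_spacetime (U : set Z) : open U -> measurable (U : set mZ).
Proof.
move=> oU.
pose box (q : 'rV[rat]_N * rat * nat) : set mZ :=
  [set x : 'rV[R]_N | forall i, `](ratr (q.1.1 0 i) - q.2.+1%:R^-1), (ratr (q.1.1 0 i) + q.2.+1%:R^-1)[%classic (x 0 i)] `*`
  `](ratr q.1.2 - q.2.+1%:R^-1), (ratr q.1.2 + q.2.+1%:R^-1)[%classic.
have mbox q : measurable (box q).
  apply: measurableX; last exact: measurable_itv.
  exact: (@measurable_rV_box R N (fun i => `](ratr (q.1.1 0 i) - q.2.+1%:R^-1), (ratr (q.1.1 0 i) + q.2.+1%:R^-1)[%classic)).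
pose F q : set mZ := if pselect (box q `<=` U) then box q else set0.
rewrite (_ : (U : set mZ) = \bigcup_q F q).
  have cq : countable [set: 'rV[rat]_N * rat * nat].
    exact: (@countableP ('rV[rat]_N * rat * nat)%type).
  apply: (countable_bigcupT_measurable cq) => q.
  by rewrite /F; case: pselect => h /=; [exact: mbox|exact: measurable0].
apply/seteqP; split => [z Uz|z [q _]]; last by rewrite /F; case: pselect => // h; exact: h.
have /nbhs_ballP[e /= e0 eU] : nbhs (z : Z) U by exact: open_nbhs_nbhs.
have [n n_e] : exists n, n.+1%:R^-1 < e / 2 :> R.
  have e20 : 0 < e / 2 by rewrite divr_gt0.
  have [n _ /(_ n (leqnn n)) H] := near_infty_natSinv_lt (PosNum e20).
  by exists n.
have n0 : 0 < n.+1%:R^-1 :> R by rewrite invr_gt0.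
have [e1 e1E] : exists e1 : R, e1 = n.+1%:R^-1 by eexists.
rewrite -e1E in n_e n0.
have approx (r : R) : exists q : rat, `|ratr q - r| < e1.
  have [|q] := @rat_in_itvoo R (r - e1) (r + e1); first by lra.
  by rewrite in_itv/= => q1; exists q; rewrite ltr_norml; lra.
have [qx qxP] := choice (fun i => approx (z.1 0 i)).
have [qt qtP] := approx z.2.
exists (\row_i qx i, qt, n) => //.
have sub : box (\row_i qx i, qt, n) `<=` U.
  move=> w [/= w1 w2]; apply: eU; rewrite -ball_normE /ball_/=.
  apply: norm_lt => //=.
    move=> i; have := w1 i; rewrite /= in_itv/= !mxE -e1E => /andP[a1 a2].
    by have := qxP i; rewrite !ltr_norml => /andP[b1 b2]; lra.
  move: w2; rewrite in_itv/= -e1E => /andP[a1 a2].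
  by move: qtP; rewrite !ltr_norml => /andP[b1 b2]; lra.
rewrite /F; case: pselect => // h; split => /=.
  move=> i; have := qxP i; rewrite in_itv/= !mxE -e1E ltr_norml => /andP[b1 b2]; lra.
by move: qtP; rewrite in_itv/= -e1E ltr_norml => /andP[b1 b2]; lra.
Qed.

Lemma measurable_continuous_spacetime (f : Z -> R) : continuous f ->
  measurable_fun [set: mZ] (f : mZ -> R).
Proof.
move=> cf; apply: (measurability _ (RGenOInfty.measurableE R)).
move=> _ [_ [a ->] <-]; rewrite setTI; apply: measurable_open_spacetime.
by apply: open_comp => // x _; exact: cf.
Qed.

Definition open_sets : set (set mZ) := [set A | open (A : set Z)].

Lemma setI_open_sets : setI_closed open_sets.
Proof. by move=> A B; exact: openI. Qed.

(** The identity from the Borel sigma-algebra of the topology to the product one is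
measurable because all coordinates are continuous. *)
Lemma open_sets_generate : @measurable _ mZ = <<s open_sets >>.
Proof.
apply/seteqP; split=> A; last first.
  apply: smallest_sub => //; first exact: sigma_algebra_measurable.
  exact: measurable_open_spacetime.
move=> mA.
pose T' := g_sigma_algebraType open_sets.
have key (f : Z -> R) : continuous f -> measurable_fun [set: T'] f.
  move=> cf; apply: (measurability _ (RGenOInfty.measurableE R)).
  move=> _ [_ [a ->] <-]; rewrite setTI; apply: sub_sigma_algebra.
  by apply: open_comp => // x _; exact: cf.
suff : measurable_fun [set: T'] (id : T' -> mZ).
  by move=> /(_ measurableT _ mA); rewrite setTI.
apply/measurable_fun_pairP; split.
  apply: measurable_fun_rV => i; apply: key.
  move=> z; apply: (@continuous_comp _ _ _ fst (fun x : 'rV[R]_N => x 0 i)).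
    exact: cvg_fst.
  exact: coord_continuous.
by apply: key => z; exact: cvg_snd.
Qed.

Lemma mkernel_concentrates A z : open_sets A -> A z ->
  \forall n \near \oo, forall w, mkernel n z w != 0 -> A w.
Proof.
move=> oA Az.
have /nbhs_ballP[e /= e0 eA] : nbhs (z : Z) A by exact: open_nbhs_nbhs.
near=> n => w kw; apply: eA; rewrite -ball_normE /ball_/=.
apply: lt_trans (moll_neq0 kw) _.
near: n.
exact: (near_infty_natSinv_lt (PosNum e0)).
Unshelve. all: end_near. Qed.

End mollifier.

(** * Mollified functions *)

Section smoothing_spacetime.
Context {R : realType} {N : nat}.
Local Notation leb := (@lebesgue_measure R).
Local Notation Z := ('rV[R]_N * R)%type.
Local Notation mZ := ('rV[R]_N * measurableTypeR R)%type.
Local Notation mu := (@dxdt R N).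
Local Notation L1 f := (mu.-integrable [set: mZ] (EFin \o (f : mZ -> R))).
Local Notation T := (smoothing mu mkernel).

Lemma measurable_Omega : measurable (positive_times : set mZ).
Proof.
rewrite (_ : positive_times = [set: 'rV[R]_N] `*` `]0, +oo[%classic); first exact: measurableX.
by apply/seteqP; split => -[x t] /=; rewrite in_itv/= andbT => // -[].
Qed.

Lemma derive_off_supp (f : Z -> R) v z : ~ supp f z -> 'D_v f z = 0.
Proof.
move=> fz.
have : \forall y \near z, f y = cst 0 y.
  have oU : open (~` supp f) by apply: closed_openC; exact: closed_closure.
  have := open_nbhs_nbhs (conj oU fz).
  apply: filterS => y fy; apply/eqP; apply: contra_notT fy => fy.
  by apply: subset_closure.
by move=> /(near_eq_derive v) ->; rewrite derive_cst.
Qed.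

Lemma off_supp (f : Z -> R) z : ~ supp f z -> f z = 0.
Proof.
by move=> fz; apply/eqP; apply: contra_notT fz => fz; exact: subset_closure.
Qed.

Lemma measurable_sub (z : mZ) : measurable_fun [set: mZ] (fun w : mZ => z - w).
Proof.
apply/measurable_fun_pairP; split => /=.
  apply: measurable_fun_rV => i /=.
  under eq_fun do rewrite !mxE.
  apply: measurable_funB => //.
  exact: (measurableT_comp (measurable_rV_coord i) measurable_fst).
by apply: (@measurable_funB _ _ R setT (fun=> z.2) (fun w : mZ => w.2)) => //; exact: measurable_snd.
Qed.

(** The derivative is a pointwise limit of difference quotients. *)
Lemma measurable_C11_deriv (f : Z -> R) D h : C11 f D ->
  measurable_fun [set: mZ] (f : mZ -> R) ->
  measurable_fun [set: mZ] (fun w : mZ => D w h).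
Proof.
move=> [C H] mf; have DZ w a := C11_linZ H w a h.
case: H => C0 fC Dl DC [DL fD].
pose g (m : nat) (w : mZ) : R := m.+1%:R * (f (w + m.+1%:R^-1 *: h) - f w).
apply: (@measurable_fun_cvg _ _ _ _ g).
- move=> m; apply: measurable_funM => //; apply: measurable_funB => //.
  apply: (measurableT_comp mf).
  have := measurable_sub (- (m.+1%:R^-1 *: h) : Z).
  have := measurable_sub (0 : Z).
  move=> H1 H2; have := measurableT_comp H1 H2.
  by apply: eq_measurable_fun => w _; rewrite /= sub0r opprB opprK.
- move=> w _; apply/cvgrPdist_le => e e0; near=> m.
  have m0 : 0 < m.+1%:R :> R by [].
  have -> : D w h - g m w = - (m.+1%:R * (f (w + m.+1%:R^-1 *: h) - f w - D w (m.+1%:R^-1 *: h))).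
    rewrite DZ mulrBr mulrA mulfV ?gt_eqF// mul1r /g; ring.
  rewrite normrN normrM (ger0_norm (ltW m0)).
  have := fD w (m.+1%:R^-1 *: h); rewrite normrZ (ger0_norm (_ : 0 <= m.+1%:R^-1)) ?invr_ge0// => H.
  apply: (le_trans (ler_wpM2l (ltW m0) H)).
  have -> : m.+1%:R * (C * (m.+1%:R^-1 * `|h|) ^+ 2) = (C * `|h| ^+ 2) * m.+1%:R^-1.
    by field; rewrite nat1r gt_eqF.
  have c1 : 0 < C * `|h| ^+ 2 + 1 by rewrite ltr_wpDl// mulr_ge0// sqr_ge0.
  apply: (@le_trans _ _ ((C * `|h| ^+ 2 + 1) * m.+1%:R^-1)).
    by rewrite ler_wpM2r ?invr_ge0 ?lerDl// ltW.
  rewrite mulrC -ler_pdivlMr// ltW//.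
  near: m.
  have ec : 0 < e / (C * `|h| ^+ 2 + 1) by rewrite divr_gt0// ltr_wpDl// mulr_ge0// sqr_ge0.
  exact: (near_infty_natSinv_lt (PosNum ec)).
Unshelve. all: end_near. Qed.

Lemma C11_mkernel n : exists D, forall z,
  C11 (moll n : Z -> R) D /\
  C11 (fun w : Z => mkernel n z w) (fun w h => - D (z - w) h).
Proof.
have [D HD] := C11_moll (R := R) (N := N) n.
by exists D => z; split => //; exact: C11_reflect.
Qed.

Lemma measurable_moll_deriv n D h z : C11 (moll n : Z -> R) D ->
  measurable_fun [set: mZ] (fun w : mZ => D (z - w) h).
Proof.
move=> HD.
have := measurable_C11_deriv h (C11_reflect z HD).
have mk : measurable_fun [set: mZ] (fun w : mZ => moll n (z - w)).
  exact: (measurableT_comp (measurable_moll n) (measurable_sub z)).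
move=> /(_ mk) /measurable_funN.
by apply: eq_measurable_fun => w _; rewrite /= opprK.
Qed.

Lemma L1_bounded_mul (g f : mZ -> R) M : L1 f ->
  measurable_fun [set: mZ] g -> (forall w, `|g w| <= M) ->
  L1 (fun w => g w * f w).
Proof.
move=> f1 mg gM; rewrite (_ : _ \o _ = ((EFin \o g) \* (EFin \o f))%E)//.
apply: integrableMr => //.
exists M; split; first exact: num_real.
by move=> x Mx w _ /=; apply: (le_trans (gM w)); exact: ltW.
Qed.

(** The Taylor expansion of the kernel is uniform, so it can be integrated against
[f]. *)
Lemma smoothing_C11 n (f : mZ -> R) D : L1 f -> C11 (moll n : Z -> R) D ->
  C11 (T n f : Z -> R) (fun z h => \int[mu]_w (D (z - w) h * f w)).
Proof.
move=> f1 HD; have [C [C0 rC Dl DC [DL rD]]] := HD.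
have mf : measurable_fun [set: mZ] f := L1_measurable f1.
have mD z h := measurable_moll_deriv h z HD.
have bound_int (g : mZ -> R) M : measurable_fun [set: mZ] g -> (forall w, `|g w| <= M) ->
    L1 (fun w => g w * f w) by exact: L1_bounded_mul.
have fn1 : L1 (fun w => `|f w|).
  rewrite (_ : _ \o _ = abse \o (EFin \o f))//; exact: integrable_abse.
have Dint z h : L1 (fun w => D (z - w) h * f w).
  by apply: (bound_int _ (C * `|h|)) => // w; exact: DC.
have kint z : L1 (fun w => mkernel n z w * f w).
  apply: integrable_kM => //; [exact: mkernel_ge0|exact: mkernel_bounded|exact: measurable_mkernel].
pose I := \int[mu]_w `|f w|.
have I0 : 0 <= I by apply: Rintegral_ge0.
have est (g : mZ -> R) M : measurable_fun [set: mZ] g -> (forall w, `|g w| <= M) ->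
    `|\int[mu]_w (g w * f w)| <= M * I.
  move=> mg gM; have gf := bound_int _ _ mg gM.
  apply: (le_trans (le_normr_Rintegral measurableT gf)).
  rewrite -RintegralZl//; apply: le_Rintegral => //.
  - rewrite (_ : _ \o _ = abse \o (EFin \o (fun w => g w * f w)))//; exact: integrable_abse.
  - exact: L1Z.
  - by move=> w _; rewrite normrM ler_wpM2r.
have mk z : measurable_fun [set: mZ] (mkernel n z : mZ -> R).
  exact: (measurableT_comp (measurable_moll n) (measurable_sub z)).
exists (C * I + C); split.
- by rewrite addr_ge0 ?mulr_ge0.
- move=> z; apply: (@le_trans _ _ (C * I)); last by rewrite lerDl.
  by apply: est => // w; exact: rC.
- move=> z a h h'; rewrite -RintegralZl// -RintegralD//; last first.
    exact: (L1Z a (Dint z h)).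
  by apply: eq_Rintegral => w _; rewrite Dl; ring.
- move=> z h; apply: (@le_trans _ _ (C * `|h| * I)).
    by apply: est => // w; exact: DC.
  rewrite mulrAC ler_wpM2r// lerDl//.
- split.
  + move=> z z' h; rewrite -RintegralB//.
    rewrite (@eq_Rintegral _ _ _ mu setT (fun w => (D (z - w) h - D (z' - w) h) * f w)); last first.
      by move=> w _; rewrite mulrBl.
    apply: (@le_trans _ _ (C * `|z - z'| * `|h| * I)).
      apply: est; first exact: measurable_funB.
      move=> w; apply: (le_trans (DL _ _ _)).
      by rewrite opprB addrA subrK.
    have P0 : 0 <= C * (`|z - z'| * `|h|) by rewrite mulr_ge0// mulr_ge0.
    nra.
  + move=> z h.
    have kB : L1 (fun w => mkernel n (z + h) w * f w - mkernel n z w * f w).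
      by apply: L1B; exact: kint.
    rewrite /smoothing -RintegralB//.
    rewrite -RintegralB//.
    rewrite (@eq_Rintegral _ _ _ mu setT (fun w => (mkernel n (z + h) w - mkernel n z w - D (z - w) h) * f w)); last first.
      by move=> w _; rewrite !mulrBl.
    apply: (@le_trans _ _ (C * `|h| ^+ 2 * I)).
      apply: est; first by apply: measurable_funB => //; apply: measurable_funB; exact: mk.
      by move=> w; rewrite /mkernel (addrAC z h (- w)); exact: rD.
    by rewrite mulrAC ler_wpM2r ?sqr_ge0// lerDl.
Qed.

Definition box (M a b : R) : set Z :=
  [set z : Z | (forall i, - M <= z.1 0 i <= M) /\ a <= z.2 <= b].

Lemma boxX M a b : box M a b =
  [set x : 'rV[R]_N | forall i, `[(- M), M]%classic (x 0 i)] `*` `[a, b]%classic.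
Proof.
by apply/seteqP; split => z /=; rewrite in_itv/= => -[z1 z2]; split => // i;
  have := z1 i; rewrite in_itv.
Qed.

Lemma compact_box M a b : compact (box M a b).
Proof.
rewrite boxX; apply: compact_setX; last exact: segment_compact.
by apply: (@rV_compact R N (fun=> `[- M, M]%classic)) => i; exact: segment_compact.
Qed.

Lemma measurable_box M a b : measurable (box M a b : set mZ).
Proof.
rewrite boxX; apply: measurableX; last exact: measurable_itv.
exact: (@measurable_rV_box R N (fun=> `[(- M), M]%classic)).
Qed.

Lemma supp_box (f : Z -> R) M a b :
  (forall z, ~ box M a b z -> f z = 0) -> supp f `<=` box M a b.
Proof.
move=> f0; have cb : closed (box M a b).
  by apply: compact_closed; [exact: norm_hausdorff|exact: compact_box].
rewrite [X in _ `<=` X](closure_id _).1//; apply: closureS => w /= /eqP Fw.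
by apply: contrapT => /f0.
Qed.

Lemma dxdt_box M a b : 0 <= M -> a <= b ->
  mu (box M a b) = ((2 * M) ^+ N * (b - a))%:E.
Proof.
move=> M0 ab; rewrite boxX.
have m1 : measurable [set x : 'rV[R]_N | forall i, `[(- M), M]%classic (x 0 i)].
  exact: (@measurable_rV_box R N (fun=> `[(- M), M]%classic)).
rewrite [LHS](_ : _ = (lebesgue_rV R N [set x | forall i, `[(- M)%R, M]%classic (x 0%R i)] *
   leb `[a, b]%classic)%E); last first.
  by apply: product_measure1E => //; exact: measurable_itv.
rewrite (@lebesgue_rV_box R N (fun=> `[(- M), M]%classic))//.
have itvE (c e : R) : c <= e -> leb `[c, e]%classic = (e - c)%:E.
  move=> ce; rewrite lebesgue_measure_itv/= lte_fin; case: ltP => [_|ec]; first by rewrite EFinB.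
  by rewrite (_ : e = c) ?subrr//; apply/eqP; rewrite eq_le ec ce.
have MM : - M <= M by lra.
have -> : (\prod_(i < N) leb `[(- M)%R, M]%classic = ((2 * M) ^+ N)%:E)%E.
  elim: (N) => [|n IH]; first by rewrite big_ord0 expr0.
  rewrite big_ord_recl [X in (_ * X)%E]IH [X in (X * _)%E](itvE _ _ MM) -EFinM exprS.
  by congr (_ * _)%:E; lra.
by rewrite [X in (_ * X)%E](itvE _ _ ab) EFinM.
Qed.

Lemma dxdt_box_lty M a b : (mu (box M a b) < +oo)%E.
Proof.
apply: (@le_lt_trans _ _ (mu (box `|M| (Num.min a b) b))); last first.
  by rewrite dxdt_box ?ltry// ge_min lexx orbT.
have mem c e h : box c e h \in (measurable : set (set mZ)) by apply: mem_set; exact: measurable_box.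
apply: le_measure; [exact: mem|exact: mem|].
move=> z [z1 /andP[z2 z3]]; split => [i|]; last by rewrite ge_min z2 z3.
by rewrite -ler_norml; apply: (le_trans _ (ler_norm M)); rewrite ler_norml.
Qed.

Lemma compact_closed_ball (z : Z) (r : R) : compact [set w : Z | `|z - w| <= r].
Proof.
pose m := `|z| + r.
apply: (@subclosed_compact _ _ (box m (- m) m)).
- exact: closed_closed_ball_.
- exact: compact_box.
- move=> w /= zw.
  have wm : `|w| <= m.
    have := ler_normB (w - z) (- z); rewrite opprK subrK normrN distrC.
    by rewrite /m; lra.
  split; last by rewrite -ler_norml; exact: le_trans (norm_time _) wm.
  by move=> i; rewrite -ler_norml; exact: le_trans (norm_coord _ _) wm.
Qed.

(** This is what allows the weak derivatives to be tested against the kernel. *)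
Lemma mkernel_test n (z : Z) (Q : set Z) : Q `<=` positive_times ->
  (forall w : Z, `|z - w| <= n.+1%:R^-1 -> Q w) ->
  C1c (mkernel n z : Z -> R) /\ supp (mkernel n z : Z -> R) `<=` Q.
Proof.
move=> QO zQ.
have [D HD] := C11_mkernel n.
have [d1 d2 d3] := C11_diff (HD z).2.
have sub : supp (mkernel n z : Z -> R) `<=` [set w : Z | `|z - w| <= n.+1%:R^-1].
  have -> : [set w : Z | `|z - w| <= n.+1%:R^-1] = closure [set w : Z | `|z - w| <= n.+1%:R^-1].
    by apply: (closure_id _).1; exact: closed_closed_ball_.
  apply: closureS => w /= kw; apply: ltW; exact: moll_neq0 kw.
split; last by move=> w /sub; exact: zQ.
split => //.
apply: subclosed_compact sub; last exact: compact_closed_ball.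
exact: closed_closure.
Qed.

(** The mollified function differentiates on the kernel as a function of z, and the
weak derivative tests against the kernel as a function of w; the two
derivatives of k(z - w) are opposite. *)
Lemma smoothing_weak_derivative n (v z : Z) (u g : Z -> R) (Q : set Z) :
  weak_derivative (fun phi => 'D_v phi) u g ->
  measurable (Q : set mZ) -> Q `<=` positive_times ->
  L1 (u \_ Q) -> L1 (g \_ Q) ->
  (forall w : Z, `|z - w| <= n.+1%:R^-1 -> Q w) ->
  'D_v (T n (u \_ Q) : Z -> R) z = T n (g \_ Q) z.
Proof.
move=> wd mQ QO u1 g1 zQ.
have [kc ks] := mkernel_test QO zQ.
have [D HD] := C11_mkernel n.
have [_ kD _] := C11_diff (HD z).2.
have [_ TD _] := C11_diff (smoothing_C11 u1 (HD z).1).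
rewrite TD.
have := wd _ kc (subset_trans ks QO).
have D0 w : ~ Q w -> D (z - w) v = 0.
  move=> nQw; apply/eqP; rewrite -oppr_eq0 -kD; apply/eqP.
  by apply: derive_off_supp; apply: contra_not nQw; exact: ks.
move=> {}wd.
have [C [_ _ _ DC _]] := (HD z).1.
have Du : L1 (fun w => D (z - w) v * (u \_ Q) w).
  apply: (L1_bounded_mul (M := C * `|v|) u1) => [|w]; last exact: DC.
  exact: measurable_moll_deriv (HD z).1.
have gk : L1 (fun w => mkernel n z w * (g \_ Q) w).
  apply: integrable_kM => //; [exact: mkernel_ge0|exact: mkernel_bounded|exact: measurable_mkernel].
have E1 : (\int[lebesgue_spacetime]_(w in positive_times) (u w * 'D_v (mkernel n z) w)%:E =
    (- 1)%:E * \int[mu]_w (D (z - w) v * (u \_ Q) w)%:E)%E.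
  rewrite -(integralZl measurableT Du) [LHS]integral_mkcond; apply: eq_integral => w _.
  rewrite /= -EFinM patchE; case: ifPn => [_|wO].
    rewrite kD patchE; case: ifPn => [_|/negP wQ]; first by congr EFin; ring.
    by rewrite D0 ?mul0r ?oppr0 ?mulr0// => /mem_set.
  rewrite patchE memNset ?mulr0// => /QO; move/negP: wO => wO /mem_set; exact: wO.
have E2 : (\int[lebesgue_spacetime]_(w in positive_times) (g w * mkernel n z w)%:E =
    \int[mu]_w (mkernel n z w * (g \_ Q) w)%:E)%E.
  rewrite [LHS]integral_mkcond; apply: eq_integral => w _.
  rewrite /= patchE; case: ifPn => [_|wO].
    rewrite patchE; case: ifPn => [_|/negP wQ]; first by rewrite mulrC.
    rewrite mulr0 (_ : mkernel n z w = 0) ?mulr0//.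
    by apply: off_supp => /ks /mem_set.
  rewrite patchE memNset ?mulr0// => /QO; move/negP: wO => wO /mem_set; exact: wO.
move: wd; rewrite E1 E2 EFinN mulN1e => /(congr1 oppe); rewrite !oppeK.
by rewrite /smoothing /Rintegral => ->.
Qed.

Lemma L1_patch (f : mZ -> R) (Q : set mZ) : measurable Q -> mu.-integrable Q (EFin \o f) ->
  L1 (f \_ Q).
Proof. by move=> mQ; rewrite integrable_mkcond// restrict_EFin. Qed.

End smoothing_spacetime.

(** * Calculus of C1 functions on space-time *)

Section spacetime_calculus.
Context {R : realType} {N : nat}.
Local Notation leb := (@lebesgue_measure R).
Local Notation Z := ('rV[R]_N * R)%type.
Local Notation mZ := ('rV[R]_N * measurableTypeR R)%type.
Local Notation mu := (@dxdt R N).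
Local Notation L1 f := (mu.-integrable [set: mZ] (EFin \o (f : mZ -> R))).

(** The regularity demanded of test functions by [C1c], without the support
condition. *)
Definition C1 (f : Z -> R) :=
  (forall z, differentiable f z) /\ (forall v, continuous ('D_v f)).

Lemma C1_continuous f : C1 f -> continuous f.
Proof. by move=> [df _] z; exact: differentiable_continuous. Qed.

Lemma C11_C1 f D : C11 f D -> C1 f.
Proof. by move=> /C11_diff[]. Qed.

Lemma C1_deriveM f g v z : C1 f -> C1 g ->
  'D_v (fun z => f z * g z) z = f z * 'D_v g z + g z * 'D_v f z.
Proof.
move=> [df _] [dg _].
by rewrite (deriveM (diff_derivable (df z)) (diff_derivable (dg z))).
Qed.

Lemma C1M f g : C1 f -> C1 g -> C1 (fun z => f z * g z).
Proof.
move=> Cf Cg; split.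
  by move=> z; apply: differentiableM; [exact: Cf.1|exact: Cg.1].
move=> v.
have -> : 'D_v (fun z => f z * g z) = fun z => f z * 'D_v g z + g z * 'D_v f z.
  by apply/funext => z; exact: C1_deriveM.
move=> z; apply: cvgD; apply: cvgM.
- exact: C1_continuous.
- exact: Cg.2.
- exact: C1_continuous.
- exact: Cf.2.
Qed.

Lemma derive_comp1 (h h' : R -> R) f v z : C1 f ->
  is_derive (f z) 1 h (h' (f z)) ->
  'D_v (h \o f) z = h' (f z) * 'D_v f z.
Proof.
move=> [df _] [dh hE].
have dh' : differentiable h (f z) by exact/derivable1_diffP.
rewrite deriveE; last exact: differentiable_comp.
have fE := deriveE v (df z).
rewrite diff_comp//= -fE (deriv1E dh) derive1E hE.
by rewrite -[LHS]/('D_v f z * h' (f z)) mulrC.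
Qed.

(** The hypotheses on [h] are only made at the values taken by [f], so that the
lemma applies to functions that are controlled on [0, +oo[ alone. *)
Lemma C1_comp (h h' : R -> R) f : C1 f ->
  (forall z, is_derive (f z) 1 h (h' (f z))) ->
  (forall z, {for f z, continuous h'}) ->
  C1 (h \o f).
Proof.
move=> Cf dh ch; split.
  move=> z; apply: differentiable_comp; first exact: Cf.1.
  by apply/derivable1_diffP; have [] := dh z.
move=> v.
rewrite (_ : 'D_v _ = fun z => h' (f z) * 'D_v f z); last first.
  by apply/funext => z; exact: derive_comp1.
have ch' : continuous (fun y => h' (f y)).
  move=> y.
  have H1 : {for y, continuous f} := @C1_continuous f Cf y.
  exact: (continuous_comp H1 (ch y)).
by move=> z; apply: cvgM; [exact: ch'|exact: Cf.2].
Qed.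

Lemma bounded_off_compact (f : Z -> R) (K : set Z) : continuous f -> compact K ->
  (forall z, ~ K z -> f z = 0) -> exists2 C, 0 <= C & forall z, `|f z| <= C.
Proof.
move=> cf cK f0.
have : compact (f @` K).
  by apply: continuous_compact => //; exact: continuous_subspaceT.
move=> /compact_bounded[M [_ HM]].
exists (`|M| + 1) => [|z]; first by rewrite addr_ge0.
have [Kz|/f0 ->] := pselect (K z); last by rewrite normr0 addr_ge0.
by apply: (HM (`|M| + 1)); [rewrite ltr_pwDr// ler_norm|exists z].
Qed.

Lemma continuous_sectiont (f : Z -> R) (x : 'rV[R]_N) : continuous f ->
  continuous (fun t : R => f (x, t)).
Proof.
move=> cf t; apply: (@continuous_comp _ _ _ (fun t : R => (x, t) : Z) f); last exact: cf.
by apply: (@cvg_pair _ _ _ _ (nbhs x) (nbhs t) _ _ _ (fun=> x) id); [exact: cvg_cst|exact: cvg_id].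
Qed.

Lemma is_derive_sectiont (F : Z -> R) (x : 'rV[R]_N) (t : R) : C1 F ->
  is_derive t 1 (fun t : R => F (x, t)) ('D_(0, 1) F (x, t)).
Proof.
move=> [dF _].
have E (h : R) : h *: ((0 : 'rV[R]_N), (1 : R)) + (x, t) = (x, h *: (1 : R) + t) :> Z.
  by rewrite /GRing.add/= /GRing.scale/= /add_pair/= scaler0 add0r.
split.
  have := @diff_derivable _ _ _ F (x, t) ((0 : 'rV[R]_N), (1 : R)) (dF (x, t)).
  rewrite /derivable; under eq_fun do rewrite /= E; exact.
by rewrite /derive; congr (lim _); under [in RHS]eq_fun do rewrite /= E.
Qed.

(** Integrate first in time: by the fundamental theorem of calculus the inner
integral vanishes. *)
Lemma integral_partial_t0 (F : Z -> R) M : C1 F ->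
  (forall z, ~ box M (- M) M z -> F z = 0) ->
  L1 ('D_(0, 1) F) /\ (\int[mu]_z ('D_(0, 1) F z)%:E = 0)%E.
Proof.
move=> CF F0.
have M' : `|M| < `|M| + 1 by rewrite ltrDl.
have f0 z : ~ box M (- M) M z -> 'D_(0, 1) F z = 0.
  by move=> zb; apply: derive_off_supp; apply: contra_not zb; exact: supp_box.
have cf := CF.2 (0, 1).
have [C C0 fC] := bounded_off_compact cf (@compact_box R N M (- M) M) f0.
have mf := measurable_continuous_spacetime cf.
have mB := measurable_box (R := R) (N := N) M (- M) M.
have fL1 : L1 ('D_(0, 1) F).
  rewrite (_ : 'D_(0, 1) F = ('D_(0, 1) F : mZ -> R) \_ (box M (- M) M)).
    apply: L1_patch => //; apply: measurable_bounded_integrable => //.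
    - exact: dxdt_box_lty.
    - exact: measurable_funTS.
    - exists C; split; first exact: num_real.
      by move=> y Cy z _; apply: (le_trans (fC z)); exact: ltW.
  apply/funext => z; rewrite patchE; case: ifPn => // /negP zb.
  by apply: f0 => /mem_set.
split => //.
rewrite -[LHS]/(\int[lebesgue_rV R N \x leb]_z ('D_(0, 1) F z)%:E)%E.
rewrite -integral12_prod_meas1; last exact: fL1.
rewrite /fubini_F; apply: integral0_eq => x _ /=.
pose a := - (`|M| + 1); pose b := `|M| + 1.
have ab : a < b by rewrite /a /b gtrN// ltr_wpDl.
have F'E t : (fun t => F (x, t))^`()%classic t = 'D_(0, 1) F (x, t).
  by rewrite derive1E; have [_ ->] := is_derive_sectiont x t CF.
have out t : ~ (- M <= t <= M) -> ~ box M (- M) M (x, t) by move=> h [].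
transitivity (\int[leb]_(t in `[a, b]) ('D_(0, 1) F (x, t))%:E)%E.
  rewrite [RHS]integral_mkcond; apply: eq_integral => t _.
  rewrite patchE; case: ifPn => // /negP tab; rewrite f0//.
  apply: out => tM; apply: tab; apply: mem_set; rewrite /= in_itv/= /a /b.
  by move: tM; have := ler_norm M; lra.
have cFx := continuous_sectiont (x := x) (C1_continuous CF).
rewrite (@continuous_FTC2 R (fun t => 'D_(0, 1) F (x, t)) (fun t => F (x, t)) a b ab).
- have Fb : F (x, b) = 0.
    by apply: F0; apply: out => /andP[]; rewrite /b; have := ler_norm M; lra.
  have Fa : F (x, a) = 0.
    by apply: F0; apply: out => /andP[]; rewrite /a; have := ler_norm M; lra.
  by rewrite Fa Fb -EFinB subrr.
- by apply: continuous_subspaceT; exact: (@continuous_sectiont ('D_((0 : 'rV[R]_N), (1 : R)) F) x cf).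
- split.
  + by move=> t _; have [] := is_derive_sectiont x t CF.
  + by apply: cvg_at_right_filter; exact: cFx.
  + by apply: cvg_at_left_filter; exact: cFx.
- by move=> t _; exact: F'E.
Qed.

End spacetime_calculus.

(** * The mean curvature operator *)

Section mean_curvature.
Context {R : realType} {N : nat}.
Implicit Types x y xi : 'rV[R]_N.

Lemma dotmul_ge0 x : 0 <= dotmul x x.
Proof. by apply: sumr_ge0 => i _; rewrite -expr2 sqr_ge0. Qed.

Lemma enorm_sqr x : enorm x ^+ 2 = dotmul x x.
Proof. by rewrite /enorm sqr_sqrtr// dotmul_ge0. Qed.

Lemma dotmulZl a x y : dotmul (a *: x) y = a * dotmul x y.
Proof. by rewrite /dotmul mulr_sumr; apply: eq_bigr => i _; rewrite mxE mulrA. Qed.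

Lemma dotmulZr a x y : dotmul x (a *: y) = a * dotmul x y.
Proof. by rewrite /dotmul mulr_sumr; apply: eq_bigr => i _; rewrite mxE mulrCA. Qed.

(** The quadratic polynomial dotmul (x - c y) (x - c y) in c is nonnegative; the
optimal c is used when y is nonzero, and a large c otherwise. *)
Lemma dotmul_CS (x y : 'rV[R]_N) : dotmul x y ^+ 2 <= dotmul x x * dotmul y y.
Proof.
have H (c : R) : 0 <= dotmul x x - 2 * c * dotmul x y + c ^+ 2 * dotmul y y.
  have := dotmul_ge0 (x - c *: y); congr (_ <= _).
  rewrite /dotmul !mulr_sumr -sumrB -big_split/=; apply: eq_bigr => i _.
  by rewrite !mxE; ring.
have [y0|y0] := eqVneq (dotmul y y) 0.
  have [->|xy0] := eqVneq (dotmul x y) 0; first by rewrite y0 mulr0 expr0n.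
  have := H ((dotmul x x + 1) / (2 * dotmul x y)); rewrite y0 mulr0 addr0.
  rewrite (_ : _ * _ * _ = dotmul x x + 1); last by field.
  by lra.
have yp : 0 < dotmul y y by rewrite lt_neqAle eq_sym y0 dotmul_ge0.
have := H (dotmul x y / dotmul y y).
rewrite (_ : _ - _ + _ = dotmul x x - dotmul x y ^+ 2 / dotmul y y); last by field.
by rewrite subr_ge0 ler_pdivrMr.
Qed.

Let s xi := (Num.sqrt (1 + enorm xi ^+ 2))^-1.

Let s_facts xi : [/\ 0 < s xi, s xi <= 1 & s xi ^+ 2 * (1 + dotmul xi xi) = 1].
Proof.
have d1 : 1 <= 1 + dotmul xi xi by rewrite lerDl dotmul_ge0.
have d0 : 0 < 1 + dotmul xi xi by exact: lt_le_trans d1.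
have q0 : 0 < Num.sqrt (1 + dotmul xi xi) by rewrite sqrtr_gt0.
rewrite /s enorm_sqr; split; first by rewrite invr_gt0.
- rewrite invf_le1// -[leLHS]sqrtr1; exact: ler_wsqrtr.
- by rewrite exprVn sqr_sqrtr ?(ltW d0)// mulVf// (gt_eqF d0).
Qed.

(** The flux is bounded, whatever the gradient is. *)
Lemma mean_curvature_sqr_le1 xi :
  dotmul (mean_curvature_op xi) (mean_curvature_op xi) <= 1.
Proof.
have [s0 s1 sE] := s_facts xi.
rewrite /mean_curvature_op -/(s xi) dotmulZl dotmulZr mulrA -expr2.
by have := sqr_ge0 (s xi); lra.
Qed.

(** A(xi) = s xi with 0 < s <= 1, so that A(xi).A(xi) = s A(xi).xi. *)
Lemma mean_curvature_coercive xi :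
  dotmul (mean_curvature_op xi) (mean_curvature_op xi) <=
  dotmul (mean_curvature_op xi) xi.
Proof.
have [s0 s1 sE] := s_facts xi.
rewrite /mean_curvature_op -/(s xi) !dotmulZl dotmulZr ler_wpM2l ?(ltW s0)//.
by rewrite ler_piMl ?dotmul_ge0.
Qed.

Lemma coord_sqr_le_dotmul x i : x 0 i ^+ 2 <= dotmul x x.
Proof.
rewrite /dotmul (bigD1 i)//= expr2 lerDl sumr_ge0// => j _.
by rewrite -expr2 sqr_ge0.
Qed.

Lemma mean_curvature_coord_le1 xi i : `|mean_curvature_op xi 0 i| <= 1.
Proof.
have := le_trans (coord_sqr_le_dotmul (mean_curvature_op xi) i) (mean_curvature_sqr_le1 xi).
by rewrite -[in X in X -> _]real_normK ?num_real// expr_le1.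
Qed.

End mean_curvature.

Section spacetime_L1.
Context {R : realType} {N : nat}.
Local Notation Z := ('rV[R]_N * R)%type.
Local Notation mZ := ('rV[R]_N * measurableTypeR R)%type.
Local Notation mu := (@dxdt R N).
Local Notation L1 f := (mu.-integrable [set: mZ] (EFin \o (f : mZ -> R))).
Local Notation T := (smoothing mu mkernel).
Local Notation Omega := positive_times.

Lemma box_Omega M a b : 0 < a -> box M a b `<=` (Omega : set Z).
Proof. by move=> a0 z [_ /andP[az _]]; exact: lt_le_trans az. Qed.

(** A box has finite measure and |f| <= 1 + f^2. *)
Lemma L2loc_L1 (f : Z -> R) M a b : L2loc f -> 0 < a ->
  L1 ((f : mZ -> R) \_ (box M a b)).
Proof.
move=> [mf f2] a0.
have mB := measurable_box (R := R) (N := N) M a b.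
have fB := f2 _ (@compact_box R N M a b) (@box_Omega M a b a0).
have mfB : measurable_fun (box M a b : set mZ) (f : mZ -> R).
  by apply: measurable_funS mf; [exact: measurable_Omega|exact: box_Omega].
apply: L1_patch => //.
have i1 : mu.-integrable (box M a b : set mZ) (EFin \o (cst 1 : mZ -> R)).
  apply: measurable_bounded_integrable => //; first exact: dxdt_box_lty.
  exists 1; split; first exact: num_real.
  by move=> y y1 z _; rewrite /= normr1 ltW.
apply: (@le_integrable _ _ _ mu (box M a b) mB _ (EFin \o (fun z => 1 + f z ^+ 2))).
- exact/measurable_EFinP.
- move=> z _; rewrite /= lee_fin [leRHS]ger0_norm ?addr_ge0 ?sqr_ge0//.
  rewrite -[f z ^+ 2]real_normK ?num_real//.
  by have := sqr_ge0 (`|f z| - 1); rewrite !expr2; have := normr_ge0 (f z); nra.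
- exact: (integrableD mB i1 fB).
Qed.

Lemma smoothing_ge0 n (f : mZ -> R) z : {ae mu, forall z, 0 <= f z} -> L1 f ->
  0 <= T n f z.
Proof.
move=> f0 f1; rewrite /smoothing.
have -> : \int[mu]_w (mkernel n z w * f w) = \int[mu]_w (mkernel n z w * Num.max 0 (f w)).
  rewrite /Rintegral; congr fine; apply: ae_eq_integral => //.
  - apply/measurable_EFinP; apply: measurable_funM; last exact: L1_measurable f1.
    exact: (measurableT_comp (measurable_moll n) (measurable_sub z)).
  - apply/measurable_EFinP; apply: measurable_funM.
      exact: (measurableT_comp (measurable_moll n) (measurable_sub z)).
    apply: measurable_maxr => //; exact: L1_measurable f1.
  - by apply: filterS f0 => w fw _; rewrite (max_idPr fw).
by apply: Rintegral_ge0 => w _; rewrite mulr_ge0 ?mkernel_ge0// le_max lexx.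
Qed.

(** An open ball of the sup norm that contains the box is the open set of finite
measure required by [smoothing_cvgP]. *)
Lemma smoothing_cvg_box M a b (f : mZ -> R) :
  L1 f -> (forall z, ~ box M a b z -> f z = 0) -> smoothing_cvg mu mkernel f.
Proof.
move=> f1 f0.
pose r := `|M| + `|a| + `|b| + 1.
have r0 : 0 < r by rewrite ltr_wpDl// !addr_ge0.
apply: (@smoothing_cvgP _ mZ R mu mkernel _ _ _ _ _ open_sets (ball (0 : Z) r)) => //.
- exact: mkernel_ge0.
- exact: mkernel_bounded.
- exact: measurable_mkernel.
- exact: mkernel_int1.
- exact: mkernel_int2.
- exact: open_sets_generate.
- exact: setI_open_sets.
- exact: mkernel_concentrates.
- exact: ball_open.
- apply: (@le_lt_trans _ _ (mu (box r (- r) r))); last exact: dxdt_box_lty.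
  apply: le_measure; [| |].
  + by apply: mem_set; apply: measurable_open_spacetime; exact: ball_open.
  + by apply: mem_set; exact: measurable_box.
  + move=> z; rewrite -ball_normE /ball_/= sub0r normrN => zr.
    split; last by rewrite -ler_norml; apply: le_trans (norm_time _) (ltW zr).
    by move=> i; rewrite -ler_norml; apply: le_trans (norm_coord _ _) (ltW zr).
- move=> z zr; apply: f0; apply: contra_not zr => -[z1 z2].
  rewrite -ball_normE /ball_/= sub0r normrN; apply: norm_lt => //.
  + move=> i; apply: (@le_lt_trans _ _ `|M|).
      by have := z1 i; rewrite -ler_norml => h; apply: (le_trans h); exact: ler_norm.
    rewrite /r -!addrA ltrDl; have := normr_ge0 a; have := normr_ge0 b; lra.
  + move: z2 => /andP[az zb]; rewrite ltr_norml /r.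
    have := ler_norm b; have := ler_norm (- a); rewrite normrN.
    by have := normr_ge0 M; have := normr_ge0 a; have := normr_ge0 b; lra.
Qed.

Lemma integralE_Rintegral (f : mZ -> R) : L1 f ->
  (\int[mu]_z (f z)%:E)%E = (\int[mu]_z f z)%:E.
Proof. by move=> f1; rewrite /Rintegral fineK//; exact: integrable_fin_num f1. Qed.

Lemma L1_smoothing n (f : mZ -> R) : L1 f -> L1 (T n f).
Proof.
move=> f1; apply: (@integrable_smoothing _ mZ R mu mkernel) => //.
- exact: mkernel_ge0.
- exact: mkernel_bounded.
- exact: measurable_mkernel.
- exact: mkernel_int2.
Qed.

Lemma L1_sum I (r : seq I) (f : I -> mZ -> R) : (forall i, L1 (f i)) ->
  L1 (fun z => \sum_(i <- r) f i z).
Proof.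
move=> f1; elim: r => [|i r IH].
  by under eq_fun do rewrite big_nil; exact: integrable0.
by under eq_fun do rewrite big_cons; exact: L1D.
Qed.

Lemma Rintegral_sum I (r : seq I) (f : I -> mZ -> R) : (forall i, L1 (f i)) ->
  \int[mu]_z (\sum_(i <- r) f i z) = \sum_(i <- r) \int[mu]_z f i z.
Proof.
move=> f1; elim: r => [|i r IH].
  by rewrite big_nil; under eq_Rintegral do rewrite big_nil; rewrite Rintegral_cst// mul0r.
under eq_Rintegral do rewrite big_cons.
by rewrite RintegralD//; [rewrite IH big_cons|exact: L1_sum].
Qed.

End spacetime_L1.

(** * Testing the inequality with a nonlinear function of the solution *)

Section key_inequality.
Context {R : realType} {N : nat}.
Local Notation Z := ('rV[R]_N * R)%type.
Local Notation mZ := ('rV[R]_N * measurableTypeR R)%type.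
Local Notation mu := (@dxdt R N).
Local Notation L1 f := (mu.-integrable [set: mZ] (EFin \o (f : mZ -> R))).
Local Notation T := (smoothing mu mkernel).
Local Notation Omega := positive_times.

Variables (u ut : Z -> R) (Du : Z -> 'rV[R]_N) (source : Z -> \bar R).
Hypothesis uW : W12loc u ut Du.
Hypothesis u_ge0 : {ae mu, forall z, Omega z -> 0 <= u z}.
Hypothesis A_L2 : forall i, L2loc (fun z => mean_curvature_op (Du z) 0 i).
Hypothesis source_ge0 : forall z, (0 <= source z)%E.

Variables (g g' G : R -> R) (L : R).
Hypothesis L0 : 0 <= L.
Hypothesis dG : forall r : R, 0 <= r -> is_derive r 1 G (g r).
Hypothesis dg : forall r : R, 0 <= r -> is_derive r 1 g (g' r).
Hypothesis cg' : forall r : R, 0 <= r -> {for r, continuous g'}.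
Hypothesis g_bounds : forall r : R, 0 <= r -> 1 <= g r <= 2.
Hypothesis g'_bounds : forall r : R, 0 <= r -> - L <= g' r <= 0.
Hypothesis G_bounds : forall r : R, 0 <= r -> 0 <= G r <= 2 * r.
Hypothesis g_lip : forall r x : R, 0 <= r -> 0 <= x -> `|g r - g x| <= L * `|r - x|.
Hypothesis g'_lip : forall r x : R, 0 <= r -> 0 <= x -> `|g' r - g' x| <= L * `|r - x|.
Hypothesis G_lip : forall r x : R, 0 <= r -> 0 <= x -> `|G r - G x| <= 2 * `|r - x|.
Hypothesis mg : measurable_fun setT g.
Hypothesis mg' : measurable_fun setT g'.
Hypothesis mG : measurable_fun setT G.

Variables (phi : Z -> R) (M tau : R).
Hypothesis tau0 : 0 < tau.
Hypothesis test : forall f : Z -> R, C1c f -> (forall z, 0 <= f z) ->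
  supp f `<=` box M tau M ->
  (\int[mu]_(z in Omega) (source z * (f z)%:E) <=
   \int[mu]_(z in Omega) (ut z * f z)%:E +
   \int[mu]_(z in Omega) (dotmul (mean_curvature_op (Du z)) (grad_x f z))%:E)%E.
Hypothesis phi_C1 : C1 phi.
Hypothesis phi_ge0 : forall z, 0 <= phi z.
Hypothesis phi_box : forall z, ~ box M tau M z -> phi z = 0.

Local Notation et := ((0 : 'rV[R]_N), (1 : R)).
Local Notation ex i := ((delta_mx 0 i : 'rV[R]_N), (0 : R)).
Local Notation A z := (mean_curvature_op (Du z)).

Let B : set Z := box M tau M.
Let Q : set Z := box (M + 1) (tau / 2) (M + 1).
(** Almost everywhere equal to u on the enlarged box [Q]. The maximum keeps it in
the domain where g and G are controlled. *)
Let U z := Num.max 0 (((u : mZ -> R) \_ Q) z).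

Local Notation A_Q i := ((fun z => A z 0 i) \_ Q).
Local Notation Du_Q i := ((fun z => Du z 0 i) \_ Q).

(** With G' = g and the truncation at 0, this is what remains of the inequality
tested with g(u) phi: the time derivative has been integrated by parts, and
A.Du has been replaced by its lower bound |A|^2 in the term with g' <= 0. *)
Definition limit_integrand (z : mZ) : R :=
  - (G (Num.max 0 (u z)) * 'D_et phi z) +
  g (Num.max 0 (u z)) * dotmul (A z) (grad_x phi z) +
  g' (Num.max 0 (u z)) * phi z * dotmul (A z) (A z).

Let BQ : B `<=` Q.
Proof.
move=> z [z1 /andP[z2 z3]]; split=> [i|].
  by have := z1 i; lra.
by have := tau0; move=> t0; apply/andP; split; lra.
Qed.

Let tau20 : 0 < tau / 2. Proof. by rewrite divr_gt0. Qed.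

Let QO : Q `<=` (Omega : set Z). Proof. exact: box_Omega. Qed.

Let Dphi_box v z : ~ B z -> 'D_v phi z = 0.
Proof.
by move=> Bz; apply: derive_off_supp; apply: contra_not Bz; exact: supp_box.
Qed.

Let phi_bounded : exists C, [/\ 0 <= C, forall z, `|phi z| <= C,
  forall z, `|'D_et phi z| <= C & forall i z, `|'D_(ex i) phi z| <= C].
Proof.
have cB : compact B by exact: (@compact_box R N).
have [C1 C10 H1] := bounded_off_compact (C1_continuous phi_C1) cB phi_box.
have [C2 C20 H2] := bounded_off_compact (phi_C1.2 et) cB (@Dphi_box et).
have /choice[C3 H3] i : exists C, 0 <= C /\ forall z, `|'D_(ex i) phi z| <= C.
  have [C C0 H] := bounded_off_compact (phi_C1.2 (ex i)) cB (@Dphi_box (ex i)).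
  by exists C.
have S0 : 0 <= \sum_i C3 i by apply: sumr_ge0 => i _; exact: (H3 i).1.
exists (C1 + C2 + \sum_i C3 i); split.
- by rewrite !addr_ge0.
- by move=> z; have := H1 z; lra.
- by move=> z; have := H2 z; lra.
- move=> i z; have := (H3 i).2 z.
  have : C3 i <= \sum_i C3 i.
    by rewrite (bigD1 i)//= lerDl sumr_ge0// => j _; exact: (H3 j).1.
  by lra.
Qed.

Let uQ : L1 (u \_ Q). Proof. by have [h _ _ _ _] := uW; exact: L2loc_L1 h tau20. Qed.
Let utQ : L1 (ut \_ Q). Proof. by have [_ h _ _ _] := uW; exact: L2loc_L1 h tau20. Qed.
Let DuQ i : L1 (Du_Q i).
Proof. by have [_ _ h _ _] := uW; exact: L2loc_L1 (h i) tau20. Qed.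

Let V n : Z -> R := T n (u \_ Q).

Let V_ge0 n z : 0 <= V n z.
Proof.
have h : {ae mu, forall w, 0 <= ((u : mZ -> R) \_ Q) w}.
  have [X [mX X0 sX]] := u_ge0; exists X; split => // w /= wn; apply: sX => /= w0.
  by apply: wn; rewrite patchE; case: ifPn => // /set_mem/QO.
exact: smoothing_ge0 h uQ.
Qed.

Let V_C1 n : C1 (V n).
Proof.
have [D HD] := C11_mkernel (R := R) (N := N) n.
exact: C11_C1 (smoothing_C11 uQ (HD 0).1).
Qed.

Let near_B n z w : n.+1%:R^-1 <= Num.min 1 (tau / 2) -> B z -> `|z - w| <= n.+1%:R^-1 -> Q w.
Proof.
have : (0 : R) <= n.+1%:R^-1 by rewrite invr_ge0.
move: (n.+1%:R^-1) => e e0; rewrite le_min => /andP[n1 n2] [z1 /andP[z2 z3]] zw.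
have wt := le_trans (norm_time (z - w)) zw.
have wx i := le_trans (norm_coord (z - w) i) zw.
split => [i|].
  have := z1 i; have := wx i; rewrite /= !mxE ler_norml => /andP[a1 a2] /andP[a3 a4].
  by apply/andP; split; lra.
move: wt; rewrite /= ler_norml => /andP[a1 a2]; apply/andP; split; lra.
Qed.

Let V_dt n z : n.+1%:R^-1 <= Num.min 1 (tau / 2) -> B z -> 'D_et (V n) z = T n (ut \_ Q) z.
Proof.
move=> n0 Bz; have [_ _ _ h _] := uW.
apply: (smoothing_weak_derivative h) => //; first exact: measurable_box.
by move=> w; exact: near_B.
Qed.

Let V_dx n i z : n.+1%:R^-1 <= Num.min 1 (tau / 2) -> B z ->
  'D_(ex i) (V n) z = T n (Du_Q i) z.
Proof.
move=> n0 Bz; have [_ _ _ _ h] := uW.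
apply: (smoothing_weak_derivative (h i)) => //; first exact: measurable_box.
by move=> w; exact: near_B.
Qed.

Let w n : Z -> R := fun z => (g \o V n) z * phi z.

Let gV_C1 n : C1 (g \o V n).
Proof.
apply: (@C1_comp _ _ g g') => // z; first exact: (dg (V_ge0 n z)).
exact: (cg' (V_ge0 n z)).
Qed.

Let w_C1 n : C1 (w n). Proof. exact: C1M. Qed.

Let w_off n z : ~ B z -> w n z = 0.
Proof. by move=> /phi_box h; rewrite /w h mulr0. Qed.

Let w_ge n z : phi z <= w n z.
Proof. by rewrite /w ler_peMl//=; have /andP[] := g_bounds (V_ge0 n z). Qed.

Let Dw n v z : 'D_v (w n) z = g (V n z) * 'D_v phi z + phi z * (g' (V n z) * 'D_v (V n) z).
Proof.
by rewrite C1_deriveM// (derive_comp1 v (V_C1 n) (dg (V_ge0 n z))).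
Qed.

Let P n : Z -> R := fun z => (G \o V n) z * phi z.

Let GV_C1 n : C1 (G \o V n).
Proof.
apply: (@C1_comp _ _ G g) => // z; first exact: dG.
have [d _] := dg (V_ge0 n z).
by apply: differentiable_continuous; exact/derivable1_diffP.
Qed.

Let P_C1 n : C1 (P n). Proof. exact: C1M. Qed.

Let DP n v z : 'D_v (P n) z = G (V n z) * 'D_v phi z + phi z * (g (V n z) * 'D_v (V n) z).
Proof.
by rewrite C1_deriveM// (derive_comp1 v (V_C1 n) (dG (V_ge0 n z))).
Qed.

Let P_box n z : ~ box M (- M) M z -> P n z = 0.
Proof.
move=> h; rewrite /P phi_box ?mulr0//; apply: contra_not h => -[z1 z2]; split => //.
by have := tau0; lra.
Qed.

(** The derivative of G(u_n) phi, whose integral is 0, is subtracted so that the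
time derivatives of u and u_n meet. *)
Let h_ n (z : mZ) : R := (ut \_ Q) z * w n z +
  \sum_i (A_Q i) z * 'D_(ex i) (w n) z - 'D_et (P n) z.

Let AQ i : L1 (A_Q i).
Proof. exact: L2loc_L1 (A_L2 i) tau20. Qed.

Let L1_C1_mul (f : mZ -> R) (F : Z -> R) : L1 f -> continuous F ->
  (forall z, ~ B z -> F z = 0) -> L1 (fun z => f z * F z).
Proof.
move=> f1 cF F0.
have [C _ FC] := bounded_off_compact cF (@compact_box R N _ _ _ : compact B) F0.
under eq_fun do rewrite mulrC.
by apply: (@L1_bounded_mul _ _ (F : mZ -> R) f C) => //; exact: measurable_continuous_spacetime.
Qed.

Let Dw_off n v z : ~ B z -> 'D_v (w n) z = 0.
Proof.
by move=> Bz; rewrite Dw (Dphi_box _ Bz) (phi_box Bz) mulr0 mul0r addr0.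
Qed.

Let w1 n : L1 (fun z => (ut \_ Q) z * w n z).
Proof. apply: L1_C1_mul => //; [exact: (C1_continuous (w_C1 n))|exact: w_off]. Qed.

Let w2 n : L1 (fun z => \sum_i (A_Q i) z * 'D_(ex i) (w n) z).
Proof.
apply: L1_sum => i; apply: L1_C1_mul => //; first exact: (w_C1 n).2.
by move=> z; exact: Dw_off.
Qed.

Let w3 n : L1 ('D_et (P n)) /\ (\int[mu]_z ('D_et (P n) z)%:E = 0)%E.
Proof. exact: (integral_partial_t0 (P_C1 n) (P_box n)). Qed.

Let h_L1 n : L1 (h_ n).
Proof. exact: (L1B (L1D (w1 n) (w2 n)) (w3 n).1). Qed.

(** Since g >= 1, the source tested with phi is at most the source tested with
g(u_n) phi. *)
Let test_h n :
  (\int[mu]_(z in Omega) (source z * (phi z)%:E) <= (\int[mu]_z h_ n z)%:E)%E.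
Proof.
have w0 z : 0 <= w n z by exact: le_trans (phi_ge0 z) (w_ge n z).
have sw : supp (w n) `<=` B by apply: supp_box; exact: w_off.
have cw : C1c (w n).
  split; [exact: (w_C1 n).1|exact: (w_C1 n).2|].
  apply: subclosed_compact sw; [exact: closed_closure|exact: (@compact_box R N)].
apply: (@le_trans _ _ (\int[mu]_(z in Omega) (source z * (w n z)%:E))%E).
  apply: ge0_le_integral_all => z _; first by rewrite mule_ge0// lee_fin.
  by rewrite lee_wpmul2l// lee_fin.
apply: (le_trans (test cw w0 sw)).
have -> : (\int[mu]_(z in Omega) (ut z * w n z)%:E = \int[mu]_z ((ut \_ Q) z * w n z)%:E)%E.
  rewrite integral_mkcond; apply: eq_integral => z _.
  have [Bz|Bz] := pselect (B z).
    by rewrite !patchE !mem_set//; [exact: BQ|exact/QO/BQ].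
  by rewrite w_off// !mulr0 patchE w_off// mulr0; case: ifP.
have -> : (\int[mu]_(z in Omega) (dotmul (A z) (grad_x (w n) z))%:E =
    \int[mu]_z (\sum_i (A_Q i) z * 'D_(ex i) (w n) z)%:E)%E.
  rewrite integral_mkcond; apply: eq_integral => z _.
  have [Bz|Bz] := pselect (B z).
    rewrite patchE mem_set; last exact/QO/BQ.
    rewrite /dotmul; congr EFin; apply: eq_bigr => i _.
    by rewrite patchE mem_set ?mxE//; exact: BQ.
  rewrite [in RHS]big1; last by move=> i _; rewrite Dw_off// mulr0.
  rewrite patchE; case: ifP => // _; rewrite /dotmul big1// => i _.
  by rewrite [X in _ * X](_ : _ = 0) ?mulr0// [LHS]mxE; exact: Dw_off.
rewrite !integralE_Rintegral// -EFinD lee_fin /h_.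
have w30 : \int[mu]_z 'D_et (P n) z = 0 by rewrite /Rintegral (w3 n).2.
rewrite RintegralB//; [|by apply: L1D|exact: (w3 n).1].
by rewrite RintegralD// w30 subr0.
Qed.

Let err n (z : mZ) : R := `|V n z - (u \_ Q) z| + `|T n (ut \_ Q) z - (ut \_ Q) z| +
  \sum_i `|T n (Du_Q i) z - (Du_Q i) z|.

Let L1_smoothing_err n (f : mZ -> R) : L1 f -> L1 (fun z => `|T n f z - f z|).
Proof.
move=> f1; apply: integrable_norm.
by apply: L1B => //; exact: L1_smoothing.
Qed.

Let err_L1 n : L1 (err n).
Proof.
apply: L1D; first by apply: L1D; exact: L1_smoothing_err.
by apply: L1_sum => i; exact: L1_smoothing_err.
Qed.

Let smoothing_err_cvg (f : Z -> R) : L1 (f \_ Q) -> forall e : R, 0 < e ->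
  \forall n \near \oo, \int[mu]_z `|T n (f \_ Q) z - (f \_ Q) z| <= e.
Proof.
move=> f1 e e0.
have f0 z : ~ Q z -> (f \_ Q) z = 0 by move=> Qz; rewrite patchE memNset.
have := smoothing_cvg_box f1 f0 e0.
apply: filterS => n; rewrite integralE_Rintegral ?lee_fin//.
exact: L1_smoothing_err.
Qed.

Let err_cvg (e : R) : 0 < e -> \forall n \near \oo, \int[mu]_z err n z <= e.
Proof.
move=> e0.
pose e' := e / (N%:R + 2).
have e'0 : 0 < e' by rewrite divr_gt0// ltr_wpDl.
have c1 := smoothing_err_cvg uQ e'0.
have c2 := smoothing_err_cvg utQ e'0.
have c3 : \forall n \near \oo, forall i : 'I_N,
   \int[mu]_z `|T n (Du_Q i) z - (Du_Q i) z| <= e'.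
  by apply: filter_forall => i; exact: smoothing_err_cvg (DuQ i) _ e'0.
near=> n.
rewrite /err RintegralD//; last 2 first.
  by apply: L1D; exact: L1_smoothing_err.
  by apply: L1_sum => i; exact: L1_smoothing_err.
rewrite RintegralD//; [|exact: L1_smoothing_err|exact: L1_smoothing_err].
rewrite Rintegral_sum//; last by move=> i; exact: L1_smoothing_err.
have -> : e = e' + e' + \sum_(i < N) e'.
  by rewrite sumr_const card_ord -mulr_natl /e'; field; rewrite gt_eqF// ltr_wpDl.
apply: lerD; first apply: lerD.
- by near: n.
- by near: n.
- apply: ler_sum => i _; have : forall i : 'I_N,
   \int[mu]_z `|T n (Du_Q i) z - (Du_Q i) z| <= e' by near: n.
  exact.
Unshelve. all: by end_near.
Qed.

Let gradE i z : grad_x phi z 0 i = 'D_(ex i) phi z.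
Proof. by rewrite mxE. Qed.

Let limitE z : limit_integrand z =
  - ('D_et phi z * G (U z)) +
  \sum_i (g (U z) * 'D_(ex i) phi z) * (A_Q i) z +
  \sum_i (g' (U z) * phi z * (A_Q i) z) * (A_Q i) z.
Proof.
have [Bz|Bz] := pselect (B z).
  have Qz : (z : mZ) \in (Q : set mZ) by apply: mem_set; exact: BQ.
  rewrite /limit_integrand /U patchE Qz mulrC; congr (_ + _ + _).
    rewrite /dotmul mulr_sumr; apply: eq_bigr => i _.
    by rewrite patchE Qz gradE; ring.
  rewrite /dotmul mulr_sumr; apply: eq_bigr => i _.
  by rewrite patchE Qz; ring.
rewrite /limit_integrand (Dphi_box _ Bz) (phi_box Bz) !mulr0 !mul0r.
rewrite /dotmul !big1 ?mulr0// => i _.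
- by rewrite !mul0r.
- by rewrite (Dphi_box _ Bz) mulr0 mul0r.
- by rewrite gradE (Dphi_box _ Bz) mulr0.
Qed.

Let U_ge0 z : 0 <= U z. Proof. by rewrite le_max lexx. Qed.

Let mU : measurable_fun [set: mZ] (U : mZ -> R).
Proof. by apply: measurable_maxr => //; exact: L1_measurable uQ. Qed.

Let AQ_le1 i z : `|(A_Q i) z| <= 1.
Proof.
by rewrite patchE; case: ifP => _; [exact: mean_curvature_coord_le1|rewrite normr0].
Qed.

Let gg'_norm r : 0 <= r -> `|g r| <= 2 /\ `|g' r| <= L.
Proof.
move=> r0; have /andP[g1 g2] := g_bounds r0; have /andP[h1 h2] := g'_bounds r0.
by rewrite ger0_norm ?ler0_norm//; [split=> //; lra|lra].
Qed.

Lemma limit_integrand_L1 : L1 limit_integrand.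
Proof.
have [C [C0 pC ptC pxC]] := phi_bounded.
have mD v : measurable_fun [set: mZ] ('D_v phi : mZ -> R).
  by apply: measurable_continuous_spacetime; exact: (phi_C1.2 v).
have mphi : measurable_fun [set: mZ] (phi : mZ -> R).
  by apply: measurable_continuous_spacetime; exact: C1_continuous.
have mgU : measurable_fun [set: mZ] (fun z => g (U z)) by exact: measurableT_comp mg mU.
have mg'U : measurable_fun [set: mZ] (fun z => g' (U z)) by exact: measurableT_comp mg' mU.
have -> : limit_integrand = fun z : mZ => (-1) * ('D_et phi z * G (U z)) +
  \sum_i (g (U z) * 'D_(ex i) phi z) * (A_Q i) z +
  \sum_i (g' (U z) * phi z * (A_Q i) z) * (A_Q i) z.
  by apply/funext => z; rewrite limitE mulN1r.
apply: L1D; first apply: L1D.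
- apply: L1Z; apply: (@L1_bounded_mul _ _ ('D_et phi : mZ -> R) (fun z => G (U z)) C) => //.
  have mGU : measurable_fun [set: mZ] (fun z => G (U z)) by exact: measurableT_comp mG mU.
  apply: (@le_integrable _ _ _ mu setT measurableT _ (EFin \o (fun z => 2 * (u \_ Q) z))).
  + exact/measurable_EFinP.
  + move=> z _; have /andP[G1 G2] := G_bounds (U_ge0 z).
    rewrite /= lee_fin normrM (ger0_norm G1) (ger0_norm (_ : 0 <= 2))//.
    apply: (le_trans G2); rewrite ler_pM2l// /U ge_max normr_ge0/=; exact: ler_norm.
  + exact: L1Z.
- apply: L1_sum => i.
  apply: (@L1_bounded_mul _ _ (fun z => g (U z) * 'D_(ex i) phi z) _ (2 * C)) => //.
    exact: measurable_funM.
  move=> z; rewrite normrM; apply: ler_pM => //; first exact: (gg'_norm (U_ge0 z)).1.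
- apply: L1_sum => i.
  apply: (@L1_bounded_mul _ _ (fun z => g' (U z) * phi z * (A_Q i) z) _ (L * C)) => //.
    apply: measurable_funM; first exact: measurable_funM.
    exact: L1_measurable (AQ i).
  move=> z; rewrite normrM -[leRHS]mulr1; apply: ler_pM => //.
  rewrite normrM; apply: ler_pM => //; exact: (gg'_norm (U_ge0 z)).2.
Qed.

Let max0_lip (r x : R) : 0 <= r -> `|r - Num.max 0 x| <= `|r - x|.
Proof.
move=> r0; case: (lerP 0 x) => // x0.
by rewrite subr0 !ger0_norm//; lra.
Qed.

(** Off the box everything vanishes; on it, mollification commutes with
differentiation once [n] is large. The bound |A(Du)| <= 1 makes every error
linear in [err]. *)
Let h_le_limit : exists2 K : R, 0 <= K & forall n z, n.+1%:R^-1 <= Num.min 1 (tau / 2) ->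
  h_ n z <= limit_integrand z + K * err n z.
Proof.
have [C [C0 pC ptC pxC]] := phi_bounded.
exists (C * (L + L * N%:R + 2)); first by rewrite mulr_ge0// !addr_ge0// mulr_ge0.
move=> n z n0.
have err0 : 0 <= err n z by rewrite !addr_ge0// sumr_ge0.
have [Bz|Bz] := pselect (B z); last first.
  rewrite limitE /h_ (w_off _ Bz) DP !(Dphi_box _ Bz) (phi_box Bz) !mulr0 !mul0r.
  rewrite addr0 subr0 oppr0 !big1; last 3 first.
  - by move=> i _; rewrite !(mulr0, mul0r).
  - by move=> i _; rewrite (Dphi_box _ Bz) !(mulr0, mul0r).
  - by move=> i _; rewrite (Dw_off _ _ Bz) mulr0.
  by rewrite !add0r !mulr_ge0// !addr_ge0// mulr_ge0.
have Qz : (z : mZ) \in (Q : set mZ) by apply: mem_set; exact: BQ.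
pose v := V n z; pose y := U z; have v0 : 0 <= v := V_ge0 n z; have y0 : 0 <= y := U_ge0 z.
pose e0 := `|V n z - (u \_ Q) z|; pose e1 := `|T n (ut \_ Q) z - ut z|.
pose e2 i := `|T n (Du_Q i) z - Du z 0 i|.
have vy : `|v - y| <= e0 by exact: max0_lip.
have -> : err n z = e0 + e1 + \sum_i e2 i.
  have utE : (ut \_ Q) z = ut z by rewrite patchE Qz.
  rewrite /err /e1 -utE; congr (_ + _); apply: eq_bigr => i _.
  by rewrite patchE Qz.
pose F := T n (ut \_ Q) z.
pose E i := T n (Du_Q i) z.
pose a i := A z 0 i; pose f i := 'D_(ex i) phi z; pose ft := 'D_et phi z; pose ph := phi z.
have hE : h_ n z = g v * ph * (ut z - F) + g' v * ph * (\sum_i a i * E i)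
   + g v * (\sum_i a i * f i) - G v * ft.
  rewrite /h_ DP V_dt// patchE Qz -/F -/v -/ft -/ph.
  under eq_bigr do rewrite patchE Qz Dw V_dx// -/v -/ph.
  rewrite (_ : \sum_i _ = \sum_i (g' v * ph * (a i * E i) + g v * (a i * f i))); last first.
    by apply: eq_bigr => i _; rewrite /a /E /f; ring.
  by rewrite big_split/= -!mulr_sumr /w /= -/v -/ph; ring.
have lE : limit_integrand z = - (G y * ft) + g y * (\sum_i a i * f i) + g' y * ph * (\sum_i a i * a i).
  rewrite limitE -/y -/ft (mulrC ft); congr (_ + _ + _); rewrite mulr_sumr; apply: eq_bigr => i _;
  rewrite !patchE Qz -/(a i) -?/(f i) -?/ph; ring.
rewrite hE lE.
have a1 i : `|a i| <= 1 by exact: mean_curvature_coord_le1.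
have aa1 : \sum_i a i * a i <= 1 by exact: mean_curvature_sqr_le1.
have aa0 : 0 <= \sum_i a i * a i by exact: dotmul_ge0.
have aD : \sum_i a i * a i <= \sum_i a i * Du z 0 i by exact: mean_curvature_coercive.
have aE : - (\sum_i e2 i) <= \sum_i a i * E i - \sum_i a i * Du z 0 i.
  rewrite -sumrB -sumrN; apply: ler_sum => i _.
  rewrite -mulrBr lerNl; apply: (le_trans (ler_norm _)); rewrite normrN normrM.
  by rewrite ler_piMl.
have af : `|\sum_i a i * f i| <= N%:R * C.
  apply: (le_trans (ler_norm_sum _ _ _)).
  rewrite mulr_natl -[N in leRHS]card_ord -sumr_const; apply: ler_sum => i _.
  by rewrite normrM -[leRHS]mul1r ler_pM//; exact: pxC.
have S20 : 0 <= \sum_i e2 i by apply: sumr_ge0 => i _; exact: normr_ge0.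
have ph0 : 0 <= ph by exact: phi_ge0.
have phC : ph <= C by apply: le_trans (pC z); exact: ler_norm.
have /andP[gv1 gv2] := g_bounds v0.
have /andP[g'v1 g'v2] := g'_bounds v0.
move: (\sum_i a i * a i) (\sum_i a i * f i) (\sum_i a i * E i) (\sum_i a i * Du z 0 i) (\sum_i e2 i)
  aa1 aa0 aD aE af S20 => aa sf sE sD s2 aa1 aa0 aD aE af S20.
have e00 : 0 <= e0 := normr_ge0 _. have e10 : 0 <= e1 := normr_ge0 _.
have N0 : (0 : R) <= N%:R by [].
(* [t1]: u_t against its mollification. [t2]: the mollified gradient against Du,
   then coercivity, where the sign of g' matters. [t3]-[t5]: u_n against u. *)
have t1 : g v * ph * (ut z - F) <= 2 * C * e1.
  apply: (@le_trans _ _ (g v * ph * e1)).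
    by rewrite ler_wpM2l ?mulr_ge0//; [lra|rewrite /e1 distrC ler_norm].
  by rewrite ler_wpM2r// ler_pM//; lra.
have t2 : g' v * ph * sE <= g' v * ph * aa + L * C * s2.
  have : - (g' v * ph) * (aa - s2) <= - (g' v * ph) * sE.
    by rewrite ler_wpM2l//; [rewrite oppr_ge0 mulr_le0_ge0|lra].
  have : - g' v * ph * s2 <= L * C * s2.
    by rewrite ler_wpM2r// ler_pM//; lra.
  by lra.
have t3 : g' v * ph * aa <= g' y * ph * aa + L * e0 * C.
  have : (g' v - g' y) * (ph * aa) <= L * e0 * C.
    apply: (@le_trans _ _ (L * e0 * (ph * aa))).
      rewrite ler_wpM2r ?mulr_ge0//; apply: (le_trans (ler_norm _)).
      by apply: (le_trans (g'_lip v0 y0)); rewrite ler_wpM2l.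
    by rewrite ler_wpM2l ?mulr_ge0// -[leRHS]mulr1 ler_pM.
  by lra.
have t4 : g v * sf <= g y * sf + L * e0 * (N%:R * C).
  have : (g v - g y) * sf <= L * e0 * (N%:R * C).
    apply: (le_trans (ler_norm _)); rewrite normrM ler_pM//.
    by apply: (le_trans (g_lip v0 y0)); rewrite ler_wpM2l.
  by lra.
have t5 : - (G v * ft) <= - (G y * ft) + 2 * e0 * C.
  have : (G y - G v) * ft <= 2 * e0 * C.
    apply: (le_trans (ler_norm _)); rewrite normrM ler_pM//; last exact: ptC.
    by rewrite distrC; apply: (le_trans (G_lip v0 y0)); rewrite ler_wpM2l.
  by lra.
have q1 : 0 <= C * L * e1 by rewrite !mulr_ge0.
have q2 : 0 <= C * L * N%:R * e1 by rewrite !mulr_ge0.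
have q3 : 0 <= C * L * N%:R * s2 by rewrite !mulr_ge0.
have q4 : 0 <= C * s2 by rewrite !mulr_ge0.
by lra.
Qed.

(** The inequality is tested with the C1 function w_n = g(u_n) phi, where u_n is the
mollification of u, and the integral of d_t (G(u_n) phi), which is 0, is
subtracted. The time derivative of u_n then cancels against u_t up to an error,
and the whole integrand is at most the limit integrand up to errors that are
linear in L1-convergent quantities ([h_le_limit]). No pointwise convergence of
the mollified functions is involved. *)
Lemma key_inequality :
  (\int[mu]_(z in Omega) (source z * (phi z)%:E) <=
   (\int[mu]_z limit_integrand z)%:E)%E.
Proof.
have [K K0 hK] := h_le_limit.
apply/lee_addgt0Pr => e e0.
have K1 : 0 < K + 1 by rewrite ltr_wpDl.
near \oo => n.
have nm : n.+1%:R^-1 <= Num.min 1 (tau / 2).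
  near: n; have m0 : 0 < Num.min 1 (tau / 2) by rewrite lt_min ltr01 tau20.
  by near do apply: ltW; exact: near_infty_natSinv_lt (PosNum m0).
have en : \int[mu]_z err n z <= e / (K + 1).
  by near: n; apply: err_cvg; rewrite divr_gt0.
apply: (le_trans (test_h n)); rewrite -EFinD lee_fin.
apply: (@le_trans _ _ (\int[mu]_z (limit_integrand z + K * err n z))).
  apply: le_Rintegral => //.
  - by apply: L1D; [exact: limit_integrand_L1|apply: L1Z].
  - by move=> z _; exact: hK.
rewrite RintegralD//; [|exact: limit_integrand_L1|exact: L1Z].
rewrite lerD2l RintegralZl//.
apply: (@le_trans _ _ ((K + 1) * (e / (K + 1)))).
  apply: ler_pM => //; last by rewrite lerDl.
  by apply: Rintegral_ge0 => z _; rewrite !addr_ge0// sumr_ge0.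
by rewrite mulrC divfK// gt_eqF.
Unshelve. all: by end_near.
Qed.

End key_inequality.

(** * A Caccioppoli inequality *)

(** Completing the square (c x - y/c)^2 >= 0. *)
Lemma weighted_young (R : realFieldType) (s x y c : R) : 0 < c -> 0 <= x -> 0 <= y -> s ^+ 2 <= x * y ->
  2 * `|s| <= c * x + y / c.
Proof.
move=> c0 x0 y0 sxy.
have yc0 : 0 <= y / c by rewrite divr_ge0// ltW.
have cx0 : 0 <= c * x by rewrite mulr_ge0// ltW.
have e : c * x * (y / c) = x * y by field; rewrite gt_eqF.
rewrite -(@ler_pXn2r _ 2) ?nnegrE ?mulr_ge0 ?addr_ge0//.
rewrite exprMn real_normK ?num_real//.
have := sqr_ge0 (c * x - y / c); move: sxy; rewrite !expr2; nra.
Qed.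

Section nonneg_calculus.
Context {R : realType}.

Lemma derive_bounded_lip (f f' : R -> R) (C : R) :
  (forall r : R, 0 <= r -> is_derive r 1 f (f' r)) ->
  (forall r : R, 0 <= r -> `|f' r| <= C) ->
  forall r x : R, 0 <= r -> 0 <= x -> `|f r - f x| <= C * `|r - x|.
Proof.
move=> df f'C.
have wlog_le r x : 0 <= r -> r <= x -> `|f r - f x| <= C * `|r - x|.
  move=> r0 rx.
  have [||c] := @MVT_segment R f f' r x rx.
  - by move=> y; rewrite in_itv/= => /andP[ry _]; apply: df; rewrite (le_trans r0)// ltW.
  - apply: derivable_within_continuous => y; rewrite in_itv/= => /andP[ry _].
    by have [] := df y (le_trans r0 ry).
  rewrite in_itv/= => /andP[rc _] E.
  rewrite distrC E normrM (distrC r) ler_wpM2r//; apply: f'C; exact: le_trans rc.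
move=> r x r0 x0; have [rx|/ltW xr] := leP r x; first exact: wlog_le.
by rewrite distrC (distrC r); exact: wlog_le.
Qed.

Lemma is_derive_affine_comp (f : R -> R) (df a b x : R) : is_derive x 1 f df ->
  is_derive x 1 (fun y => a + b * f y) (b * df).
Proof.
move=> h; have D := is_deriveD (is_derive_cst a x (1 : R)) (is_deriveZ b h).
by rewrite add0r in D.
Qed.

Variable kappa : R.
Hypothesis kappa0 : 0 < kappa.

Let X_ge1 r : 0 <= r -> 1 <= 1 + r / kappa.
Proof. by move=> r0; rewrite lerDl divr_ge0// ltW. Qed.

Lemma is_derive_affine_powR (e r : R) : 0 <= r ->
  is_derive r 1 (fun r => (1 + r / kappa) `^ e) (e / kappa * (1 + r / kappa) `^ (e - 1)).
Proof.
move=> r0.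
have X0 : 0 < 1 + r / kappa by apply: lt_le_trans (X_ge1 r0).
have d1 : is_derive r 1 (fun r : R => 1 + r / kappa) kappa^-1.
  have := is_derive_affine_comp 1 kappa^-1 (is_derive_id r (1 : R)).
  by rewrite mulr1; congr is_derive; apply/funext => x; rewrite mulrC.
have := @is_derive1_comp R (fun x => x `^ e) (fun r => 1 + r / kappa) r _ _ (is_derive1_powR e X0) d1.
by rewrite mulrAC.
Qed.

Lemma affine_powR_le1 (e r : R) : 0 <= r -> 0 <= e -> 0 <= (1 + r / kappa) `^ (- e) <= 1.
Proof.
move=> r0 e0; rewrite powR_ge0/= powRN invf_le1 ?powR_gt0//.
  by rewrite -[leLHS](powRr0 (1 + r / kappa)); apply: ler_powR => //; exact: X_ge1.
by apply: lt_le_trans (X_ge1 r0).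
Qed.

End nonneg_calculus.

Section caccioppoli.
Context {R : realType} {N : nat}.
Local Notation Z := ('rV[R]_N * R)%type.
Local Notation mZ := ('rV[R]_N * measurableTypeR R)%type.
Local Notation mu := (@dxdt R N).
Local Notation Omega := positive_times.
Local Notation et := ((0 : 'rV[R]_N), (1 : R)).

Variables (u ut : Z -> R) (Du : Z -> 'rV[R]_N) (source : Z -> \bar R).
Hypothesis uW : W12loc u ut Du.
Hypothesis u_ge0 : {ae mu, forall z, Omega z -> 0 <= u z}.
Hypothesis A_L2 : forall i, L2loc (fun z => mean_curvature_op (Du z) 0 i).
Hypothesis source_ge0 : forall z, (0 <= source z)%E.

Variables (phi : Z -> R) (M tau : R).
Hypothesis tau0 : 0 < tau.
Hypothesis test : forall f : Z -> R, C1c f -> (forall z, 0 <= f z) ->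
  supp f `<=` box M tau M ->
  (\int[mu]_(z in Omega) (source z * (f z)%:E) <=
   \int[mu]_(z in Omega) (ut z * f z)%:E +
   \int[mu]_(z in Omega) (dotmul (mean_curvature_op (Du z)) (grad_x f z))%:E)%E.
Hypothesis phi_C1 : C1 phi.
Hypothesis phi_ge0 : forall z, 0 <= phi z.
Hypothesis phi_box : forall z, ~ box M tau M z -> phi z = 0.

Variable psi : Z -> R.
Hypothesis psi_ge0 : forall z, 0 <= psi z.
Hypothesis grad_psi : forall z, dotmul (grad_x phi z) (grad_x phi z) <= phi z * psi z.
Hypothesis dt_psi : forall z, - 'D_et phi z <= psi z.

Variables d kappa : R.
Hypothesis d01 : 0 < d < 1.
Hypothesis kappa0 : 0 < kappa.

Let X r : R := 1 + r / kappa.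
(** The weight in the test function; g', g2 are its derivatives and G its
primitive vanishing at 0. *)
Let g r : R := 1 + X r `^ (- d).
Let g' r : R := - (d / kappa) * X r `^ (- (d + 1)).
Let g2 r : R := d * (d + 1) / kappa ^+ 2 * X r `^ (- (d + 2)).
Let G r : R := r + kappa / (1 - d) * (X r `^ (1 - d) - 1).
Let L := d / kappa + d * (d + 1) / kappa ^+ 2.

Let d0 : 0 < d. Proof. by case/andP: d01. Qed.
Let d1 : d < 1. Proof. by case/andP: d01. Qed.
Let dk0 : 0 <= d / kappa. Proof. by rewrite divr_ge0// ltW. Qed.
Let dk20 : 0 <= d * (d + 1) / kappa ^+ 2.
Proof. by rewrite divr_ge0 ?sqr_ge0// mulr_ge0 ?addr_ge0// ltW. Qed.

Let dg (r : R) : 0 <= r -> is_derive r 1 g (g' r).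
Proof.
move=> r0; have := is_derive_affine_comp 1 1 (is_derive_affine_powR kappa0 (- d) r0).
rewrite mul1r /g' /X opprD mulNr; congr (is_derive _ _ _ _).
by apply/funext => y; rewrite mul1r.
Qed.

Let dg' (r : R) : 0 <= r -> is_derive r 1 g' (g2 r).
Proof.
move=> r0.
have := is_derive_affine_comp 0 (- (d / kappa)) (is_derive_affine_powR kappa0 (- (d + 1)) r0).
rewrite (_ : _ * (_ * _) = g2 r).
  by congr (is_derive _ _ _ _); apply/funext => y; rewrite add0r.
rewrite /g2 /X -opprD -addrA (_ : 1 + 1 = 2 :> R)//.
by field; rewrite gt_eqF.
Qed.

Let dG (r : R) : 0 <= r -> is_derive r 1 G (g r).
Proof.
move=> r0; have d10 : 1 - d != 0 by rewrite gt_eqF// subr_gt0.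
have D := is_derive_affine_comp (- (kappa / (1 - d))) (kappa / (1 - d)) (is_derive_affine_powR kappa0 (1 - d) r0).
have := is_deriveD (is_derive_id r (1 : R)) D.
rewrite (_ : 1 + kappa / (1 - d) * _ = g r).
  congr (is_derive _ _ _ _); apply/funext => y.
  by rewrite [LHS]/GRing.add/= /G /X mulrBr mulr1 (addrC (- _)).
rewrite /g /X mulrA (_ : 1 - d - 1 = - d); last by ring.
rewrite (_ : kappa / (1 - d) * ((1 - d) / kappa) = 1) ?mul1r//.
by field; rewrite gt_eqF// d10.
Qed.

Let g_bounds r : 0 <= r -> 1 <= g r <= 2.
Proof.
move=> r0; have /andP[a b] := affine_powR_le1 kappa0 r0 (ltW d0).
by rewrite /g /X; apply/andP; split; lra.
Qed.

Let g'_bounds r : 0 <= r -> - L <= g' r <= 0.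
Proof.
move=> r0; have d10 : 0 <= d + 1 by rewrite addr_ge0// ltW.
have /andP[a b] := affine_powR_le1 kappa0 r0 d10.
rewrite /g' /L mulNr oppr_le0 mulr_ge0// andbT lerN2.
rewrite -[leLHS]addr0; apply: lerD => //; by rewrite ler_piMr.
Qed.

Let g2_bound r : 0 <= r -> `|g2 r| <= L.
Proof.
move=> r0; have d20 : 0 <= d + 2 by rewrite addr_ge0// ltW.
have /andP[a b] := affine_powR_le1 kappa0 r0 d20.
have : g2 r <= d * (d + 1) / kappa ^+ 2 by rewrite /g2 ler_piMr.
by rewrite ger0_norm /L; [have := dk0; lra|rewrite /g2 mulr_ge0].
Qed.

Let G_lip r x : 0 <= r -> 0 <= x -> `|G r - G x| <= 2 * `|r - x|.
Proof.
apply: (derive_bounded_lip dG) => y y0.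
by have /andP[a b] := g_bounds y0; rewrite ger0_norm//; lra.
Qed.

Let G_bounds r : 0 <= r -> 0 <= G r <= 2 * r.
Proof.
move=> r0.
have G0 : G 0 = 0 by rewrite /G /X mul0r addr0 powR1 subrr mulr0 addr0.
have := G_lip r0 (lexx 0); rewrite G0 !subr0 (ger0_norm r0) => h.
rewrite (le_trans (ler_norm _) h) andbT /G addr_ge0// mulr_ge0//.
  by rewrite divr_ge0 ?(ltW kappa0)// subr_ge0 ltW.
rewrite subr_ge0 -[leLHS](powRr0 (X r)) ler_powR//; last by rewrite subr_ge0 ltW.
by rewrite /X lerDl divr_ge0// ltW.
Qed.

Let measurable_X e : measurable_fun setT (fun r : R => X r `^ e).
Proof.
apply: (measurableT_comp (measurable_powR e)).
apply: measurable_funD => //; exact: measurable_funM.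
Qed.

Definition caccioppoli_rhs (z : mZ) : R :=
  kappa * (4 + d^-1) * (1 + Num.max 0 (u z) / kappa) `^ (1 + d) * psi z.

(** With c = -g'(u) = (d/kappa) (1 + u/kappa)^(-d-1), the flux term is bounded by
2 |A.grad phi| <= c phi |A|^2 + psi/c; the first summand is cancelled by the
term with g', and 1/c = (kappa/d) (1 + u/kappa)^(1+d). The time term is at most
2 u psi <= 2 kappa (1 + u/kappa)^(1+d) psi. *)
Lemma caccioppoli :
  (\int[mu]_(z in Omega) (source z * (phi z)%:E) <= \int[mu]_z (caccioppoli_rhs z)%:E)%E.
Proof.
have Xm := measurable_X.
have L0 : 0 <= L by rewrite addr_ge0.
have cg' r : 0 <= r -> {for r, continuous g'}.
  move=> r0; have [dr _] := dg' r0.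
  by apply: differentiable_continuous; exact/derivable1_diffP.
have glip r x : 0 <= r -> 0 <= x -> `|g r - g x| <= L * `|r - x|.
  apply: (derive_bounded_lip dg) => y y0.
  by have /andP[a b] := g'_bounds y0; rewrite ler0_norm//; lra.
have g'lip r x : 0 <= r -> 0 <= x -> `|g' r - g' x| <= L * `|r - x|.
  exact: (derive_bounded_lip dg').
have mg : measurable_fun setT g by apply: measurable_funD => //; exact: Xm.
have mg' : measurable_fun setT g' by apply: measurable_funM => //; exact: Xm.
have mG : measurable_fun setT G.
  apply: measurable_funD => //; apply: measurable_funM => //.
  by apply: measurable_funB => //; exact: Xm.
apply: (le_trans (key_inequality uW u_ge0 A_L2 source_ge0 L0 dG dg cg' g_bounds g'_bounds
  G_bounds glip g'lip G_lip mg mg' mG tau0 test phi_C1 phi_ge0 phi_box)).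
have lL1 := limit_integrand_L1 uW A_L2 g_bounds g'_bounds G_bounds mg mg' mG tau0 phi_C1 phi_box.
set lim := limit_integrand _ _ _ _ _ _ in lL1 *.
rewrite -integralE_Rintegral//.
apply: (@le_trans _ _ (\int[mu]_z (Num.max (lim z) 0)%:E)%E).
  apply: le_integral => //.
  - apply: (@le_integrable _ _ _ mu setT measurableT _ (EFin \o lim)) => //.
    + by apply/measurable_EFinP; apply: measurable_maxr => //; exact: L1_measurable lL1.
    + by move=> z _; rewrite /= lee_fin; case: (lerP (lim z) 0) => // _; rewrite normr0.
  - by move=> z _; rewrite lee_fin le_max lexx.
apply: ge0_le_integral_all => z _; rewrite lee_fin; first by rewrite le_max lexx orbT.
have r0 : 0 <= Num.max 0 (u z) by rewrite le_max lexx.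
rewrite /lim /limit_integrand /caccioppoli_rhs; move: (Num.max 0 (u z)) r0 => r r0.
have X1 : 1 <= X r by rewrite /X lerDl divr_ge0// ltW.
have X0 : 0 < X r by apply: lt_le_trans X1.
rewrite -/(X r).
set a := mean_curvature_op (Du z); set gr := grad_x phi z; set ft := 'D_et phi z.
have ps0 := psi_ge0 z; have ph0 := phi_ge0 z; have gps := grad_psi z; have dps := dt_psi z.
have cs := dotmul_CS a gr.
have Xd1 : 0 < X r `^ (1 + d) by rewrite powR_gt0.
have XdX : X r <= X r `^ (1 + d).
  by rewrite -[leLHS]powRr1 ?(ltW X0)//; apply: ler_powR => //; rewrite lerDl ltW.
have rX : r <= kappa * X r.
  by rewrite /X mulrDr mulr1 mulrC mulfVK ?gt_eqF// lerDr ltW.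
have kps : 0 <= kappa * (4 + d^-1) * X r `^ (1 + d) * psi z.
  by rewrite !mulr_ge0 ?addr_ge0 ?invr_ge0 ?powR_ge0// ltW.
rewrite ge_max kps andbT.
have /andP[g1 g2'] := g_bounds r0; have /andP[G1 G2] := G_bounds r0.
have aa0 : 0 <= dotmul a a := dotmul_ge0 a.
have t1 : - (G r * ft) <= 2 * kappa * X r `^ (1 + d) * psi z.
  apply: (@le_trans _ _ (G r * psi z)).
    by rewrite -mulrN ler_wpM2l.
  rewrite ler_wpM2r// (le_trans G2)// -mulrA ler_pM2l// (le_trans rX)//.
  by rewrite ler_pM2l.
have c0 : 0 < d / kappa * X r `^ (- (d + 1)).
  by rewrite mulr_gt0 ?powR_gt0// divr_gt0.
have t2 : g r * dotmul a gr + g' r * phi z * dotmul a a <= kappa / d * X r `^ (1 + d) * psi z.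
  have y : dotmul a gr ^+ 2 <= (phi z * dotmul a a) * psi z.
    by apply: (le_trans cs); rewrite (mulrC (phi z)) -mulrA ler_wpM2l.
  have := weighted_young c0 (mulr_ge0 ph0 aa0) ps0 y.
  have -> : psi z / (d / kappa * X r `^ (- (d + 1))) = kappa / d * X r `^ (1 + d) * psi z.
    rewrite powRN (addrC d 1); field.
    by rewrite !gt_eqF.
  have : g r * dotmul a gr <= 2 * `|dotmul a gr|.
    apply: (le_trans (ler_norm _)); rewrite normrM ler_wpM2r// ger0_norm//; lra.
  by rewrite /g'; lra.
have q : 0 <= 2 * kappa * X r `^ (1 + d) * psi z.
  by rewrite !mulr_ge0 ?powR_ge0// ltW.
have -> : kappa * (4 + d^-1) * X r `^ (1 + d) * psi z =
   kappa / d * X r `^ (1 + d) * psi z + 2 * (2 * kappa * X r `^ (1 + d) * psi z) by field; rewrite gt_eqF.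
by lra.
Qed.

End caccioppoli.

(** * Lower bounds for the kernel and the source *)

Section kernel_bound.
Context {R : realType} {N : nat}.
Implicit Types (x w : 'rV[R]_N).

Lemma coord_le_enorm w i : `|w 0 i| <= enorm w.
Proof.
rewrite -(@ler_pXn2r _ 2) ?nnegrE ?sqrtr_ge0//.
by rewrite real_normK ?num_real// enorm_sqr coord_sqr_le_dotmul.
Qed.

Lemma enorm_le_coord w (m : R) : (1 <= N)%N -> 0 <= m -> (forall i, `|w 0 i| <= m) ->
  enorm w <= N%:R * m.
Proof.
move=> N1 m0 wm.
have N1' : (1 : R) <= N%:R by rewrite ler1n.
rewrite -(@ler_pXn2r _ 2) ?nnegrE ?sqrtr_ge0 ?mulr_ge0// enorm_sqr exprMn.
apply: (@le_trans _ _ (N%:R * m ^+ 2)); last first.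
  by rewrite ler_wpM2r ?sqr_ge0// expr2 ler_peMl.
rewrite mulr_natl -[N in leRHS]card_ord -sumr_const; apply: ler_sum => i _.
by rewrite -expr2 -real_normK ?num_real// ler_pXn2r ?nnegrE.
Qed.

Lemma ler_powRN (a b e : R) : 0 < a -> a <= b -> 0 <= e -> b `^ (- e) <= a `^ (- e).
Proof.
move=> a0 ab e0; have b0 : 0 < b by exact: lt_le_trans ab.
by rewrite !powRN lef_pV2 ?posrE ?powR_gt0// ge0_ler_powR// nnegrE ltW.
Qed.

Lemma powRN_le1 (a e : R) : 1 <= a -> 0 <= e -> a `^ (- e) <= 1.
Proof. by move=> a1 e0; have := ler_powRN ltr01 a1 e0; rewrite powR1. Qed.

(** Near 0 the lower limit is positive, far away the decay hypothesis applies, and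
in between K is bounded below by compactness. As M >= 1, the constants of
the first two regions may be multiplied by M^(-beta) <= 1. *)
Lemma admissible_kernel_lower_bound beta (K : 'rV[R]_N -> R) : (1 <= N)%N -> 0 < beta ->
  admissible_kernel beta K ->
  exists2 c : R, 0 < c & forall M w, 1 <= M -> w != 0 -> (forall i, `|w 0 i| <= 2 * M) ->
    c * M `^ (- beta) <= K w.
Proof.
move=> N1 b0 [Kc K0 Kinf [rho [c [rho0 c0 Kfar]]]].
have N1' : (1 : R) <= N%:R by rewrite ler1n.
have [k0 k00 [delta delta0 Knear]] : exists2 k0 : R, 0 < k0 & exists2 delta : R, 0 < delta &
    forall w, w != 0 -> `|w| < delta -> k0 <= K w.
  move: Kinf; rewrite limf_einfE => Kinf; have [_ [V V0 <-] infV] := ereal_sup_gt Kinf.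
  have [m m0 Vm] : exists2 m : R, 0 < m & forall w, V w -> m <= K w.
    exists (if ereal_inf ((EFin \o K) @` V) is r%:E then r else 1).
      by move: infV; case: (ereal_inf _) => //= r; rewrite lte_fin.
    move=> w Vw; have : (ereal_inf ((EFin \o K) @` V) <= (K w)%:E)%E.
      by apply: ereal_inf_lbound; exists w.
    by move: infV; case: (ereal_inf _).
  exists m => //.
  have /nbhs_ballP[delta /= d0 dV] := V0.
  exists delta => // w w0 wd; apply: Vm.
  by apply: dV => //; rewrite -ball_normE /ball_/= sub0r normrN.
pose A := [set w : 'rV[R]_N | delta <= `|w|] `&` [set w | forall i, `[- rho, rho]%classic (w ord0 i)].
have cA : compact A.
  apply: (@subclosed_compact _ _ [set w : 'rV[R]_N | forall i, `[- rho, rho]%classic (w ord0 i)]).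
  - apply: closedI.
      apply: (@closed_comp _ _ (fun w : 'rV[R]_N => `|w|) [set r | delta <= r]).
        by move=> w _; exact: norm_continuous.
      exact: closed_ge.
    apply: compact_closed; first exact: norm_hausdorff.
    by apply: (@rV_compact R N (fun=> `[- rho, rho]%classic)) => i; exact: segment_compact.
  - by apply: (@rV_compact R N (fun=> `[- rho, rho]%classic)) => i; exact: segment_compact.
  - by move=> w [].
have An0 w : A w -> w != 0.
  by move=> [/= dw _]; rewrite -normr_gt0; exact: lt_le_trans dw.
have [k1 k10 Kmid] : exists2 k1 : R, 0 < k1 & forall w, A w -> k1 <= K w.
  have [[w0 Aw0]|A0] := pselect (A !=set0); last first.
    by exists 1 => // w Aw; exfalso; apply: A0; exists w.
  have [||//|w1 w1A hw1] := @EVT_min_rV R N K A.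
  - by exists w0.
  - exact: cA.
  - apply: continuous_in_subspaceT => w /set_mem Aw; exact/Kc/An0.
  exists (K w1); first exact/K0/An0/set_mem.
  by move=> w Aw; apply: hw1; exact: mem_set.
pose k2 := c * (2 * N%:R) `^ (- beta).
have k20 : 0 < k2 by rewrite mulr_gt0// powR_gt0// mulr_gt0// (lt_le_trans _ N1').
exists (Num.min k0 (Num.min k1 k2)); first by rewrite !lt_min k00 k10.
move=> M w M1 w0 wM.
have M0 : 0 < M by exact: lt_le_trans M1.
have Mb : 0 <= M `^ (- beta) <= 1 by rewrite powR_ge0 powRN_le1// ltW.
have aux k : 0 < k -> Num.min k0 (Num.min k1 k2) <= k ->
    Num.min k0 (Num.min k1 k2) * M `^ (- beta) <= k.
  move=> kp h; case/andP: Mb => b1 b2.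
  by apply: (@le_trans _ _ (k * M `^ (- beta))); [rewrite ler_wpM2r|rewrite ler_piMr// ltW].
have [wd|dw] := ltP `|w| delta.
  by apply: le_trans (Knear _ w0 wd); apply: aux => //; rewrite ge_min lexx.
have [wr|rw] := leP (enorm w) rho.
  have Aw : A w.
    by split => // i; rewrite /= in_itv/= -ler_norml; exact: le_trans (coord_le_enorm _ _) wr.
  by apply: le_trans (Kmid _ Aw); apply: aux => //; rewrite !ge_min lexx orbT.
apply: le_trans (Kfar _ rw).
have ew : enorm w <= 2 * N%:R * M.
  rewrite -mulrA mulrCA; apply: enorm_le_coord => //.
  by rewrite mulr_ge0// ltW.
have ew0 : 0 < enorm w by exact: lt_trans rw.
apply: (@le_trans _ _ (k2 * M `^ (- beta))).
  by rewrite ler_wpM2r ?powR_ge0// !ge_min lexx !orbT.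
rewrite /k2 -mulrA ler_pM2l// -powRM ?mulr_ge0 ?(ltW M0)//.
by apply: ler_powRN => //; exact: ltW.
Qed.

End kernel_bound.

Section source_bound.
Context {R : realType} {N : nat}.
Local Notation leb := (@lebesgue_measure R).
Local Notation X := ('rV[R]_N).
Local Notation Z := ('rV[R]_N * R)%type.
Local Notation mZ := ('rV[R]_N * measurableTypeR R)%type.
Local Notation mu := (@dxdt R N).
Local Notation dx := (lebesgue_rV R N).
Local Notation Omega := positive_times.

Hypothesis N1 : (1 <= N)%N.

Let rV1E (x : X) : [set x] = [set y : X | forall i, [set x 0 i] (y 0 i)].
Proof. by apply/seteqP; split => y /= => [->//|h]; apply/rowP => i. Qed.

Lemma measurable_rV1 (x : X) : measurable [set x].
Proof.
rewrite rV1E; apply: (@measurable_rV_box R N (fun i => [set x 0 i])) => i.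
exact: measurable_set1.
Qed.

(** On R^0 a point has mass 1, hence the assumption on [N]. *)
Lemma lebesgue_rV1 (x : X) : dx [set x] = 0%E.
Proof.
rewrite rV1E (@lebesgue_rV_box R N (fun i => [set x 0 i])); last first.
  by move=> i; exact: measurable_set1.
by rewrite (bigD1 (Ordinal N1))//= lebesgue_measure_set1 mul0e.
Qed.

Lemma ge0_integral_rV1 (x : X) (f : X -> \bar R) : (forall y, (0 <= f y)%E) ->
  (\int[dx]_(y in [set x]) f y = 0)%E.
Proof.
move=> f0; apply/eqP; rewrite eq_le integral_ge0// andbT.
apply: (@le_trans _ _ (\int[dx]_(y in [set x]) +oo)%E).
  by apply: ge0_le_integral_all => // y _; exact: leey.
rewrite integral_cst; last exact: measurable_rV1.
by rewrite [X in (_ * X)%E](lebesgue_rV1 x) mule0.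
Qed.

(** The value of the kernel at 0 may be negative. The negative part of the
integrand is then carried by a single point and has integral 0. *)
Lemma le_integral_off_point (x : X) (f F : X -> R) : measurable_fun setT f ->
  (forall y, 0 <= f y) -> (forall y, y != x -> f y <= F y) ->
  (\int[dx]_y (f y)%:E <= \int[dx]_y (F y)%:E)%E.
Proof.
move=> mf f0 fF.
have mx := measurable_rV1 x.
have -> : (\int[dx]_y (f y)%:E = \int[dx]_(y in ~` [set x]) (f y)%:E)%E.
  rewrite -[in LHS](setvU [set x]) ge0_integral_setU//=; last 4 first.
  - exact: measurableC.
  - by apply/measurable_EFinP; exact: measurable_funTS.
  - by move=> y _; rewrite lee_fin.
  - by apply/disj_setPLR.
  rewrite [X in (_ + X)%E](_ : _ = 0%E) ?adde0//.
  by apply: ge0_integral_rV1 => y; rewrite lee_fin.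
rewrite integral_mkcond [leRHS]integralE.
have -> : (\int[dx]_y (EFin \o F)^\- y = 0)%E.
  apply/eqP; rewrite eq_le integral_ge0// andbT.
  apply: (@le_trans _ _ (\int[dx]_y (((cst +oo%E) \_ [set x]) y))%E).
    apply: ge0_le_integral_all => // y _.
    rewrite patchE; case: ifPn => [_|yx]; first exact: leey.
    rewrite funenegE ge_max lexx andbT /= lee_fin oppr_le0.
    apply: le_trans (f0 y) (fF y _); apply: contra yx => /eqP ->; exact: mem_set.
  by rewrite -integral_mkcond ge0_integral_rV1// => y; exact: leey.
rewrite oppe0 adde0; apply: ge0_le_integral_all => y _.
  by rewrite patchE; case: ifP => // _; rewrite lee_fin.
rewrite patchE; case: ifPn => [|_]; last by rewrite funeposE le_max lexx orbT.
move/set_mem => /= yx; rewrite funeposE le_max/= lee_fin fF//.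
exact/eqP.
Qed.

Variables (K : X -> R) (p q : R) (u : Z -> R).
Hypothesis K_pos : forall x, x != 0 -> 0 < K x.

Lemma conv_pow_ge0 z : (0 <= conv_pow K p u z)%E.
Proof.
have -> : (0 = \int[dx]_y (0 : R)%:E)%E by rewrite integral0.
apply: (@le_integral_off_point z.1) => // y yx.
by rewrite mulr_ge0 ?powR_ge0// ltW// K_pos// subr_eq0 eq_sym.
Qed.

Lemma source_ge0 z : (0 <= source K p q u z)%E.
Proof. by rewrite mule_ge0 ?conv_pow_ge0// lee_fin powR_ge0. Qed.

Hypothesis p0 : 0 < p.
Hypothesis q0 : 0 < q.
Hypothesis u_meas : measurable_fun (Omega : set mZ) (u : mZ -> R).

(** The positive part of u, extended by 0 to negative times; it is measurable on
all of space-time. Since a negative number raised to a real power is 1 by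
convention, replacing u by [upos] can only decrease its positive powers
([upos_powR_le]). *)
Definition upos : mZ -> R := fun z => Num.max 0 (((u : mZ -> R) \_ Omega) z).

Lemma upos_ge0 z : 0 <= upos z. Proof. by rewrite le_max lexx. Qed.

Lemma measurable_upos : measurable_fun setT upos.
Proof.
apply: measurable_maxr => //.
by apply/(measurable_restrictT _ _).1 => //; exact: measurable_Omega.
Qed.

Lemma upos_powR_le (e : R) z : 0 < e -> upos z `^ e <= u z `^ e.
Proof.
move=> e0; rewrite /upos patchE.
have powR0' : (0 : R) `^ e = 0 by rewrite powR0// gt_eqF.
case: ifP => _; last by rewrite maxxx powR0' powR_ge0.
by case: (lerP 0 (u z)) => // _; rewrite powR0' powR_ge0.
Qed.

Variables (phi : mZ -> R) (M c : R).
Hypothesis mphi : measurable_fun setT phi.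
Hypothesis phi01 : forall z, 0 <= phi z <= 1.
Hypothesis phi_box : forall (x : X) (t : R) i, M < `|x 0 i| -> phi (x, t) = 0.
Hypothesis c0 : 0 <= c.
Hypothesis Kc : forall w : X, w != 0 -> (forall i, `|w 0 i| <= 2 * M) -> c <= K w.

(** Written A_e(t) in the overview. *)
Definition moment (e : R) (t : R) : \bar R := (\int[dx]_x (upos (x, t) `^ e * phi (x, t))%:E)%E.

Lemma measurable_upos_powR e : measurable_fun setT (fun z => upos z `^ e * phi z).
Proof.
by apply: measurable_funM => //; apply: (measurableT_comp (measurable_powR e)); exact: measurable_upos.
Qed.

Lemma upos_powR_ge0 e z : 0 <= upos z `^ e * phi z.
Proof. by rewrite mulr_ge0 ?powR_ge0//; have /andP[] := phi01 z. Qed.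

Lemma moment_ge0 e t : (0 <= moment e t)%E.
Proof. by apply: integral_ge0 => x _; rewrite lee_fin upos_powR_ge0. Qed.

Lemma measurable_moment e : measurable_fun (setT : set (measurableTypeR R)) (moment e).
Proof.
apply: (@measurable_fun_fubini_tonelli_G _ _ _ _ _ dx (fun z => (upos z `^ e * phi z)%:E)).
  by apply/measurable_EFinP; exact: measurable_upos_powR.
by move=> z; rewrite lee_fin upos_powR_ge0.
Qed.

Lemma integral_moment e :
  (\int[mu]_z (upos z `^ e * phi z)%:E = \int[leb]_t moment e t)%E.
Proof.
rewrite -[LHS]/(\int[dx \x leb]_z (upos z `^ e * phi z)%:E)%E.
rewrite fubini_tonelli2//.
  by apply/measurable_EFinP; exact: measurable_upos_powR.
by move=> z; rewrite lee_fin upos_powR_ge0.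
Qed.

(** If phi vanishes neither at (x, t) nor at (y, t), then x - y lies in the region
where K >= c; otherwise the integrand on the left-hand side vanishes. *)
Lemma source_ge_moment z :
  (c%:E * moment p z.2 * (upos z `^ q * phi z)%:E <= source K p q u z * (phi z)%:E)%E.
Proof.
case: z => x t /=; have /andP[ph0 ph1] := phi01 (x, t).
have [phx|phx] := eqVneq (phi (x, t)) 0; first by rewrite phx mulr0 !mule0.
have xM i : `|x 0 i| <= M.
  by rewrite leNgt; apply/negP => /(phi_box t) h; rewrite h eqxx in phx.
have cm : (c%:E * moment p t <= conv_pow K p u (x, t))%E.
  rewrite /moment -ge0_integralZl//; last 2 first.
  - apply/measurable_EFinP; exact: (measurableT_comp (measurable_upos_powR p) (pair2_measurable t)).
  - by move=> y _; rewrite lee_fin upos_powR_ge0.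
  rewrite /conv_pow; under eq_integral do rewrite -EFinM.
  apply: (@le_integral_off_point x).
  - apply: measurable_funM => //; exact: (measurableT_comp (measurable_upos_powR p) (pair2_measurable t)).
  - by move=> y; rewrite mulr_ge0// upos_powR_ge0.
  move=> y yx /=.
  have xy0 : x - y != 0 by rewrite subr_eq0 eq_sym.
  have Kxy := K_pos xy0.
  have [->|phy] := eqVneq (phi (y, t)) 0; first by rewrite !mulr0 mulr_ge0 ?powR_ge0// ltW.
  have yM i : `|y 0 i| <= M.
    by rewrite leNgt; apply/negP => /(phi_box t) h; rewrite h eqxx in phy.
  apply: ler_pM => //; first exact: upos_powR_ge0.
    apply: Kc => // i; rewrite !mxE; apply: (le_trans (ler_normB _ _)).
    by have := xM i; have := yM i; lra.
  have /andP[phy0 phy1] := phi01 (y, t).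
  by apply: le_trans (upos_powR_le (y, t) p0); rewrite ler_piMr// powR_ge0.
rewrite EFinM muleA /source lee_wpmul2r ?lee_fin//.
by apply: lee_pmul => //; rewrite ?lee_fin ?powR_ge0 ?upos_powR_le// mule_ge0 ?moment_ge0.
Qed.

Lemma source_lower_bound :
  (c%:E * \int[leb]_t (moment p t * moment q t) <=
   \int[mu]_(z in Omega) (source K p q u z * (phi z)%:E))%E.
Proof.
pose F (z : mZ) : \bar R := (c%:E * moment p z.2 * (upos z `^ q * phi z)%:E)%E.
have F0 z : (0 <= F z)%E by rewrite !mule_ge0 ?moment_ge0 ?lee_fin ?upos_powR_ge0.
have mF : measurable_fun setT F.
  apply: emeasurable_funM; last by apply/measurable_EFinP; exact: measurable_upos_powR.
  apply: emeasurable_funM => //.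
  exact: (measurableT_comp (measurable_moment p) measurable_snd).
apply: (@le_trans _ _ (\int[mu]_(z in Omega) F z)%E); last first.
  by apply: ge0_le_integral_all => z _ //; exact: source_ge_moment.
have -> : (\int[mu]_(z in Omega) F z = \int[mu]_z F z)%E.
  rewrite integral_mkcond; apply: eq_integral => z _; rewrite patchE; case: ifPn => // /negP zO.
  rewrite /F /upos patchE; case: ifPn => [/zO//|_].
  by rewrite maxxx powR0 ?gt_eqF// mul0r mule0.
rewrite -[leRHS]/(\int[dx \x leb]_z F z)%E fubini_tonelli2//.
rewrite -ge0_integralZl//; last 2 first.
- by apply: emeasurable_funM; exact: measurable_moment.
- by move=> t _; rewrite mule_ge0 ?moment_ge0.
rewrite le_eqVlt; apply/orP; left; apply/eqP; apply: eq_integral => t _; rewrite /fubini_G /F /=.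
rewrite ge0_integralZl//.
- by rewrite muleA.
- apply/measurable_EFinP; exact: (measurableT_comp (measurable_upos_powR q) (pair2_measurable t)).
- by move=> y _; rewrite lee_fin upos_powR_ge0.
- by rewrite mule_ge0 ?moment_ge0.
Qed.

End source_bound.

(** * Cutoff functions *)

Section cutoff.
Context {R : realType} {N : nat}.
Local Notation Z := ('rV[R]_N * R)%type.
Local Notation et := ((0 : 'rV[R]_N), (1 : R)).
Local Notation ex i := ((delta_mx 0 i : 'rV[R]_N), (0 : R)).

(** A nonnegative function cannot decrease faster than the square root of its
value: in f(z + a h) >= 0, take the minimiser a of the second-order upper bound
f(z) + a D + c a^2. *)
Lemma nonneg_C11_sqr (V : normedModType R) (f : V -> R) D : C11 f D -> (forall z, 0 <= f z) ->
  exists2 C : R, 0 < C & forall z h, `|h| <= 2 -> D z h ^+ 2 <= C * f z /\ `|D z h| <= C.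
Proof.
move=> [C H] f0; have DZ := C11_linZ H.
case: H => C0 fC Dl DC [DL fD].
(* [C + 1] is positive, and the factor 16 = 4 * 4 allows for `|h|^2 <= 4 *)
exists (16 * (C + 1)); first by rewrite mulr_gt0// ltr_wpDl.
move=> z h h2; split; last first.
  apply: (le_trans (DC z h)); apply: (@le_trans _ _ (C * 2)); first by rewrite ler_wpM2l.
  by lra.
pose c := 4 * (C + 1).
have c0 : 0 < c by rewrite mulr_gt0// ltr_wpDl.
pose a := - D z h / (2 * c).
have := fD z (a *: h); rewrite DZ ler_norml => /andP[_ H].
have f1 := f0 (z + a *: h).
have nh : `|h| ^+ 2 <= 4.
  by rewrite (_ : 4 = 2 ^+ 2 :> R) ?ler_pXn2r ?nnegrE//; ring.
have Ca : C * `|a *: h| ^+ 2 <= c * a ^+ 2.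
  rewrite normrZ exprMn real_normK ?num_real// mulrCA mulrC.
  rewrite ler_wpM2r ?sqr_ge0//.
  apply: (@le_trans _ _ (C * 4)); first by rewrite ler_wpM2l.
  by rewrite /c; lra.
have aE : a * D z h + c * a ^+ 2 = - (D z h ^+ 2 / (4 * c)).
  by rewrite /a; field; rewrite gt_eqF.
have : D z h ^+ 2 / (4 * c) <= f z by lra.
have c40 : 0 < 4 * c by rewrite mulr_gt0.
rewrite ler_pdivrMr// => h3.
by rewrite (_ : 16 * (C + 1) * f z = f z * (4 * c))//; rewrite /c; ring.
Qed.

Definition unit_cutoff (z : Z) : R := (\prod_(i < N) bell (z.1 0 i)) * bell z.2.

Lemma C11_unit_cutoff : exists D, C11 unit_cutoff D.
Proof.
have B : C11 (@bell R : (R : normedModType R) -> R) (fun r h => 1 * bell' (1 * r) * (1 * h)).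
  rewrite (_ : (@bell R) = fun r => 1 * bell (1 * r)); first exact: C11_bell.
  by apply/funext => r; rewrite !mul1r.
exact: C11_spacetime_prod B.
Qed.

Lemma unit_cutoff_ge0 z : 0 <= unit_cutoff z.
Proof. by rewrite mulr_ge0 ?bell_ge0// prodr_ge0// => i _; exact: bell_ge0. Qed.

(** For r >= 1 this map does not increase the norm, so that it preserves the C11
constants. *)
Definition parabolic_scaling (r : R) (z : Z) : Z := (r^-1 *: z.1, (r ^+ 2)^-1 * z.2).

Definition space_time_cutoff r z := unit_cutoff (parabolic_scaling r z).

(** C1, increasing, equal to 0 up to [tau] and tending to 1 at infinity. Its
derivative has the good sign in the inequality, whatever its size. *)
Definition time_ramp (tau : R) (t : R) : R := bell (expR (tau - t)).

(** The ramp keeps the support away from t = 0. The exponent [m] is what makes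
[cutoff_majorant_le] possible. *)
Definition cutoff (m : nat) (r tau : R) (z : Z) : R :=
  space_time_cutoff r z ^+ m * time_ramp tau z.2.

Lemma bell_ler (x y : R) : `|x| <= `|y| -> bell y <= bell x.
Proof.
move=> xy; have xy2 : x ^+ 2 <= y ^+ 2.
  by rewrite -(real_normK (num_real x)) -(real_normK (num_real y)) ler_pXn2r ?nnegrE.
have h : Num.max 0 (1 - y ^+ 2) <= Num.max 0 (1 - x ^+ 2).
  by rewrite ge_max !le_max lexx/= lerD2l lerN2 xy2 orbT.
by rewrite /bell ler_pXn2r// nnegrE le_max lexx.
Qed.

Lemma bell_gt0 (x : R) : `|x| < 1 -> 0 < bell x.
Proof.
move=> x1; rewrite /bell exprn_gt0// lt_max subr_gt0 -real_normK ?num_real//.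
by rewrite expr_lt1// x1 orbT.
Qed.

Lemma time_ramp_ge0 tau t : 0 <= time_ramp tau t. Proof. exact: bell_ge0. Qed.

Lemma time_ramp_le1 tau t : time_ramp tau t <= 1. Proof. exact: bell_le1. Qed.

Lemma time_ramp0 tau t : t <= tau -> time_ramp tau t = 0.
Proof.
move=> tt; rewrite /time_ramp bell_eq0// ger0_norm ?expR_ge0//.
by rewrite -(expR0 R) ler_expR subr_ge0.
Qed.

Lemma time_ramp_gt0 tau t : tau < t -> 0 < time_ramp tau t.
Proof.
move=> tt; rewrite /time_ramp bell_gt0// ger0_norm ?expR_ge0//.
by rewrite -(expR0 R) ltr_expR subr_lt0.
Qed.

Lemma space_time_cutoff_ge0 r z : 0 <= space_time_cutoff r z.
Proof. exact: unit_cutoff_ge0. Qed.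

Lemma space_time_cutoff_le1 r z : space_time_cutoff r z <= 1.
Proof.
rewrite -[leRHS]mulr1 ler_pM ?bell_ge0 ?bell_le1 ?prodr_ge0// => [i _|]; first exact: bell_ge0.
by apply: prodr_ile1 => i _; rewrite bell_ge0 bell_le1.
Qed.

Lemma space_time_cutoff_eq0 r (x : 'rV[R]_N) (t : R) : 0 < r ->
  (exists i, r <= `|x 0 i|) \/ r ^+ 2 <= `|t| -> space_time_cutoff r (x, t) = 0.
Proof.
move=> r0; rewrite /space_time_cutoff /unit_cutoff /=; case=> [[i xi]|tr].
  rewrite (bigD1 i)//= mxE bell_eq0 ?mul0r// normrM normfV (gtr0_norm r0).
  by rewrite ler_pdivlMl// mulr1.
have r20 : 0 < r ^+ 2 by rewrite exprn_gt0.
rewrite [bell (_ * t)]bell_eq0 ?mulr0// normrM normfV (gtr0_norm r20).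
by rewrite ler_pdivlMl// mulr1.
Qed.

Lemma cutoff_ge0 m r tau z : 0 <= cutoff m r tau z.
Proof. by rewrite mulr_ge0 ?time_ramp_ge0// exprn_ge0// space_time_cutoff_ge0. Qed.

Lemma cutoff_le1 m r tau z : cutoff m r tau z <= 1.
Proof.
rewrite -[leRHS]mulr1 ler_pM ?time_ramp_ge0 ?time_ramp_le1// ?exprn_ge0 ?space_time_cutoff_ge0//.
by rewrite exprn_ile1 ?space_time_cutoff_ge0 ?space_time_cutoff_le1.
Qed.

Lemma cutoff_eq0 m r tau (x : 'rV[R]_N) (t : R) : (0 < m)%N -> 0 < r ->
  [\/ exists i, r <= `|x 0 i|, r ^+ 2 <= `|t| | t <= tau] -> cutoff m r tau (x, t) = 0.
Proof.
move=> m0 r0 H; rewrite /cutoff /=.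
case: H => [H|H|/time_ramp0 ->]; last by rewrite mulr0.
- by rewrite (space_time_cutoff_eq0 r0 (or_introl H)) expr0n eqn0Ngt m0 mul0r.
- by rewrite (space_time_cutoff_eq0 r0 (or_intror H)) expr0n eqn0Ngt m0 mul0r.
Qed.

Lemma cutoff_gt0 m r tau (x : 'rV[R]_N) (t : R) : 0 < r -> (forall i, `|x 0 i| < r) -> `|t| < r ^+ 2 -> tau < t ->
  0 < cutoff m r tau (x, t).
Proof.
move=> r0 xr tr taut; rewrite mulr_gt0 ?time_ramp_gt0// exprn_gt0//.
have r20 : 0 < r ^+ 2 by rewrite exprn_gt0.
apply: mulr_gt0; last first; [|apply: prodr_gt0 => i _]; apply: bell_gt0 => /=.
  by rewrite normrM normfV (gtr0_norm r20) ltr_pdivrMl// mulr1.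
by rewrite mxE normrM normfV (gtr0_norm r0) ltr_pdivrMl// mulr1.
Qed.

Lemma cutoff_le m r1 r2 tau z : 0 < r1 -> r1 <= r2 -> cutoff m r1 tau z <= cutoff m r2 tau z.
Proof.
move=> r10 r12; have r20 : 0 < r2 by exact: lt_le_trans r12.
have r1'0 : 0 < r1 ^+ 2 by rewrite exprn_gt0.
have r2'0 : 0 < r2 ^+ 2 by rewrite exprn_gt0.
have r12' : r1 ^+ 2 <= r2 ^+ 2 by rewrite ler_pXn2r ?nnegrE// ltW.
rewrite ler_wpM2r ?time_ramp_ge0// lerXn2r ?nnegrE ?space_time_cutoff_ge0//.
rewrite /space_time_cutoff /unit_cutoff; apply: ler_pM; [by apply: prodr_ge0 => i _; exact: bell_ge0|exact: bell_ge0| |].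
  apply: ler_prod => i _; rewrite bell_ge0/= !mxE bell_ler// !normrM !normfV.
  by rewrite (gtr0_norm r10) (gtr0_norm r20) ler_wpM2r// lef_pV2.
by rewrite bell_ler// !normrM !normfV (gtr0_norm r1'0) (gtr0_norm r2'0) ler_wpM2r// lef_pV2.
Qed.

Lemma is_derive_bell (x : R) : is_derive x (1 : R) (@bell R) (bell' x).
Proof.
have [d1 d2 _] := C11_diff (C11_bell (1 : R) 1).
have E : (@bell R) = fun r => 1 * bell (1 * r) by apply/funext => r; rewrite !mul1r.
rewrite E; split; first exact: diff_derivable.
by rewrite d2 !mul1r mulr1.
Qed.

Let ramp' tau t : R := - bell' (expR (tau - t)) * expR (tau - t).

Lemma is_derive_time_ramp tau t : is_derive t (1 : R) (time_ramp tau) (ramp' tau t).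
Proof.
have d1 : is_derive t (1 : R) (fun t : R => tau - t) (-1).
  have := is_derive_affine_comp tau (-1) (is_derive_id t (1 : R)).
  by rewrite mulr1; congr is_derive; apply/funext => x; rewrite mulN1r.
have d2 := @is_derive1_comp R expR (fun t => tau - t) t _ _ (is_derive_expR (tau - t)) d1.
have := @is_derive1_comp R (@bell R) (expR \o (fun t => tau - t)) t _ _ (is_derive_bell _) d2.
by rewrite mulrN1 mulrN -mulNr.
Qed.

Lemma ramp'_ge0 tau t : 0 <= ramp' tau t.
Proof.
by rewrite /ramp' mulr_ge0 ?expR_ge0// /bell' !mulNr opprK !mulr_ge0 ?expR_ge0// le_max lexx.
Qed.

Lemma continuous_ramp' tau : continuous (ramp' tau).
Proof.
have ce : continuous (fun t : R => expR (tau - t)).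
  move=> t; apply: (@continuous_comp _ _ _ (fun t => tau - t) expR).
    by apply: cvgB; [exact: cvg_cst|exact: cvg_id].
  exact: continuous_expR.
have cb : continuous (@bell' R).
  have [_ d2 /(_ (1 : R)) d3] := C11_diff (C11_bell (1 : R) 1).
  by have <- : 'D_(1 : R) (fun r : R => 1 * bell (1 * r)) = @bell' R by apply/funext => x; rewrite d2 !mul1r mulr1.
move=> t; apply: cvgM; last exact: ce.
apply: cvgN; apply: (@continuous_comp _ _ _ (fun t => expR (tau - t)) (@bell' R)); first exact: ce.
exact: cb.
Qed.

Lemma C1_snd : C1 (snd : Z -> R) /\ forall v z, 'D_v (snd : Z -> R) z = v.2.
Proof.
have cs : continuous (snd : Z -> R) by move=> z; exact: cvg_snd.
have ds z : differentiable (snd : Z -> R) z.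
  exact: (@linear_differentiable R _ _ (snd : {linear Z -> R})).
have dE v z : 'D_v (snd : Z -> R) z = v.2.
  by rewrite deriveE// (@diff_lin R _ _ (snd : {linear Z -> R})).
split => //; split => // v.
by rewrite (_ : 'D_v _ = cst v.2); [exact: cst_continuous|apply/funext => z; exact: dE].
Qed.

Lemma C1_ramp tau : C1 (time_ramp tau \o (snd : Z -> R)) /\
  forall v z, 'D_v (time_ramp tau \o (snd : Z -> R)) z = ramp' tau z.2 * v.2.
Proof.
have [Cs sE] := C1_snd; split.
  apply: (@C1_comp _ _ _ (ramp' tau)) => // z; first exact: is_derive_time_ramp.
  exact: continuous_ramp'.
by move=> v z; rewrite (derive_comp1 v Cs (is_derive_time_ramp tau z.2)) sE.
Qed.

Lemma is_derive_exprS k (x : R) : is_derive x (1 : R) (fun y : R => y ^+ k.+1) (k.+1%:R * x ^+ k).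
Proof.
have := is_deriveX k.+1 (is_derive_id x (1 : R)).
rewrite [_ *: _]mulr1 /=; congr (is_derive _ _ _ _).
apply/funext => y; elim: k.+1 => [|j IH]; first by rewrite !expr0.
by rewrite !exprS -IH.
Qed.

Lemma C1_expr k (f : Z -> R) : C1 f -> C1 (fun z => f z ^+ k.+1) /\
  forall v z, 'D_v (fun z => f z ^+ k.+1) z = k.+1%:R * f z ^+ k * 'D_v f z.
Proof.
move=> Cf; split.
  apply: (@C1_comp _ _ (fun y => y ^+ k.+1) (fun y => k.+1%:R * y ^+ k)) => // z.
    exact: is_derive_exprS.
  apply: cvgM; first exact: cvg_cst.
  exact: exprn_continuous.
move=> v z.
exact: (@derive_comp1 _ _ (fun y => y ^+ k.+1) (fun y => k.+1%:R * y ^+ k) f v z Cf (is_derive_exprS k (f z))).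
Qed.

Lemma norm_ex i : `|(ex i : Z)| <= 2.
Proof.
apply: ltW; apply: norm_lt => //= [j|]; last by rewrite normr0.
by rewrite mxE eqxx/=; case: (j == i); rewrite ?normr1 ?normr0 ?ltr1n ?ltr0n.
Qed.

Lemma norm_et : `|(et : Z)| <= 2.
Proof.
apply: ltW; apply: norm_lt => //= [j|]; last by rewrite normr1 ltr1n.
by rewrite mxE normr0.
Qed.

(** Serves as psi in [caccioppoli], with one factor of the cutoff less than in
[cutoff]. *)
Definition cutoff_majorant (C : R) k r tau (z : Z) : R :=
  (r ^+ 2)^-1 * C * (space_time_cutoff r z ^+ k * time_ramp tau z.2).

(** The function X = [space_time_cutoff r] satisfies |grad X|^2 <= C r^(-2) X by
[nonneg_C11_sqr] and scaling, and |d_t X| <= C r^(-2). The derivative of the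
ramp is nonnegative and is dropped. The constant does not depend on r and tau. *)
Lemma cutoff_deriv k : exists2 C : R, 0 < C & forall r tau, 1 <= r ->
  [/\ C1 (cutoff k.+1 r tau),
   forall z, dotmul (grad_x (cutoff k.+1 r tau) z) (grad_x (cutoff k.+1 r tau) z) <=
     cutoff k.+1 r tau z * cutoff_majorant C k r tau z &
   forall z, - 'D_et (cutoff k.+1 r tau) z <= cutoff_majorant C k r tau z].
Proof.
have [D HD] := C11_unit_cutoff.
have [C C0 HC] := nonneg_C11_sqr HD unit_cutoff_ge0.
pose m : R := k.+1%:R.
have m0 : 0 < m by rewrite ltr0n.
exists (m ^+ 2 * (N%:R * C) + m * C).
  by rewrite ltr_wpDl// ?mulr_gt0// !mulr_ge0 ?sqr_ge0// ltW.
move=> r tau r1.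
have r0 : 0 < r by exact: lt_le_trans r1.
pose l := parabolic_scaling r.
pose i2 := (r ^+ 2)^-1.
have i20 : 0 <= i2 by rewrite invr_ge0 exprn_ge0// ltW.
have ri1 : `|r^-1| <= 1 by rewrite ger0_norm ?invf_le1 ?invr_ge0 ?(ltW r0).
have i21 : `|i2| <= 1.
  by rewrite ger0_norm// /i2 invf_le1 ?exprn_gt0// exprn_ege1.
have Hl : C11 (space_time_cutoff r) (fun z h => D (l z) (l h)).
  apply: (C11_comp_linear (l := l)) HD.
    move=> a h h'; rewrite /l /parabolic_scaling; congr (_, _) => /=.
      by rewrite scalerDr !scalerA mulrC.
    by rewrite mulrDr; congr (_ + _); rewrite [RHS]mulrCA.
  move=> h; rewrite !prod_normE /= ge_max !le_max normrZ normrM.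
  by rewrite ler_piMl//= ler_piMl// orbT.
have [_ DE _] := C11_diff Hl.
have CX := C11_C1 Hl.
have [CXm XmE] := C1_expr k CX.
have [CT TE] := C1_ramp tau.
have Cc : C1 (cutoff k.+1 r tau) by exact: (C1M CXm CT).
have cE v z : 'D_v (cutoff k.+1 r tau) z = space_time_cutoff r z ^+ k.+1 * (ramp' tau z.2 * v.2) +
   time_ramp tau z.2 * (m * space_time_cutoff r z ^+ k * D (l z) (l v)).
  by rewrite (C1_deriveM _ _ CXm CT) TE XmE DE.
have [C' HD'] := HD; have DZ := C11_linZ HD'.
have lx i : l (ex i) = r^-1 *: (ex i : Z).
  by rewrite /l /parabolic_scaling /= mulr0 /GRing.scale/= /scale_pair/= scaler0.
have lt : l et = i2 *: (et : Z).
  rewrite /l /parabolic_scaling; congr (_, _).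
  by rewrite /= !scaler0.
split => // z.
- set X := space_time_cutoff r z; set th := time_ramp tau z.2.
  have X0 : 0 <= X := space_time_cutoff_ge0 r z.
  have th0 : 0 <= th := time_ramp_ge0 tau z.2.
  have gE i : grad_x (cutoff k.+1 r tau) z 0 i = th * m * X ^+ k * r^-1 * D (l z) (ex i).
    by rewrite mxE /partial_x cE /= mulr0 mulr0 add0r lx DZ -/X -/th; ring.
  have -> : dotmul (grad_x (cutoff k.+1 r tau) z) (grad_x (cutoff k.+1 r tau) z) =
      (th * m * X ^+ k) ^+ 2 * i2 * \sum_i D (l z) (ex i) ^+ 2.
    rewrite /dotmul mulr_sumr; apply: eq_bigr => i _; rewrite gE /i2 -exprVn; ring.
  apply: (@le_trans _ _ ((th * m * X ^+ k) ^+ 2 * i2 * (N%:R * (C * X)))).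
    have q : 0 <= (th * m * X ^+ k) ^+ 2 * i2 by apply: mulr_ge0 => //; exact: sqr_ge0.
    rewrite ler_wpM2l//.
    rewrite mulr_natl -[N in leRHS]card_ord -sumr_const; apply: ler_sum => i _.
    exact: (HC _ _ (norm_ex i)).1.
  rewrite /cutoff /cutoff_majorant -/X -/th -/i2.
  have -> : (th * m * X ^+ k) ^+ 2 * i2 * (N%:R * (C * X)) =
     (X ^+ k.+1 * th) * (i2 * (m ^+ 2 * (N%:R * C)) * (X ^+ k * th)) by rewrite [X ^+ k.+1]exprS; ring.
  rewrite ler_wpM2l ?mulr_ge0 ?exprn_ge0// ler_wpM2r ?mulr_ge0 ?exprn_ge0//.
  by rewrite ler_wpM2l// lerDl mulr_ge0// ltW.
- rewrite cE /= mulr1 lt DZ /cutoff_majorant -/i2.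
  set X := space_time_cutoff r z; set th := time_ramp tau z.2.
  have X0 : 0 <= X := space_time_cutoff_ge0 r z.
  have th0 : 0 <= th := time_ramp_ge0 tau z.2.
  have rp : 0 <= X ^+ k.+1 * ramp' tau z.2 by rewrite mulr_ge0 ?exprn_ge0// ramp'_ge0.
  have dl : - D (l z) et <= C.
    by apply: (le_trans _ (HC (l z) _ norm_et).2); rewrite -normrN ler_norm.
  have q0 : 0 <= i2 * m * (X ^+ k * th) by rewrite !mulr_ge0 ?exprn_ge0// ltW.
  have q1 : i2 * m * (X ^+ k * th) * (- D (l z) et) <= i2 * m * (X ^+ k * th) * C.
    by rewrite ler_wpM2l.
  have q2 : 0 <= i2 * (m ^+ 2 * (N%:R * C)) * (X ^+ k * th).
    by rewrite !mulr_ge0 ?exprn_ge0 ?sqr_ge0// ltW.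
  by move: q1 q2 rp; lra.
Qed.

(** The ramp is at most 1, so lowering its exponent increases it. *)
Lemma cutoff_majorant_le k r tau (z : Z) :
  space_time_cutoff r z ^+ k * time_ramp tau z.2 <= cutoff k.+1 r tau z `^ (k%:R / k.+1%:R).
Proof.
set X := space_time_cutoff r z; set th := time_ramp tau z.2.
have X0 : 0 <= X := space_time_cutoff_ge0 r z.
have th0 : 0 <= th := time_ramp_ge0 tau z.2.
have e0 : 0 <= (k%:R / k.+1%:R : R) by rewrite divr_ge0.
rewrite /cutoff -/X -/th powRM ?exprn_ge0//.
apply: ler_pM => //; first by rewrite exprn_ge0.
  by rewrite -(powR_mulrn k.+1 X0) -powRrM mulrC divfK// powR_mulrn.
have [->|thn] := eqVneq th 0; first exact: powR_ge0.
have th1 : 0 < th <= 1 by rewrite lt_neqAle eq_sym thn th0 time_ramp_le1.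
rewrite -[leLHS]powRr1//; apply: (ger_powR th1).
by rewrite ler_pdivrMr// mul1r ler_nat.
Qed.

End cutoff.

(** * The initial formulation, and moments of the solution *)

Section initial_formulation.
Context {R : realType} {N : nat}.
Local Notation Z := ('rV[R]_N * R)%type.
Local Notation mZ := ('rV[R]_N * measurableTypeR R)%type.
Local Notation mu := (@dxdt R N).
Local Notation L1 f := (mu.-integrable [set: mZ] (EFin \o (f : mZ -> R))).
Local Notation Omega := positive_times.

(** For a test function that vanishes near t = 0 the initial term disappears and the
time derivative can be integrated by parts. *)
Lemma weak_ineq_initial_away K p q (u0 : 'rV[R]_N -> R) (u ut : Z -> R) Du f M tau :
  W12loc u ut Du -> 0 < tau -> C1c f -> supp f `<=` box M tau M ->
  weak_ineq_initial K p q u0 u Du f -> weak_ineq K p q u ut Du f.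
Proof.
move=> [u2 _ _ wd _] tau0 cf sf; rewrite /weak_ineq_initial /weak_ineq.
have sO : supp f `<=` (Omega : set Z) by move=> z /sf; exact: box_Omega.
have -> : (\int[lebesgue_rV R N]_x (- (u0 x * f (x, 0)%R))%:E = 0)%E.
  apply: integral0_eq => x _; rewrite off_supp ?mulr0 ?oppr0// => /sf[_ /andP[/= h _]].
  by have := lt_le_trans tau0 h; rewrite ltxx.
rewrite add0e.
suff -> : (\int[lebesgue_spacetime]_(z in Omega) (- (u z * partial_t f z))%:E =
  \int[lebesgue_spacetime]_(z in Omega) (ut z * f z)%:E)%E by [].
have := wd f cf sO => /(congr1 oppe); rewrite oppeK => <-.
have uQ := @L2loc_L1 _ _ _ M _ M u2 tau0.
have [df cdf comp] := cf.
have mB := measurable_box (R := R) (N := N) M tau M.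
have D0 z : ~ box M tau M z -> partial_t f z = 0.
  by move=> Bz; apply: derive_off_supp; apply: contra_not Bz; exact: sf.
have [C C0 DC] := bounded_off_compact (cdf _) (@compact_box R N _ _ _) D0.
have i1 : L1 (fun z => u z * partial_t f z).
  rewrite (_ : (fun z => _) = fun z => partial_t f z * (u \_ (box M tau M)) z); last first.
    apply/funext => z; rewrite mulrC patchE.
    by case: ifPn => // /negP Bz; rewrite D0 ?mul0r// => /mem_set.
  apply: (@L1_bounded_mul _ _ (partial_t f : mZ -> R) _ C) => //.
  exact: measurable_continuous_spacetime (cdf _).
have i2 : mu.-integrable (Omega : set mZ) (EFin \o (fun z : mZ => u z * partial_t f z)).
  apply: integrableS i1 => //; exact: measurable_Omega.
exact: (integralN (integrable_add_def measurable_Omega i2)).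
Qed.

End initial_formulation.

Section moments.
Context {R : realType} {N : nat}.
Local Notation leb := (@lebesgue_measure R).
Local Notation X := ('rV[R]_N).
Local Notation Z := ('rV[R]_N * R)%type.
Local Notation mZ := ('rV[R]_N * measurableTypeR R)%type.
Local Notation mu := (@dxdt R N).
Local Notation dx := (lebesgue_rV R N).
Local Notation Omega := positive_times.

Variable u : Z -> R.
Hypothesis u_meas : measurable_fun (Omega : set mZ) (u : mZ -> R).
Variable phi : mZ -> R.
Hypothesis mphi : measurable_fun setT phi.
Hypothesis phi01 : forall z, 0 <= phi z <= 1.

Local Notation upos := (upos u).
Local Notation moment := (moment u phi).

Let mx e t : measurable_fun setT (fun x : X => (upos (x, t) `^ e * phi (x, t))%:E).
Proof.
apply/measurable_EFinP; exact: (measurableT_comp (measurable_upos_powR u_meas mphi e) (pair2_measurable t)).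
Qed.

Let f0 e x t : (0 <= (upos (x, t) `^ e * phi (x, t))%:E)%E.
Proof. by rewrite lee_fin upos_powR_ge0. Qed.

(** That u^e phi = 0 almost everywhere means that u = 0 or phi = 0 there, whatever
[e] is. *)
Lemma moment_eq0 e e' t : 0 < e -> 0 < e' -> moment e t = 0%E -> moment e' t = 0%E.
Proof.
move=> e0 e'0 h.
have /(ae_eq_integral_abs dx measurableT (mx e t)) ae0 :
    (\int[dx]_(x in setT) `|(upos (x, t) `^ e * phi (x, t))%:E| = 0)%E.
  by rewrite -[RHS]h; apply: eq_integral => x _; rewrite gee0_abs.
rewrite /moment -[RHS](integral0 dx setT); apply: ae_eq_integral => //.
apply: filterS ae0 => x /(_ I) /= [] /eqP.
rewrite mulf_eq0 powR_eq0 => /orP[/andP[/eqP -> _] _|/eqP -> _]; last by rewrite mulr0.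
by rewrite powR0 ?gt_eqF// mul0r.
Qed.

Variables p q : R.
Hypothesis p0 : 0 < p.
Hypothesis q0 : 0 < q.

Let powR_young (l a b : R) : 0 < l -> 0 <= a ->
  a `^ ((p + q) / 2) <= l / 2 * a `^ p + (2 * l)^-1 * a `^ q.
Proof.
move=> l0 a0.
pose x := a `^ (p / 2); pose y := a `^ (q / 2).
have xx : x * x = a `^ p.
  rewrite /x -powRD; last by apply/implyP => /eqP; move: p0; lra.
  by congr powR; lra.
have yy : y * y = a `^ q.
  rewrite /y -powRD; last by apply/implyP => /eqP; move: q0; lra.
  by congr powR; lra.
have xy : x * y = a `^ ((p + q) / 2).
  rewrite /x /y -powRD; last by apply/implyP => /eqP; move: p0 q0; lra.
  by congr powR; lra.
rewrite -xx -yy -xy -subr_ge0.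
rewrite (_ : _ - _ = (2 * l)^-1 * (l * x - y) ^+ 2); last by field; rewrite gt_eqF.
by rewrite mulr_ge0 ?sqr_ge0// invr_ge0 mulr_ge0// ltW.
Qed.

(** Pointwise, u^s <= l/2 u^p + 1/(2l) u^q for every l > 0. Take l = 1/(lambda A_p)
when A_p is finite and positive; in the other cases the left-hand side is 0 or
the right-hand side infinite. *)
Lemma moment_young (lambda t : R) : 0 < lambda ->
  (moment ((p + q) / 2) t <=
   (lambda / 2)%:E * (moment p t * moment q t) + ((2 * lambda)^-1)%:E)%E.
Proof.
move=> l0; have s0 : 0 < (p + q) / 2 by rewrite divr_gt0// addr_gt0.
have li0 : (0 <= ((2 * lambda)^-1)%:E)%E by rewrite lee_fin invr_ge0 mulr_ge0// ltW.
have Ap0 : (0 <= moment p t)%E by exact: moment_ge0.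
have Aq0 : (0 <= moment q t)%E by exact: moment_ge0.
have [h|h] := eqVneq (moment p t) 0%E.
  by rewrite (moment_eq0 p0 s0 h) h mul0e mule0 add0e.
have [h'|h'] := eqVneq (moment q t) 0%E.
  by rewrite (moment_eq0 q0 s0 h') h' mule0 mule0 add0e.
have [Ap|] := boolP (moment p t \is a fin_num); last first.
  rewrite ge0_fin_numE// -leNgt leye_eq => /eqP ->.
  rewrite gt0_mulye; last by rewrite lt_neqAle eq_sym h' Aq0.
  by rewrite gt0_muley ?lte_fin ?divr_gt0// addye// leey.
pose a := fine (moment p t).
have aE : moment p t = a%:E by rewrite fineK.
have a0 : 0 < a by rewrite -lte_fin -aE lt_neqAle eq_sym h Ap0.
pose l := (lambda * a)^-1.
have lp : 0 < l by rewrite invr_gt0 mulr_gt0.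
have li : 0 <= (2 * l)^-1 by rewrite invr_ge0 mulr_ge0// ltW.
have l2 : 0 <= l / 2 by rewrite divr_ge0// ltW.
apply: (@le_trans _ _ ((l / 2)%:E * moment p t + ((2 * l)^-1)%:E * moment q t)%E).
  rewrite /moment -!ge0_integralZl// -ge0_integralD//; last 4 first.
  - by move=> x _; rewrite mule_ge0.
  - exact: measurable_funeM.
  - by move=> x _; rewrite mule_ge0.
  - exact: measurable_funeM.
  apply: ge0_le_integral_all => x _; first exact: f0.
  rewrite -!EFinM -EFinD lee_fin !mulrA -mulrDl ler_wpM2r//.
    by have /andP[] := phi01 (x, t).
  exact: (powR_young 0 lp (upos_ge0 u (x, t))).
rewrite aE addeC; apply: leeD; last first.
  by rewrite -EFinM lee_fin /l le_eqVlt; apply/orP; left; apply/eqP; field; rewrite !gt_eqF.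
rewrite muleA -EFinM lee_wpmul2r// lee_fin le_eqVlt; apply/orP; left; apply/eqP.
by rewrite /l; field; rewrite !gt_eqF.
Qed.

(** Where A_p A_q = 0 one of the two factors vanishes, and then A_s = 0; Tonelli's
theorem concludes. *)
Lemma moment_ae0 :
  (\int[leb]_t (moment p t * moment q t) = 0)%E ->
  {ae mu, forall z, upos z `^ ((p + q) / 2) * phi z = 0}.
Proof.
move=> h; have s0 : 0 < (p + q) / 2 by rewrite divr_gt0// addr_gt0.
have mA e : measurable_fun (setT : set (measurableTypeR R)) (moment e) by exact: measurable_moment.
have A0 e t : (0 <= moment e t)%E by exact: moment_ge0.
have mpq : measurable_fun (setT : set (measurableTypeR R)) (fun t => moment p t * moment q t)%E.
  exact: emeasurable_funM.
have /(ae_eq_integral_abs _ measurableT mpq) ae0 :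
    (\int[leb]_(t in setT) `|moment p t * moment q t| = 0)%E.
  by rewrite -[RHS]h; apply: eq_integral => t _; rewrite gee0_abs// mule_ge0.
have ms0 : (\int[leb]_t moment ((p + q) / 2) t = 0)%E.
  rewrite -[RHS](integral0 leb setT); apply: ae_eq_integral => //.
  apply: filterS ae0 => t /(_ I) /= /eqP; rewrite mule_eq0 => /orP[] /eqP ht _.
    exact: moment_eq0 ht.
  exact: moment_eq0 ht.
have mf : measurable_fun [set: mZ] (fun z => (upos z `^ ((p + q) / 2) * phi z)%:E).
  by apply/measurable_EFinP; exact: measurable_upos_powR.
have /(ae_eq_integral_abs mu measurableT mf) :
    (\int[mu]_(z in setT) `|(upos z `^ ((p + q) / 2) * phi z)%:E| = 0)%E.
  rewrite -[RHS]ms0 -(integral_moment u_meas mphi phi01).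
  by apply: eq_integral => z _; rewrite gee0_abs// lee_fin upos_powR_ge0.
by apply: filterS => z /(_ I) /= [].
Qed.

End moments.

(** * Decay of the energy *)

Lemma powR_le1D (R : realType) (a e : R) : 0 <= a -> 0 <= e <= 1 -> a `^ e <= 1 + a.
Proof.
move=> a0 /andP[e0 e1]; have [a1|/ltW a1] := leP a 1.
  by apply: (@le_trans _ _ (1 `^ e)); [rewrite ge0_ler_powR ?nnegrE|rewrite powR1 lerDl].
by apply: (@le_trans _ _ (a `^ 1)); [exact: ler_powR|rewrite powRr1// lerDr].
Qed.

(** Here w stands for the majorant and ph for the cutoff. For v <= 1 the power is
bounded, and for v > 1 the left-hand side is at most
4 v^(s e) ph^e = 4 (v^s ph)^e. *)
Lemma powR_absorb (R : realType) (v w ph s e : R) : 0 <= v -> 0 <= w <= 1 -> 0 <= ph ->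
  w <= ph `^ e -> 0 <= e <= 1 -> 0 <= s * e <= 2 ->
  (1 + v) `^ (s * e) * w <= 4 * (1 + v `^ s * ph).
Proof.
move=> v0 /andP[w0 w1] ph0 wph e01 /andP[se0 se2].
have vph : 0 <= v `^ s * ph by rewrite mulr_ge0// powR_ge0.
have two4 : (2 : R) `^ (s * e) <= 4.
  apply: (@le_trans _ _ ((2 : R) `^ 2)); first by apply: ler_powR => //; rewrite ler1n.
  by rewrite (powR_mulrn 2)//; lra.
have [v1|/ltW v1] := leP v 1.
  have h : (1 + v) `^ (s * e) <= 4.
    apply: (le_trans _ two4); rewrite ge0_ler_powR// ?nnegrE//; lra.
  apply: (@le_trans _ _ (4 * 1)); first by rewrite ler_pM// powR_ge0.
  by rewrite ler_pM2l// lerDl.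
apply: (@le_trans _ _ (4 * (v `^ (s * e) * w))).
  rewrite mulrA ler_wpM2r//; apply: (@le_trans _ _ ((2 * v) `^ (s * e))).
    by rewrite ge0_ler_powR// ?nnegrE; lra.
  by rewrite powRM//; apply: ler_wpM2r => //; exact: powR_ge0.
rewrite ler_pM2l//; apply: (@le_trans _ _ ((v `^ s * ph) `^ e)); last exact: powR_le1D.
by rewrite powRM ?powR_ge0// -powRrM ler_wpM2l// powR_ge0.
Qed.

Section fujita.
Context {R : realType} {N : nat}.
Local Notation leb := (@lebesgue_measure R).
Local Notation X := ('rV[R]_N).
Local Notation Z := ('rV[R]_N * R)%type.
Local Notation mZ := ('rV[R]_N * measurableTypeR R)%type.
Local Notation mu := (@dxdt R N).
Local Notation Omega := positive_times.

Hypothesis N1 : (1 <= N)%N.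
Variables (p q beta : R) (K : X -> R).
Hypothesis p0 : 0 < p.
Hypothesis q0 : 0 < q.
Hypothesis hK : admissible_kernel beta K.
Hypothesis hbeta : 0 < beta < 1.
Hypothesis hpq : 2 < p + q <= 2 + 2 * (1 - beta) / (N%:R + beta).

Variables (u ut : Z -> R) (Du : Z -> X).
Hypothesis uW : W12loc u ut Du.
Hypothesis u_ge0 : {ae mu, forall z, Omega z -> 0 <= u z}.
Hypothesis A_L2 : forall i, L2loc (fun z => mean_curvature_op (Du z) 0 i).
Hypothesis source_L1 : L1loc (source K p q u).
Hypothesis test : forall M tau (f : Z -> R), 0 < tau -> C1c f -> (forall z, 0 <= f z) ->
  supp f `<=` box M tau M -> weak_ineq K p q u ut Du f.

Let s := (p + q) / 2.
Let u_meas : measurable_fun (Omega : set mZ) (u : mZ -> R).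
Proof. by have [[]] := uW. Qed.
Let K_pos : forall x, x != 0 -> 0 < K x. Proof. by have [] := hK. Qed.
Let b0 : 0 < beta. Proof. by case/andP: hbeta. Qed.
Let Nb0 : 0 < N%:R + beta. Proof. by rewrite ltr_wpDl. Qed.
Let s_gt1 : 1 < s. Proof. by rewrite /s; case/andP: hpq; lra. Qed.
Let s_fujita : (N%:R + beta) * (s - 1) <= 1 - beta.
Proof.
have /andP[_ h] := hpq.
by rewrite mulrC -ler_pdivlMr// /s; lra.
Qed.
Let s_lt2 : s < 2.
Proof.
have N1' : (1 : R) <= N%:R by rewrite ler1n.
by have := s_fujita; have := s_gt1; have := b0; nra.
Qed.

(** The ratio k/(k+1) tends to 1 and s > 1. *)
Lemma exponent_choice : exists k : nat, (0 < k)%N /\ 1 < s * (k%:R / k.+1%:R) < 2.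
Proof.
have h : 0 <= (s - 1)^-1 by rewrite invr_ge0 subr_ge0 ltW.
have := archi_boundP h; set b := Num.bound _ => hb.
have [k kb] : exists k, k = b.+1 by exists b.+1.
exists k; split; first by rewrite kb.
have k1 : (s - 1)^-1 < k%:R by apply: lt_trans hb _; rewrite kb ltr_nat.
have {}kb : (0 < k)%N by rewrite kb.
have k0 : 0 < k.+1%:R :> R by rewrite ltr0n.
have kS : k.+1%:R = k%:R + 1 :> R by rewrite -natr1.
have kp : 0 < k%:R :> R by rewrite ltr0n.
have s1 : 0 < s - 1 by rewrite subr_gt0.
move: k1; rewrite invf_plt// => k1.
have : 1 < k%:R * (s - 1) by rewrite mulrC -ltr_pdivrMr// div1r.
rewrite mulrA ltr_pdivlMr// ltr_pdivrMr// kS => h'.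
have s2 := s_lt2; apply/andP; split; nra.
Qed.

Variable k : nat.
Hypothesis k0 : (0 < k)%N.
Hypothesis k_exp : 1 < s * (k%:R / k.+1%:R) < 2.

(** Written S in the overview. *)
Definition energy (r tau : R) : \bar R :=
  (\int[mu]_(z in Omega) (source K p q u z * (cutoff k.+1 r tau z)%:E))%E.

Lemma energy_ge0 r tau : (0 <= energy r tau)%E.
Proof.
apply: integral_ge0 => z _; rewrite mule_ge0 ?lee_fin ?cutoff_ge0//.
exact: source_ge0.
Qed.

Lemma energy_le r1 r2 tau : 0 < r1 -> r1 <= r2 -> (energy r1 tau <= energy r2 tau)%E.
Proof.
move=> r0 r12; have s0 z : (0 <= source K p q u z)%E by exact: source_ge0.
apply: ge0_le_integral_all => z _; first by rewrite mule_ge0// lee_fin cutoff_ge0.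
by rewrite lee_wpmul2l// lee_fin cutoff_le.
Qed.

(** [key_inequality] has one bound M for space and time, and r <= r^2. *)
Lemma cutoff_off_box r tau (z : Z) : 1 <= r -> 0 < tau -> ~ box (r ^+ 2) tau (r ^+ 2) z ->
  cutoff k.+1 r tau z = 0.
Proof.
case: z => x t r1 tau0 Bz; have r0 : 0 < r by exact: lt_le_trans r1.
have rr : r <= r ^+ 2 by rewrite expr2 ler_peMl// ltW.
apply/eqP; apply: contra_notT Bz => cz.
have h1 i : `|x 0 i| < r.
  by rewrite ltNge; apply: contra cz => h; rewrite (cutoff_eq0 _ r0)//; constructor; exists i.
have h2 : `|t| < r ^+ 2.
  by rewrite ltNge; apply: contra cz => h; rewrite (cutoff_eq0 _ r0)//; constructor 2.
have h3 : tau < t.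
  by rewrite ltNge; apply: contra cz => h; rewrite (cutoff_eq0 _ r0)//; constructor 3.
split => /= [i|]; first by rewrite -ler_norml (le_trans (ltW (h1 i))).
by rewrite (ltW h3)/= (le_trans (ler_norm _) (ltW h2)).
Qed.

(** Finiteness is needed for the absorption argument; it comes from the local
integrability of the source. *)
Lemma energy_lty r tau : 1 <= r -> 0 < tau -> (energy r tau < +oo)%E.
Proof.
move=> r1 tau0; pose B : set mZ := box (r ^+ 2) tau (r ^+ 2).
have s0 z : (0 <= source K p q u z)%E by exact: source_ge0.
have /integrableP[_ h] := source_L1 (@compact_box R N (r ^+ 2) tau (r ^+ 2)) (@box_Omega R N _ _ _ tau0).
apply: le_lt_trans h; rewrite /energy integral_mkcond [leRHS]integral_mkcond.
apply: ge0_le_integral_all => z _.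
  by rewrite patchE; case: ifP => // _; rewrite mule_ge0// lee_fin cutoff_ge0.
rewrite !patchE; have [Bz|Bz] := pselect (B z).
  rewrite [X in (_ <= if X then _ else _)%E](_ : _ = true); last exact: mem_set.
  rewrite gee0_abs//; case: ifP => // _.
  by rewrite -[leRHS]mule1 lee_wpmul2l// lee_fin cutoff_le1.
rewrite cutoff_off_box// mule0; case: ifP => _; case: ifP => _ //; exact: abse_ge0.
Qed.

Let phi01 r tau (z : mZ) : 0 <= cutoff k.+1 r tau z <= 1.
Proof. by rewrite cutoff_ge0 cutoff_le1. Qed.

Let d := s * (k%:R / k.+1%:R) - 1.

Lemma measurable_cutoff r tau : 1 <= r -> measurable_fun setT (cutoff k.+1 r tau : mZ -> R).
Proof.
move=> r1; have [C _ HC] := cutoff_deriv (R := R) (N := N) k.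
have [Cphi _ _] := HC r tau r1.
by apply: measurable_continuous_spacetime; exact: C1_continuous.
Qed.

Lemma energy_ge_moment : exists2 c : R, 0 < c & forall r tau, 1 <= r ->
  ((c * r `^ (- beta))%:E * \int[leb]_t
     (moment u (cutoff k.+1 r tau) p t * moment u (cutoff k.+1 r tau) q t) <= energy r tau)%E.
Proof.
have [c c0 Hc] := admissible_kernel_lower_bound N1 b0 hK.
exists c => // r tau r1; have r0 : 0 < r by exact: lt_le_trans r1.
apply: (@source_lower_bound R N N1 K p q u K_pos p0 q0 u_meas (cutoff k.+1 r tau) r (c * r `^ (- beta))) => //.
- exact: measurable_cutoff.
- by move=> x t i xr; apply: cutoff_eq0 => //; constructor; exists i; exact: ltW.
- by rewrite mulr_ge0 ?powR_ge0// ltW.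
- by move=> w w0 wr; exact: Hc.
Qed.

Lemma energy_le_moment : exists2 C : R, 0 < C & forall r tau kappa, 1 <= r -> 0 < tau -> 0 < kappa ->
  (energy r tau <= (C * kappa / r ^+ 2)%:E *
    (((2 * r) ^+ N * r ^+ 2)%:E + (kappa `^ (- s))%:E *
      \int[leb]_t moment u (cutoff k.+1 r tau) s t))%E.
Proof.
have [C C0 HC] := cutoff_deriv (R := R) (N := N) k.
have d01 : 0 < d < 1.
  by rewrite /d; move: k_exp; move: (s * _) => e /andP[e1 e2]; apply/andP; split; lra.
have d0 : 0 < d by case/andP: d01.
exists (4 * (4 + d^-1) * C); first by rewrite !mulr_gt0// addr_gt0// invr_gt0.
move=> r tau kappa r1 tau0 kp0.
have r0 : 0 < r by exact: lt_le_trans r1.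
have r20 : 0 < r ^+ 2 by rewrite exprn_gt0.
have [Cphi Hg Ht] := HC r tau r1.
set phi := cutoff k.+1 r tau in Cphi Hg Ht *.
have W0 (z : Z) : 0 <= space_time_cutoff r z ^+ k * time_ramp tau z.2.
  by rewrite mulr_ge0 ?time_ramp_ge0// exprn_ge0// space_time_cutoff_ge0.
have psi0 (z : Z) : 0 <= cutoff_majorant C k r tau z.
  apply: mulr_ge0 => //; apply: mulr_ge0; last exact: ltW.
  by rewrite invr_ge0 ltW.
have cp := caccioppoli uW u_ge0 A_L2 (@source_ge0 R N N1 K p q u K_pos) tau0
  (fun f cf f0 sf => test tau0 cf f0 sf) Cphi (cutoff_ge0 _ _ _)
  (fun z => @cutoff_off_box r tau z r1 tau0) psi0 Hg Ht d01 kp0.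
apply: (le_trans cp).
pose B : set mZ := box r 0 (r ^+ 2).
have mB : measurable B by exact: measurable_box.
pose Q := 4 * (4 + d^-1) * C * kappa / r ^+ 2.
have Q0 : 0 <= Q by rewrite /Q !mulr_ge0 ?invr_ge0 ?addr_ge0 ?invr_ge0// ltW.
have mphi : measurable_fun setT (phi : mZ -> R) by exact: measurable_cutoff.
have mup := measurable_upos_powR u_meas mphi s.
have up0 z : 0 <= upos u z `^ s * phi z by exact: upos_powR_ge0 (phi01 r tau) _ _.
apply: (@le_trans _ _ (\int[mu]_z (Q%:E * ((\1_B z)%:E + (kappa `^ (- s))%:E * (upos u z `^ s * phi z)%:E)))%E).
  apply: ge0_le_integral_all => z _.
    rewrite lee_fin; apply: mulr_ge0; last exact: psi0.
    by rewrite !mulr_ge0 ?powR_ge0 ?addr_ge0 ?invr_ge0// ltW.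
  have -> : (Q%:E * ((\1_B z)%:E + (kappa `^ (- s))%:E * (upos u z `^ s * phi z)%:E))%E =
      (Q * (\1_B z + kappa `^ (- s) * (upos u z `^ s * phi z)))%:E by [].
  rewrite lee_fin /caccioppoli_rhs.
  have [W0z|Wz] := eqVneq (space_time_cutoff r z ^+ k * time_ramp tau z.2) 0.
    rewrite /cutoff_majorant W0z !mulr0 mulr_ge0// addr_ge0//.
    by rewrite mulr_ge0 ?powR_ge0.
  move: Wz; rewrite mulf_eq0 negb_or => /andP[Xz tz].
  have zt : tau < z.2 by rewrite ltNge; apply: contra tz => /time_ramp0 ->.
  have Bz : B z.
    case: z zt Xz {tz} => x t /= zt Xz.
    have h1 i : `|x 0 i| < r.
      rewrite ltNge; apply: contra Xz => h.
      by rewrite (space_time_cutoff_eq0 r0 (or_introl _)) ?expr0n ?eqn0Ngt ?k0//; exists i.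
    have h2 : `|t| < r ^+ 2.
      rewrite ltNge; apply: contra Xz => h.
      by rewrite (space_time_cutoff_eq0 r0 (or_intror h)) expr0n eqn0Ngt k0.
    split => /= [i|]; first by rewrite -ler_norml ltW.
    by rewrite (ltW (lt_trans tau0 zt))/= (le_trans (ler_norm _) (ltW h2)).
  have uE : Num.max 0 (u z) = upos u z.
    by rewrite /upos patchE mem_set//; exact: lt_trans zt.
  rewrite uE indicE mem_set//=.
  have v0 : 0 <= upos u z / kappa by rewrite divr_ge0 ?upos_ge0// ltW.
  have e01 : 0 <= (k%:R / k.+1%:R : R) <= 1.
    by rewrite divr_ge0//= ler_pdivrMr// mul1r ler_nat.
  have w01 : 0 <= space_time_cutoff r z ^+ k * time_ramp tau z.2 <= 1.
    rewrite W0/= -[leRHS]mulr1 ler_pM ?time_ramp_ge0 ?time_ramp_le1// ?exprn_ge0 ?space_time_cutoff_ge0//.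
    by rewrite exprn_ile1 ?space_time_cutoff_ge0 ?space_time_cutoff_le1.
  have se : 0 <= s * (k%:R / k.+1%:R) <= 2 by move: k_exp; move: (s * _) => e /andP[e1 e2]; apply/andP; split; lra.
  have := powR_absorb v0 w01 (cutoff_ge0 k.+1 r tau z) (cutoff_majorant_le k r tau z) e01 se.
  rewrite -/phi (_ : s * (k%:R / k.+1%:R) = 1 + d); last by rewrite /d; ring.
  have -> : (upos u z / kappa) `^ s = kappa `^ (- s) * upos u z `^ s.
    by rewrite powRM ?upos_ge0 ?invr_ge0 ?(ltW kp0)// mulrC -(powR_inv1 (ltW kp0)) -powRrM mulN1r.
  move=> h; rewrite /cutoff_majorant.
  set W := _ * time_ramp _ _ in h *; set Y := (1 + _) `^ _ in h *.
  have -> : kappa * (4 + d^-1) * Y * ((r ^+ 2)^-1 * C * W) = (Q / 4) * (Y * W).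
    by rewrite /Q; field; rewrite !gt_eqF.
  apply: (@le_trans _ _ (Q / 4 * (4 * (1 + kappa `^ (- s) * upos u z `^ s * phi z)))).
    by rewrite ler_wpM2l// divr_ge0.
  by rewrite le_eqVlt; apply/orP; left; apply/eqP; field.
have ks0 : (0 <= (kappa `^ (- s))%:E)%E by rewrite lee_fin powR_ge0.
have m1 : measurable_fun [set: mZ] (fun z => (\1_B z : R)%:E) by apply/measurable_EFinP.
have m2 : measurable_fun [set: mZ] (fun z => (upos u z `^ s * phi z)%:E) by apply/measurable_EFinP.
have m3 : measurable_fun [set: mZ] (fun z => (kappa `^ (- s))%:E * (upos u z `^ s * phi z)%:E)%E.
  exact: measurable_funeM.
rewrite ge0_integralZl//; last 2 first.
- exact: emeasurable_funD.
- by move=> z _; rewrite adde_ge0 ?mule_ge0 ?lee_fin.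
rewrite lee_wpmul2l ?lee_fin// ge0_integralD//; last first.
  by move=> z _; rewrite mule_ge0 ?lee_fin.
rewrite integral_indic// setIT; apply: leeD.
  have r20' := ltW r20.
  have muB : mu B = ((2 * r) ^+ N * r ^+ 2)%:E.
    by rewrite -[r ^+ 2 in RHS]subr0; exact: (@dxdt_box R N _ _ _ (ltW r0) r20').
  suff : (mu B <= ((2 * r) ^+ N * r ^+ 2)%:E)%E by [].
  by rewrite muB.
rewrite ge0_integralZl//; last by move=> z _; rewrite lee_fin.
by rewrite (integral_moment u_meas mphi (phi01 r tau)).
Qed.

(** The moments vanish for t outside [0, r^2], so the constant 1/(2 lambda)
is integrated over an interval of length r^2. *)
Lemma moment_integral_le (r tau lambda : R) : 1 <= r -> 0 < tau -> 0 < lambda ->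
  (\int[leb]_t moment u (cutoff k.+1 r tau) s t <=
   (lambda / 2)%:E * \int[leb]_t
      (moment u (cutoff k.+1 r tau) p t * moment u (cutoff k.+1 r tau) q t) +
   (r ^+ 2 / (2 * lambda))%:E)%E.
Proof.
move=> r1 tau0 l0; have r0 : 0 < r by exact: lt_le_trans r1.
set phi := cutoff k.+1 r tau.
have mphi : measurable_fun setT (phi : mZ -> R) by exact: measurable_cutoff.
have mA e := measurable_moment u_meas mphi (phi01 r tau) e.
have A0 e t : (0 <= moment u phi e t)%E by exact: (moment_ge0 u (phi01 r tau)).
have r20 : 0 < r ^+ 2 by rewrite exprn_gt0.
have li0 : 0 <= (2 * lambda)^-1 by rewrite invr_ge0 mulr_ge0// ltW.
pose J : set (measurableTypeR R) := `[0, r ^+ 2]%classic.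
have mJ : measurable J by exact: measurable_itv.
have mpq : measurable_fun (setT : set (measurableTypeR R)) (fun t => moment u phi p t * moment u phi q t)%E.
  by apply: emeasurable_funM; exact: mA.
apply: (@le_trans _ _ (\int[leb]_t
   ((lambda / 2)%:E * (moment u phi p t * moment u phi q t) + ((2 * lambda)^-1 * \1_J t)%:E))%E).
  apply: ge0_le_integral_all => t _ //.
  have [Jt|Jt] := pselect (J t).
    rewrite indicE mem_set// mulr1.
    exact: (moment_young u_meas mphi (phi01 r tau) p0 q0 t l0).
  rewrite [moment u phi s t](_ : _ = 0%E).
    by rewrite adde_ge0 ?lee_fin ?mulr_ge0// mule_ge0 ?mule_ge0// lee_fin divr_ge0// ltW.
  apply: integral0_eq => x _; suff -> : phi (x, t) = 0 by rewrite mulr0.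
  apply: cutoff_eq0 => //.
  have [t0|t0] := ltP t 0; first by constructor 3; exact: ltW (lt_trans t0 tau0).
  constructor 2; rewrite ger0_norm// leNgt; apply: contra_notN Jt => tr.
  by rewrite /J /= in_itv/= t0 ltW.
have l2 : (0 <= (lambda / 2)%:E)%E by rewrite lee_fin divr_ge0// ltW.
have mi : measurable_fun (setT : set (measurableTypeR R)) (fun t => ((2 * lambda)^-1 * \1_J t)%:E).
  by apply/measurable_EFinP; apply: measurable_funM => //; exact: measurable_indic.
rewrite ge0_integralD//; last 3 first.
- by move=> t _; rewrite mule_ge0// mule_ge0.
- exact: measurable_funeM.
- by move=> t _; rewrite lee_fin mulr_ge0.
rewrite ge0_integralZl//; last by move=> t _; rewrite mule_ge0.
apply: leeD => //.
under eq_integral do rewrite EFinM.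
rewrite ge0_integralZl ?lee_fin//; last first.
  by apply/measurable_EFinP; exact: measurable_indic.
rewrite integral_indic// setIT.
have JE : leb J = (r ^+ 2)%:E.
  by rewrite lebesgue_measure_itv/= lte_fin r20 -EFinB subr0.
by rewrite [X in (_ * X)%E]JE -EFinM lee_fin mulrC.
Qed.

(** Take kappa = r^(-(N+beta)) and choose lambda so that half of the energy is
absorbed. The two remaining terms are the measure of the box times
kappa r^(-2), and a power of r whose exponent is at most -beta by
[s_fujita]. *)
Lemma energy_decay : exists2 C : R, 0 < C & forall r tau, 1 <= r -> 0 < tau ->
  (energy r tau <= (C * r `^ (- beta))%:E)%E.
Proof.
have [C C0 HC] := energy_le_moment.
have [c1 c10 Hc1] := energy_ge_moment.
exists (2 * C * 2 ^+ N + C ^+ 2 / c1).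
  by rewrite ltr_pwDl ?divr_ge0 ?sqr_ge0 ?(ltW c10)// !mulr_gt0// exprn_gt0.
move=> r tau r1 tau0; have r0 : 0 < r by exact: lt_le_trans r1.
pose kappa := r `^ (- (N%:R + beta)).
have kp0 : 0 < kappa by exact: powR_gt0.
pose c := c1 * r `^ (- beta).
have c0 : 0 < c by rewrite mulr_gt0// powR_gt0.
pose Q := C * kappa / r ^+ 2; pose ks := kappa `^ (- s).
have Q0 : 0 < Q by rewrite divr_gt0 ?exprn_gt0// mulr_gt0.
have ks0 : 0 < ks by exact: powR_gt0.
(* chosen so that the term Q ks (lambda / 2) int A_p A_q is at most half of the
   energy, by [energy_ge_moment] *)
pose lambda := c / (Q * ks).
have l0 : 0 < lambda by rewrite divr_gt0// mulr_gt0.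
have low := Hc1 r tau r1.
have up := HC r tau kappa r1 tau0 kp0.
have mid := moment_integral_le r1 tau0 l0.
pose A := (\int[leb]_t (moment u (cutoff k.+1 r tau) p t * moment u (cutoff k.+1 r tau) q t))%E.
rewrite -/A in low mid.
set E := energy r tau in low up *.
pose I := (\int[leb]_t moment u (cutoff k.+1 r tau) s t)%E.
rewrite -/I in up mid.
have Efin : E \is a fin_num by rewrite ge0_fin_numE ?energy_ge0 ?energy_lty.
have A0 : (0 <= A)%E by apply: integral_ge0 => t _; rewrite mule_ge0// moment_ge0.
have Afin : A \is a fin_num.
  rewrite ge0_fin_numE// ltNge; apply/negP; rewrite leye_eq => /eqP Aoo.
  have : (+oo <= E)%E by move: low; rewrite Aoo gt0_muley ?lte_fin.
  by rewrite leNgt energy_lty.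
move: low up mid; rewrite -(fineK Efin) -(fineK Afin).
move: (fine E) (fine A) => e a.
rewrite -EFinM lee_fin => low up mid.
have {}up : (e%:E <= Q%:E * (((2 * r) ^+ N * r ^+ 2)%:E + ks%:E * ((lambda / 2 * a)%:E + (r ^+ 2 / (2 * lambda))%:E)))%E.
  apply: (le_trans up); rewrite lee_wpmul2l ?lee_fin ?(ltW Q0)// leeD2l// lee_wpmul2l ?lee_fin ?(ltW ks0)//.
have {}up : e <= Q * ((2 * r) ^+ N * r ^+ 2 + ks * (lambda / 2 * a + r ^+ 2 / (2 * lambda))).
  by rewrite -lee_fin; exact: up.
have {}low : c * a <= e := low.
have e1 : Q * (ks * (lambda / 2 * a)) = c * a / 2.
  by rewrite /lambda; field; rewrite !gt_eqF.
have e2 : Q * (ks * (r ^+ 2 / (2 * lambda))) = (Q * ks) ^+ 2 * r ^+ 2 / (2 * c).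
  by rewrite /lambda; field; rewrite !gt_eqF.
have {up} : e <= 2 * (Q * ((2 * r) ^+ N * r ^+ 2)) + (Q * ks) ^+ 2 * r ^+ 2 / c.
  have : (Q * ks) ^+ 2 * r ^+ 2 / c = 2 * ((Q * ks) ^+ 2 * r ^+ 2 / (2 * c)) by field; rewrite gt_eqF.
  by move: up; rewrite !mulrDr e1 e2; lra.
move/le_trans; apply.
have rr e' f' : r `^ e' * r `^ f' = r `^ (e' + f').
  by rewrite powRD//; apply/implyP => _; rewrite gt_eqF.
have r2 : r ^+ 2 = r `^ 2 by rewrite (powR_mulrn 2 (ltW r0)).
have ri2 : (r ^+ 2)^-1 = r `^ (- 2) by rewrite r2 powRN.
have rN : r ^+ N = r `^ N%:R by rewrite powR_mulrn// ltW.
have t1 : Q * ((2 * r) ^+ N * r ^+ 2) = C * 2 ^+ N * r `^ (- beta).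
  rewrite /Q exprMn rN (_ : _ * _ = C * 2 ^+ N * (kappa * r `^ N%:R)); last by field; rewrite gt_eqF.
  by rewrite /kappa rr; congr (_ * _ `^ _); ring.
have t2 : (Q * ks) ^+ 2 * r ^+ 2 / c = C ^+ 2 / c1 * r `^ (2 * ((N%:R + beta) * (s - 1)) - 2 + beta).
  have ksE : ks = r `^ ((N%:R + beta) * s) by rewrite /ks /kappa -powRrM mulrNN.
  have ci : c^-1 = c1^-1 * r `^ beta.
    by rewrite /c invfM powRN invrK.
  rewrite /Q ri2 ksE ci r2 /kappa.
  rewrite (_ : _ * _ = C ^+ 2 / c1 * ((r `^ (- (N%:R + beta)) * r `^ (- 2) * r `^ ((N%:R + beta) * s)) * (r `^ (- (N%:R + beta)) * r `^ (- 2) * r `^ ((N%:R + beta) * s)) * r `^ 2 * r `^ beta)); last by ring.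
  by rewrite !rr; congr (_ * _ `^ _); ring.
rewrite t1 t2 [leRHS]mulrDl; apply: lerD.
  by rewrite !mulrA.
rewrite ler_wpM2l ?divr_ge0 ?sqr_ge0 ?(ltW c10)//.
apply: ler_powR => //.
by have := s_fujita; lra.
Qed.

(** The energy increases with r and tends to 0. *)
Lemma energy_eq0 r tau : 1 <= r -> 0 < tau -> energy r tau = 0%E.
Proof.
move=> r1 tau0; have [C C0 HC] := energy_decay.
apply/eqP; rewrite eq_le energy_ge0 andbT.
apply/lee_addgt0Pr => e e0; rewrite add0e.
pose y := (C / e) `^ (beta^-1).
have y0 : 0 < y by rewrite powR_gt0// divr_gt0.
have r0 : 0 < r by exact: lt_le_trans r1.
apply: (le_trans (energy_le tau r0 (_ : r <= Num.max r y))); first by rewrite le_max lexx.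
apply: (le_trans (HC (Num.max r y) tau _ tau0)); first by rewrite le_max r1.
rewrite lee_fin.
have h : Num.max r y `^ (- beta) <= y `^ (- beta).
  by apply: ler_powRN; rewrite ?le_max ?lexx ?orbT// ltW.
apply: (@le_trans _ _ (C * y `^ (- beta))); first by rewrite ler_pM2l.
rewrite /y -powRrM mulrN mulVf ?gt_eqF// powRN powRr1; last by rewrite divr_ge0// ltW.
by rewrite invf_div mulrC divfK// gt_eqF.
Qed.

Lemma solution_vanishes_on_cutoff r tau : 1 <= r -> 0 < tau ->
  {ae mu, forall z, upos u z `^ s * cutoff k.+1 r tau z = 0}.
Proof.
move=> r1 tau0; have r0 : 0 < r by exact: lt_le_trans r1.
have [c c0 Hc] := energy_ge_moment.
apply: (moment_ae0 u_meas (measurable_cutoff tau r1) (phi01 r tau) p0 q0).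
have low := Hc r tau r1.
move: low; rewrite energy_eq0// => low.
apply/eqP; rewrite eq_le integral_ge0 ?andbT; last by move=> t _; rewrite mule_ge0// moment_ge0.
by move: low; rewrite pmule_rle0// lte_fin mulr_gt0// powR_gt0.
Qed.

(** The cutoffs with r = n + 1 and tau = 1/(n + 1) exhaust the half-space t > 0. *)
Lemma solution_trivial : {ae mu, forall z, Omega z -> u z = 0}.
Proof.
have H n := @solution_vanishes_on_cutoff n.+1%:R n.+1%:R^-1 (ltac:(by rewrite ler1n)) (ltac:(by rewrite invr_gt0)).
have h1 : {ae mu, forall z : mZ, Omega z -> 0 <= u z} := u_ge0.
suff h2 : {ae mu, forall z : mZ, Omega z -> u z = 0} by [].
have := ae_foralln H; have := h1; apply: filterS2 => z uz hz Oz.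
have u0 := uz Oz.
have uE : upos u z = u z by rewrite /upos patchE mem_set// (max_idPr u0).
pose n := Num.bound (`|z : Z| + (z.2)^-1).
have zi0 : 0 <= (z.2)^-1 by rewrite invr_ge0 ltW.
have nz : `|z : Z| + (z.2)^-1 < n.+1%:R.
  apply: lt_le_trans (archi_boundP _) _; first by rewrite addr_ge0.
  by rewrite ler_nat.
have n0 : 0 < n.+1%:R :> R by rewrite ltr0n.
have := hz n; case: z uz hz Oz u0 uE n zi0 nz n0 => x t /= uz hz Oz u0 uE n zi0 nz n0.
have xt : `|(x, t) : Z| < n.+1%:R by apply: le_lt_trans nz; rewrite lerDl.
have cpos : 0 < cutoff k.+1 n.+1%:R n.+1%:R^-1 (x, t).
  apply: cutoff_gt0 => //.
  - by move=> i; exact: le_lt_trans (norm_coord (x, t) i) xt.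
  - apply: le_lt_trans (norm_time (x, t)) _; apply: (lt_le_trans xt).
    by rewrite expr2 ler_peMl// ler1n.
  - rewrite invf_plt ?posrE//; apply: le_lt_trans nz; rewrite lerDr; exact: normr_ge0.
move/eqP; rewrite mulf_eq0 (gt_eqF cpos) orbF powR_eq0 => /andP[/eqP h _].
by rewrite -uE.
Qed.

End fujita.

(** * Nonexistence *)

Theorem corollary1p2 (R : realType) (N : nat) (hN : (1 <= N)%N)
  (p q beta : R) (hp : 0 < p) (hq : 0 < q)
  (K : 'rV[R]_N -> R) (hK : admissible_kernel beta K)
  (u0 : 'rV[R]_N -> R) (hu0 : space_L1loc u0)
  (hu0_ge0 : {ae lebesgue_rV R N, forall x, 0 <= u0 x})
  (hbeta : 0 < beta < 1)
  (hpq : 2 < p + q <= 2 + 2 * (1 - beta) / (N%:R + beta)) :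
  ~ exists u : 'rV[R]_N * R -> R, weak_solution K p q u0 u /\ nontrivial u.
Proof.
move=> [u [[u_ge0 [ut [Du [uW A_L2 source_L1 ineq]]]] unontriv]].
apply: unontriv.
have [k [k0 kexp]] := exponent_choice hN hbeta hpq.
apply: (solution_trivial hN hp hq hK hbeta hpq uW u_ge0 A_L2 source_L1 _ k0 kexp).
move=> M tau f tau0 cf f0 sf; case: ineq => [/(_ f cf f0)//|/(_ f cf f0)].
exact: (weak_ineq_initial_away uW tau0 cf sf).
Qed.
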